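(* Let $A(z)$ and $B(z)$ be entire functions and let $f$ be a solution of $$f''+A(z)f'+B(z)f=0.$$ Suppose that $f$ and $A$ are transcendental exponential polynomials and that $B$ satisfies $T(r,B)=o(T(r,A))$ as $r\to\infty$. Then: (a) $f$ and $A$ are dual exponential polynomials of some common order $q\in\mathbb{N}$; $f$ has a normalized representation of the form $$f(z)=c+F_1(z)e^{w_1z^q}+\cdots+F_m(z)e^{w_mz^q},$$ where $m\in\mathbb{N}$, $c\in\mathbb{C}\setminus\{0\}$, the $w_j$ are non-zero and pairwise distinct, and the $F_j\not\equiv 0$ are exponential polynomials of order $\le q-1$; and $B$ is an exponential polynomial of order $\rho(B)\le q-1$. (b) The non-zero frequencies of $f$ are commensurable if and only if the non-zero frequencies of $A$ are commensurable. In both cases, $f$ and $A$ are strongly dual exponential polynomials.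
   Context: An exponential polynomial is a function $f(z)=P_1(z)e^{Q_1(z)}+\cdots+P_k(z)e^{Q_k(z)}$ with polynomials $P_j,Q_j$; polynomials are exponential polynomials of order $0$. A transcendental exponential polynomial $f$ can be written uniquely in the normalized form $f(z)=F_0(z)+F_1(z)e^{w_1z^q}+\cdots+F_m(z)e^{w_mz^q}$, where $q=\max_j \deg Q_j\ge 1$ equals the order $\rho(f)$ of $f$, the (non-zero) frequencies $w_1,\dots,w_m$ are non-zero and pairwise distinct complex numbers, and the multipliers $F_j$ are exponential polynomials of order $\le q-1$ with $F_j\not\equiv0$ for $1\le j\le m$ ($F_0$ may vanish). $f$ is called simple if all its non-zero frequencies lie on one ray $\arg w=\theta$. Two simple exponential polynomials $f,g$ of the same order $q$ are dual if the non-zero frequencies of $f$ lie on a ray $\arg w=\theta$ and those of $g$ on the opposite ray $\arg w=\theta+\pi$. The non-zero frequencies $w_1,\dots,w_m$ of a simple exponential polynomial are commensurable if there is $w\in\mathbb{C}\setminus\{0\}$ (a common factor) with $w_j/w$ a positive integer for every $j$. Dual exponential polynomials $f$ and $g$ with non-zero frequencies $\{w_j\}$ and $\{\lambda_i\}$ are strongly dual if both sets of frequencies are commensurable, with common factor $w$ for $\{w_j\}$ and common factor $-w$ for $\{\lambda_i\}$ for the same $w$, and all the points $w_j+\lambda_i$ (over all $i,j$) lie on a single ray emanating from the origin (the origin included). $T(r,\cdot)$ denotes the Nevanlinna characteristic function. *)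

(* Defs.v *)
From Stdlib Require Import Reals List.
From Coquelicot Require Import Coquelicot.
Import ListNotations.
Open Scope R_scope.

Definition cexp (z : C) : C :=
  (exp (fst z) * cos (snd z), exp (fst z) * sin (snd z))%R.

Fixpoint cpow (z : C) (n : nat) : C :=
  match n with O => RtoC 1 | S k => Cmult z (cpow z k) end.

Definition peval (l : list C) (z : C) : C :=
  fold_right (fun a acc => Cplus a (Cmult z acc)) (RtoC 0) l.

Definition is_polynomial (f : C -> C) : Prop :=
  exists l : list C, forall z, f z = peval l z.

Definition expsum (t : list (list C * list C)) (z : C) : C :=
  fold_right (fun pq acc => Cplus (Cmult (peval (fst pq) z) (cexp (peval (snd pq) z))) acc)
    (RtoC 0) t.

(** [f] is an exponential polynomial admitting a representation
    sum_j P_j e^{Q_j} with deg Q_j <= p for all j, i.e. (for exponential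
    polynomials) an exponential polynomial of order rho(f) <= p. *)
Definition expoly_le (p : nat) (f : C -> C) : Prop :=
  exists t : list (list C * list C),
    (forall pq, In pq t -> (length (snd pq) <= S p)%nat) /\
    forall z, f z = expsum t z.

Definition expoly (f : C -> C) : Prop := exists p, expoly_le p f.

Definition trans_expoly (f : C -> C) : Prop := expoly f /\ ~ is_polynomial f.

Definition entire (g : C -> C) : Prop :=
  forall z : C, @ex_derive C_AbsRing C_NormedModule g z.

Definition solves_ode (A B f : C -> C) : Prop :=
  exists f1 f2 : C -> C,
    (forall z, @is_derive C_AbsRing C_NormedModule f z (f1 z)) /\
    (forall z, @is_derive C_AbsRing C_NormedModule f1 z (f2 z)) /\
    (forall z, Cplus (f2 z) (Cplus (Cmult (A z) (f1 z)) (Cmult (B z) (f z))) = RtoC 0).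

(** Nevanlinna characteristic of an ENTIRE function g:
    T(r,g) = m(r,g) = (1/2pi) int_0^{2pi} log^+ |g(r e^{i theta})| d theta
    (the counting function N(r,g) of poles vanishes for entire g). *)
Definition nevT (g : C -> C) (r : R) : R :=
  / (2 * PI) * RInt (fun th => Rmax 0 (ln (Cmod (g (Cmult (RtoC r) (cexp (0, th))))))) 0 (2 * PI).

Definition little_o_infty (phi psi : R -> R) : Prop :=
  forall eps : R, 0 < eps -> exists R0 : R, forall r, R0 <= r -> Rabs (phi r) <= eps * Rabs (psi r).

Definition normal_rep (f : C -> C) (q : nat) (F0 : C -> C) (t : list (C * (C -> C))) : Prop :=
  (1 <= q)%nat /\ t <> [] /\
  NoDup (map fst t) /\
  (forall wF, In wF t -> fst wF <> RtoC 0) /\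
  expoly_le (q - 1) F0 /\
  (forall wF, In wF t -> expoly_le (q - 1) (snd wF) /\ exists z, snd wF z <> RtoC 0) /\
  forall z, f z = Cplus (F0 z)
     (fold_right (fun wF acc => Cplus (Cmult (snd wF z) (cexp (Cmult (fst wF) (cpow z q)))) acc)
        (RtoC 0) t).

Definition on_ray (theta : R) (w : C) : Prop :=
  exists s : R, 0 < s /\ w = Cmult (RtoC s) (cexp (0, theta)).

Definition dual_freqs (ws ls : list C) : Prop :=
  exists theta : R, (forall w, In w ws -> on_ray theta w) /\
                    (forall l, In l ls -> on_ray (theta + PI) l).

Definition commensurable_with (w : C) (ws : list C) : Prop :=
  w <> RtoC 0 /\ forall wj, In wj ws -> exists n : nat, (0 < n)%nat /\ wj = Cmult (RtoC (INR n)) w.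

Definition commensurable (ws : list C) : Prop := exists w, commensurable_with w ws.

Definition strongly_dual_freqs (ws ls : list C) : Prop :=
  dual_freqs ws ls /\
  exists w : C, commensurable_with w ws /\ commensurable_with (Copp w) ls /\
    exists theta' : R, forall wj li, In wj ws -> In li ls ->
      exists s : R, 0 <= s /\ Cplus wj li = Cmult (RtoC s) (cexp (0, theta')).

(* Main.v *)
Require Import Defs.
From Stdlib Require Import ZArith Reals List Lra Lia Classical ClassicalEpsilon FunctionalExtensionality Wf_nat.
From Coquelicot Require Import Coquelicot.
Import ListNotations.
Open Scope R_scope.

(** The exponents of an exponential polynomial, viewed as elements of [z C[z]], are totally ordered by
    the growth of their real parts along a generic direction, and the sum behaves there like its dominant
    term. The hypothesis on [T(r, B)] provides, in every sector and for arbitrarily large radii [r], points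
    where [|B| <= exp (delta r ^ s)], [s] being the order of [A]. At such points in a direction where [A] is large,
    [A f'] can only be balanced by [B f], which forces the dominant term of [f] to be a constant [c <> 0] and every
    other exponent [Q] of [f] to satisfy [Re (Q + Q_A) <= o(r ^ s)] for all exponents [Q_A] of [A]. Varying
    the direction gives [s] as common order, opposite rays, and [w = - t * lambda] with [t >= 1] for all frequencies.

    Let [E0] be the part of [f'' + A f'] without exponential factor of order [s] and [D = B + E0 / c]. Then [D f] has
    only non-zero frequencies, so [D] is exponentially small in a sector while its Nevanlinna mean is
    [o(r ^ s)]; Jensen's inequality gives [D = 0]. Commensurability follows by projecting the equation, now an
    identity between exponential polynomials, onto the exponents whose frequency lies outside the group
    generated by a common factor. *)

(** [B] is only known to be complex differentiable, and [D] only to be continuous; further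
    regularity comes from [D f = K] with [K] an exponential sum, hence from [D = K / f] off the
    zeros of [f]. This is why the maximum principle rests on a second-derivative test that asks
    nothing at zeros, and why the Jensen-type bound is derived from it rather than from an integral
    formula. The inequality [t >= 1] arises because the balance bounds the sum [Q + Q_A]: its
    leading coefficient is [- t' * lambda] with [t' >= 0], and subtracting that of [Q_A] adds one to
    [t']. A degree above [s] is excluded by an angle at which the sum and [Q_A] are both positive.
    The two directions of commensurability differ. If the frequencies of [f] lie in the group,
    projection leaves the product of [f'] with the part of [A] outside it, and a product of non-zero
    exponential sums is non-zero. If those of [A] lie in it, the part of [f] outside solves the same
    equation; were it non-zero, it would contain a non-zero constant term like every such solution,
    but the frequency 0 belongs to the group. *)

Lemma Rmax_le_inv (a b r : R) : Rmax a b <= r -> a <= r /\ b <= r.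
Proof. generalize (Rmax_l a b), (Rmax_r a b); lra. Qed.

Lemma Rmin_lt_inv (a b r : R) : r < Rmin a b -> r < a /\ r < b.
Proof. generalize (Rmin_l a b), (Rmin_r a b); lra. Qed.

Lemma exp_le_compat x y : x <= y -> exp x <= exp y.
Proof. intros [|E]; [left; apply exp_increasing; auto | rewrite E; lra]. Qed.

(** * Real parts, imaginary parts and moduli *)

Lemma C_eq (a b : C) : Re a = Re b -> Im a = Im b -> a = b.
Proof. destruct a, b; simpl; intros -> ->; reflexivity. Qed.

Lemma Re_plus (a b : C) : Re (a + b)%C = Re a + Re b. Proof. reflexivity. Qed.
Lemma Re_mult (a b : C) : Re (a * b)%C = Re a * Re b - Im a * Im b. Proof. reflexivity. Qed.
Lemma Re_scal (x : R) (b : C) : Re (RtoC x * b)%C = x * Re b.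
Proof. rewrite Re_mult; simpl; ring. Qed.
Lemma Re_opp (a : C) : Re (- a)%C = - Re a. Proof. reflexivity. Qed.
Lemma Re_minus (a b : C) : Re (a - b)%C = Re a - Re b. Proof. reflexivity. Qed.

Lemma Cmod_sqr (z : C) : Cmod z * Cmod z = Re z * Re z + Im z * Im z.
Proof. generalize (Cmod2_alt z); simpl; lra. Qed.

Lemma Re_le_Cmod (z : C) : Re z <= Cmod z.
Proof. eapply Rle_trans; [apply Rle_abs | apply re_le_Cmod]. Qed.

Lemma Re_ge_Cmod (z : C) : - Cmod z <= Re z.
Proof. generalize (re_le_Cmod z); unfold Rabs; destruct Rcase_abs; lra. Qed.

Lemma Cmod_le_ReIm (z : C) : Cmod z <= Rabs (Re z) + Rabs (Im z).
Proof.
  apply Rsqr_incr_0_var; [| generalize (Rabs_pos (Re z)), (Rabs_pos (Im z)); lra].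
  unfold Rsqr; rewrite Cmod_sqr.
  generalize (Rabs_pos (Re z)), (Rabs_pos (Im z)), (Rsqr_abs (Re z)), (Rsqr_abs (Im z)).
  unfold Rsqr; intros; nra.
Qed.

Lemma Cmod_triangle_inv (x y : C) : Cmod x - Cmod y <= Cmod (x - y)%C.
Proof.
  generalize (Cmod_triangle (x - y)%C y).
  replace (x - y + y)%C with x by ring; lra.
Qed.

Lemma Cmod_plus_inv (x y : C) : Cmod x - Cmod y <= Cmod (x + y)%C.
Proof.
  generalize (Cmod_triangle_inv x (- y)%C). rewrite Cmod_opp.
  replace (x - - y)%C with (x + y)%C by ring; auto.
Qed.

Lemma Cmod_minus_sym (x y : C) : Cmod (x - y)%C = Cmod (y - x)%C.
Proof. rewrite <- (Cmod_opp (x - y)%C); f_equal; ring. Qed.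

Lemma Cmod_RtoC_pos (r : R) : 0 <= r -> Cmod (RtoC r) = r.
Proof. intros; rewrite Cmod_R; apply Rabs_pos_eq; auto. Qed.

(** * The complex exponential and powers *)

Lemma cexp_plus (a b : C) : cexp (a + b)%C = (cexp a * cexp b)%C.
Proof.
  unfold cexp; apply C_eq; simpl; rewrite ?exp_plus, ?cos_plus, ?sin_plus; ring.
Qed.

Lemma cexp_0 : cexp 0 = 1%C.
Proof. unfold cexp; apply C_eq; simpl; rewrite exp_0, ?cos_0, ?sin_0; ring. Qed.

Lemma Cmod_cexp (z : C) : Cmod (cexp z) = exp (Re z).
Proof.
  apply Rsqr_inj; [apply Cmod_ge_0 | left; apply exp_pos |].
  unfold Rsqr; rewrite Cmod_sqr; unfold cexp; simpl.
  generalize (sin2_cos2 (snd z)); unfold Rsqr; intros.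
  unfold Re. nra.
Qed.

Lemma cexp_neq_0 (z : C) : cexp z <> 0%C.
Proof.
  intros H. generalize (Cmod_cexp z), (exp_pos (Re z)).
  rewrite H, Cmod_0; lra.
Qed.

Definition cis (th : R) : C := cexp (0, th).

Lemma cis_plus (a b : R) : cis (a + b) = (cis a * cis b)%C.
Proof.
  unfold cis; rewrite <- cexp_plus; f_equal. apply C_eq; simpl; ring.
Qed.

Lemma cis_val (a : R) : cis a = (cos a, sin a).
Proof. unfold cis, cexp; simpl; rewrite exp_0; apply C_eq; simpl; ring. Qed.

Lemma Cmod_cis (a : R) : Cmod (cis a) = 1.
Proof. unfold cis; rewrite Cmod_cexp; simpl; apply exp_0. Qed.

Lemma cis_0 : cis 0 = 1%C.
Proof. apply cexp_0. Qed.

Lemma cis_period (a : R) (k : nat) : cis (a + 2 * INR k * PI) = cis a.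
Proof. rewrite !cis_val, cos_period, sin_period; reflexivity. Qed.

Lemma cis_PI : cis PI = (- (1))%C.
Proof. rewrite cis_val, cos_PI, sin_PI; apply C_eq; simpl; ring. Qed.

(** Mean value theorem for the two coordinates; adding them costs the factor 2. *)
Lemma cis_dist (a b : R) : Cmod (cis a - cis b)%C <= 2 * Rabs (a - b).
Proof.
  eapply Rle_trans; [apply Cmod_le_ReIm|]. rewrite !cis_val; simpl.
  assert (H : forall f f' : R -> R, (forall x, is_derive f x (f' x)) -> (forall x, Rabs (f' x) <= 1) ->
    Rabs (f a - f b) <= Rabs (a - b)).
  { intros f f' Hd Hb.
    destruct (MVT_gen f b a f') as [c [_ Hc]].
    - intros; apply Hd.
    - intros x _. apply derivable_continuous_pt. exists (f' x). apply is_derive_Reals, Hd.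
    - rewrite Hc, Rabs_mult. generalize (Hb c), (Rabs_pos (a - b)); nra. }
  generalize (H cos (fun x => - sin x)), (H sin cos); intros H1 H2.
  assert (Rabs (cos a - cos b) <= Rabs (a - b)).
  { apply H1. intros; auto_derive; auto; ring.
    intros; rewrite Rabs_Ropp; apply Rabs_le, SIN_bound. }
  assert (Rabs (sin a - sin b) <= Rabs (a - b)).
  { apply H2. intros; auto_derive; auto; ring.
    intros; apply Rabs_le, COS_bound. }
  unfold Rminus in *; simpl in *; lra.
Qed.

Definition polar (r th : R) : C := (RtoC r * cis th)%C.

Lemma Cmod_polar (r th : R) : 0 <= r -> Cmod (polar r th) = r.
Proof. intros; unfold polar; rewrite Cmod_mult, Cmod_cis, Cmod_RtoC_pos; lra. Qed.

(** The argument is an arc cosine with the sign of the imaginary part. The bounded range is recorded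
    for compactness arguments and for bounding a phase by [PI]. *)
Lemma polar_exists (z : C) : exists th, - PI <= th <= PI /\ z = polar (Cmod z) th.
Proof.
  destruct (Req_dec (Cmod z) 0) as [H0|H0].
  - exists 0; split; [generalize PI_RGT_0; lra|].
    apply Cmod_eq_0 in H0 as ->. unfold polar; rewrite Cmod_0; ring.
  - assert (Hp : 0 < Cmod z) by (generalize (Cmod_ge_0 z); lra).
    set (r := Cmod z) in *.
    assert (Hx : -1 <= Re z / r <= 1).
    { generalize (Re_le_Cmod z) (Re_ge_Cmod z); fold r; intros; split.
      - apply Rmult_le_reg_r with r; [lra|]. field_simplify; lra.
      - apply Rmult_le_reg_r with r; [lra|]. field_simplify; lra. }
    assert (Hs : (Re z / r) * (Re z / r) + (Im z / r) * (Im z / r) = 1).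
    { generalize (Cmod_sqr z); fold r; intros. apply Rmult_eq_reg_l with (r * r); [|nra].
      field_simplify; nra. }
    assert (Hsin : sin (acos (Re z / r)) = Rabs (Im z / r)).
    { rewrite sin_acos by lra. rewrite <- sqrt_Rsqr_abs. f_equal. unfold Rsqr in *; simpl. nra. }
    generalize (acos_bound (Re z / r)); intros Hb.
    destruct (Rle_dec 0 (Im z)) as [Hi|Hi].
    + exists (acos (Re z / r)); split; [lra|].
      unfold polar; rewrite cis_val, Hsin, cos_acos by lra.
      rewrite Rabs_pos_eq by (apply Rdiv_le_0_compat; lra).
      apply C_eq; simpl; field; lra.
    + exists (- acos (Re z / r)); split; [lra|].
      unfold polar; rewrite cis_val, cos_neg, sin_neg, Hsin, cos_acos by lra.
      rewrite Rabs_left1.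
      apply C_eq; simpl; field; lra.
      unfold Rdiv. assert (0 < / r) by (apply Rinv_0_lt_compat; lra). nra.
Qed.

Lemma cpow_mult (a b : C) n : cpow (a * b)%C n = (cpow a n * cpow b n)%C.
Proof. induction n; simpl; [ring | rewrite IHn; ring]. Qed.

Lemma cpow_RtoC (r : R) n : cpow (RtoC r) n = RtoC (r ^ n).
Proof. induction n; simpl; [reflexivity | rewrite IHn, RtoC_mult; reflexivity]. Qed.

Lemma cpow_cis th n : cpow (cis th) n = cis (INR n * th).
Proof.
  induction n.
  - simpl. rewrite Rmult_0_l, cis_0; reflexivity.
  - cbn [cpow]; rewrite IHn, S_INR, <- cis_plus. f_equal; ring.
Qed.

Lemma cpow_polar r th n : cpow (polar r th) n = polar (r ^ n) (INR n * th).
Proof. unfold polar; rewrite cpow_mult, cpow_RtoC, cpow_cis; reflexivity. Qed.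

Lemma Cmod_cpow (z : C) n : Cmod (cpow z n) = Cmod z ^ n.
Proof. induction n; simpl; [apply Cmod_1 | rewrite Cmod_mult, IHn; reflexivity]. Qed.

Lemma cpow_neq_0 (z : C) n : z <> 0%C -> cpow z n <> 0%C.
Proof.
  intros Hz H. apply Hz. destruct n as [|n]. simpl in H.
  - exfalso; apply (f_equal Re) in H; simpl in H; lra.
  - assert (H' : Cmod z ^ S n = 0) by (rewrite <- Cmod_cpow, H; apply Cmod_0).
    apply Cmod_eq_0. destruct (Req_dec (Cmod z) 0); auto.
    exfalso; revert H'; apply pow_nonzero; auto.
Qed.

(** * Complex derivatives *)

(** An increment form without quotients: [h = 0] is harmless, and estimates can be added and
    composed directly. *)
Definition cder (f : C -> C) (z l : C) : Prop :=
  forall eps, 0 < eps -> exists del, 0 < del /\ forall h, Cmod h < del ->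
    Cmod (f (z + h) - f z - h * l)%C <= eps * Cmod h.

Definition ccont_at (f : C -> C) (z : C) : Prop :=
  forall eps, 0 < eps -> exists del, 0 < del /\ forall h, Cmod h < del ->
    Cmod (f (z + h) - f z)%C < eps.

Lemma is_derive_cder (f : C -> C) (z l : C) :
  @is_derive C_AbsRing C_NormedModule f z l -> cder f z l.
Proof.
  intros [_ H] eps He.
  assert (Hl : is_filter_lim (locally (T := AbsRing_UniformSpace C_AbsRing) z) z) by (intros P HP; exact HP).
  specialize (H z Hl (mkposreal eps He)). destruct H as [d Hd].
  exists d; split; [apply cond_pos|]. intros h Hh.
  assert (Hb : ball (M := AbsRing_UniformSpace C_AbsRing) z d (z + h)%C).
  { red; simpl. unfold AbsRing_ball, abs; simpl.
    assert (E : (z + h - z = h)%C) by ring.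
    change (Cmod (z + h - z)%C < d). rewrite E; auto. }
  specialize (Hd _ Hb). simpl in Hd.
  assert (E : (z + h - z = h)%C) by ring.
  change (Cmod (f (z + h) - f z - (z + h - z) * l)%C <= eps * Cmod (z + h - z)%C) in Hd.
  rewrite E in Hd; exact Hd.
Qed.

Lemma cder_cont f z l : cder f z l -> ccont_at f z.
Proof.
  intros H eps He. destruct (H 1 Rlt_0_1) as [d [Hd Hh]].
  set (M := 1 + Cmod l). assert (HM : 0 < M) by (generalize (Cmod_ge_0 l); unfold M; lra).
  exists (Rmin d (eps / M)); split.
  - apply Rmin_pos; auto. apply Rdiv_lt_0_compat; auto.
  - intros h Hlt. destruct (Rmin_lt_inv _ _ _ Hlt) as [H1 H2].
    specialize (Hh h H1).
    apply Rle_lt_trans with (Cmod h * M).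
    + replace (f (z + h) - f z)%C with ((f (z + h) - f z - h * l) + h * l)%C by ring.
      eapply Rle_trans; [apply Cmod_triangle|]. rewrite Cmod_mult. unfold M; lra.
    + apply Rmult_lt_reg_r with (/ M). apply Rinv_0_lt_compat; auto.
      rewrite Rmult_assoc, Rinv_r by lra. unfold Rdiv in H2; lra.
Qed.

Lemma cder_ext f g z l : (forall z, f z = g z) -> cder f z l -> cder g z l.
Proof. intros He H eps Hp. destruct (H eps Hp) as [d [Hd Hh]]. exists d; split; auto. intros; rewrite <- !He; auto. Qed.

Lemma cder_const c z : cder (fun _ => c) z 0%C.
Proof.
  intros eps He; exists 1; split; [lra|]. intros h _.
  replace (c - c - h * 0)%C with (RtoC 0) by ring. rewrite Cmod_0.
  generalize (Cmod_ge_0 h); nra.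
Qed.

Lemma cder_id z : cder (fun z => z) z 1%C.
Proof.
  intros eps He; exists 1; split; [lra|]. intros h _.
  replace (z + h - z - h * 1)%C with (RtoC 0) by ring. rewrite Cmod_0.
  generalize (Cmod_ge_0 h); nra.
Qed.

Lemma cder_plus f g z l m : cder f z l -> cder g z m -> cder (fun z => f z + g z)%C z (l + m)%C.
Proof.
  intros Hf Hg eps He.
  destruct (Hf (eps / 2)) as [d1 [Hd1 H1]]; [lra|].
  destruct (Hg (eps / 2)) as [d2 [Hd2 H2]]; [lra|].
  exists (Rmin d1 d2); split; [apply Rmin_pos; auto|]. intros h Hh.
  destruct (Rmin_lt_inv _ _ _ Hh) as [Hmin1 Hmin2]. specialize (H1 h Hmin1). specialize (H2 h Hmin2).
  replace (f (z + h) + g (z + h) - (f z + g z) - h * (l + m))%C with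
    ((f (z + h) - f z - h * l) + (g (z + h) - g z - h * m))%C by ring.
  eapply Rle_trans; [apply Cmod_triangle|]. lra.
Qed.

(* Caratheodory form: the slope is continuous at [z], which makes product and chain rules algebraic. *)
Lemma cder_carath f z l :
  cder f z l <-> exists phi : C -> C, phi 0%C = l /\ ccont_at phi 0%C /\ forall h, f (z + h)%C = (f z + h * phi h)%C.
Proof.
  split.
  - intros H.
    exists (fun h : C => match excluded_middle_informative (h = 0%C) with
                     | left _ => l | right _ => ((f (z + h) - f z) / h)%C end).
    split; [|split].
    + destruct excluded_middle_informative; congruence.
    + intros eps He. destruct (H (eps / 2)) as [d [Hd Hh]]; [lra|].
      exists d; split; auto. intros h Hlt. cbv beta.
      destruct (excluded_middle_informative (RtoC 0 = RtoC 0)) as [_|n]; [|congruence].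
      replace (0 + h)%C with h by ring.
      destruct (excluded_middle_informative (h = 0%C)).
      * replace (l - l)%C with (RtoC 0) by ring. rewrite Cmod_0; auto.
      * specialize (Hh h Hlt).
        assert (Hp : 0 < Cmod h) by (apply Cmod_gt_0; auto).
        replace ((f (z + h) - f z) / h - l)%C with ((f (z + h) - f z - h * l) / h)%C by (field; auto).
        rewrite Cmod_div by auto.
        apply Rmult_lt_reg_r with (Cmod h); auto. unfold Rdiv at 1; rewrite Rmult_assoc, Rinv_l by lra; nra.
    + intros h. destruct excluded_middle_informative as [->|n].
      * replace (z + 0)%C with z by ring. ring.
      * field; auto.
  - intros [phi [Hl [Hc He]]] eps Hp. destruct (Hc eps Hp) as [d [Hd Hh]].
    exists d; split; auto. intros h Hlt. rewrite He.
    replace (f z + h * phi h - f z - h * l)%C with (h * (phi (0 + h) - phi 0))%C.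
    2:{ rewrite Hl. replace (0 + h)%C with h by ring. ring. }
    rewrite Cmod_mult. specialize (Hh h Hlt). generalize (Cmod_ge_0 h); nra.
Qed.

Lemma ccont_const c z : ccont_at (fun _ => c) z.
Proof. eapply cder_cont, cder_const. Qed.

Lemma ccont_id z : ccont_at (fun z => z) z.
Proof. eapply cder_cont, cder_id. Qed.

Lemma ccont_plus f g z : ccont_at f z -> ccont_at g z -> ccont_at (fun z => f z + g z)%C z.
Proof.
  intros Hf Hg eps He.
  destruct (Hf (eps / 2)) as [d1 [Hd1 H1]]; [lra|].
  destruct (Hg (eps / 2)) as [d2 [Hd2 H2]]; [lra|].
  exists (Rmin d1 d2); split; [apply Rmin_pos; auto|]. intros h Hh.
  destruct (Rmin_lt_inv _ _ _ Hh) as [Hmin1 Hmin2]. specialize (H1 h Hmin1). specialize (H2 h Hmin2).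
  replace (f (z + h) + g (z + h) - (f z + g z))%C with
    ((f (z + h) - f z) + (g (z + h) - g z))%C by ring.
  eapply Rle_lt_trans; [apply Cmod_triangle|]. lra.
Qed.

Lemma ccont_mult f g z : ccont_at f z -> ccont_at g z -> ccont_at (fun z => f z * g z)%C z.
Proof.
  intros Hf Hg eps He.
  set (M := 1 + Cmod (f z) + Cmod (g z)).
  assert (HM : 0 < M) by (generalize (Cmod_ge_0 (f z)), (Cmod_ge_0 (g z)); unfold M; lra).
  set (e := Rmin 1 (eps / (2 * M))).
  assert (Hep : 0 < e) by (apply Rmin_pos; [lra | apply Rdiv_lt_0_compat; lra]).
  assert (HeM : e * M <= eps / 2).
  { apply Rle_trans with (eps / (2 * M) * M).
    apply Rmult_le_compat_r; [lra | apply Rmin_r]. right; field; lra. }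
  destruct (Hf e Hep) as [d1 [Hd1 H1]].
  destruct (Hg e Hep) as [d2 [Hd2 H2]].
  exists (Rmin d1 d2); split; [apply Rmin_pos; auto|]. intros h Hh.
  destruct (Rmin_lt_inv _ _ _ Hh) as [Hmin1 Hmin2]. specialize (H1 h Hmin1). specialize (H2 h Hmin2).
  replace (f (z + h) * g (z + h) - f z * g z)%C with
    ((f (z + h) - f z) * (g (z + h) - g z) + (f (z + h) - f z) * g z + f z * (g (z + h) - g z))%C by ring.
  eapply Rle_lt_trans; [apply Cmod_triangle|].
  eapply Rle_lt_trans; [apply Rplus_le_compat_r, Cmod_triangle|].
  rewrite !Cmod_mult.
  set (a := Cmod (f (z + h) - f z)%C) in *. set (b := Cmod (g (z + h) - g z)%C) in *.
  assert (0 <= a) by apply Cmod_ge_0. assert (0 <= b) by apply Cmod_ge_0.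
  assert (e <= 1) by apply Rmin_l.
  apply Rle_lt_trans with (e * 1 + e * Cmod (g z) + Cmod (f z) * e).
  - generalize (Cmod_ge_0 (f z)), (Cmod_ge_0 (g z)); intros.
    apply Rplus_le_compat; [apply Rplus_le_compat|]; apply Rmult_le_compat; lra.
  - unfold M in *; lra.
Qed.

Lemma ccont_inv (f : C -> C) z : f z <> 0%C -> ccont_at f z -> ccont_at (fun z => / f z)%C z.
Proof.
  intros Hz Hf eps He. assert (Hp : 0 < Cmod (f z)) by (apply Cmod_gt_0; auto).
  set (m := Cmod (f z)) in *.
  destruct (Hf (Rmin (m / 2) (eps * (m * m / 2)))) as [d [Hd H]].
  { apply Rmin_pos; [lra|]. apply Rmult_lt_0_compat; auto. assert (0 < m * m) by (apply Rmult_lt_0_compat; auto). lra. }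
  exists d; split; auto. intros h Hh. specialize (H h Hh).
  destruct (Rmin_lt_inv _ _ _ H) as [H1 H2].
  assert (H3 : m / 2 <= Cmod (f (z + h)%C)).
  { generalize (Cmod_triangle_inv (f z) (f z - f (z + h)%C)%C).
    replace (f z - (f z - f (z + h)))%C with (f (z + h)%C) by ring.
    rewrite (Cmod_minus_sym (f z) _). fold m; lra. }
  assert (Hn : f (z + h)%C <> 0%C) by (apply Cmod_gt_0; lra).
  replace (/ f (z + h) - / f z)%C with ((f z - f (z + h)) / (f (z + h) * f z))%C by (field; auto).
  rewrite Cmod_div, Cmod_mult by (apply Cmult_neq_0; auto).
  fold m. rewrite (Cmod_minus_sym (f z)).
  set (b := Cmod (f (z + h)%C)) in *. set (a := Cmod (f (z + h)%C - f z)%C) in *.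
  assert (0 < b * m) by nra.
  apply Rmult_lt_reg_r with (b * m); auto. unfold Rdiv. rewrite Rmult_assoc, Rinv_l by lra.
  assert (m * m / 2 <= b * m) by nra. apply Rlt_le_trans with (eps * (m * m / 2)); [lra|].
  apply Rmult_le_compat_l; lra.
Qed.

Lemma ccont_comp f g z : ccont_at g z -> ccont_at f (g z) -> ccont_at (fun z => f (g z)) z.
Proof.
  intros Hg Hf eps He. destruct (Hf eps He) as [d [Hd H]]. destruct (Hg d Hd) as [d' [Hd' H']].
  exists d'; split; auto. intros h Hh. specialize (H _ (H' h Hh)).
  replace (g z + (g (z + h) - g z))%C with (g (z + h)%C) in H by ring. auto.
Qed.

Lemma ccont_ext f g z : (forall z, f z = g z) -> ccont_at f z -> ccont_at g z.
Proof. intros He H eps Hp. destruct (H eps Hp) as [d [Hd Hh]]. exists d; split; auto. intros; rewrite <- !He; auto. Qed.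

Lemma cder_mult f g z l m : cder f z l -> cder g z m ->
  cder (fun z => f z * g z)%C z (l * g z + f z * m)%C.
Proof.
  rewrite !cder_carath. intros [p [Hp [Cp Ep]]] [q [Hq [Cq Eq]]].
  exists (fun h : C => p h * g z + f z * q h + h * (p h * q h))%C. split; [|split].
  - rewrite Hp, Hq; ring.
  - repeat first [apply ccont_plus | apply ccont_mult | apply ccont_const | apply ccont_id | assumption].
  - intros h; rewrite Ep, Eq; ring.
Qed.

Lemma cder_comp f g z l m : cder g z m -> cder f (g z) l -> cder (fun z => f (g z)) z (m * l)%C.
Proof.
  rewrite !cder_carath. intros [p [Hp [Cp Ep]]] [q [Hq [Cq Eq]]].
  exists (fun h : C => p h * q (h * p h))%C. split; [|split].
  - replace (0 * p 0)%C with (RtoC 0) by ring. rewrite Hp, Hq; ring.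
  - apply ccont_mult; auto. apply (ccont_comp q (fun h : C => h * p h)%C).
    apply ccont_mult; auto. apply ccont_id. replace (0 * p 0)%C with (RtoC 0) by ring. auto.
  - intros h; rewrite Ep, Eq; ring.
Qed.

(** The slope of [1 / f] is [- p h / (f (z + h) * f z)], which represents the increment only while
    [f (z + h)] is non-zero. The Caratheodory identity is thus local here, and the estimate is made
    directly from the continuity of this slope. *)
Lemma cder_inv (f : C -> C) z l : f z <> 0%C -> cder f z l -> cder (fun z => / f z)%C z (- l / (f z * f z))%C.
Proof.
  intros Hz H. assert (Hc := cder_cont _ _ _ H). revert H; rewrite cder_carath. intros [p [Hp [Cp Ep]]].
  intros eps He.
  assert (Hc2 : ccont_at (fun h : C => - p h * (/ f (z + h) * / f z))%C 0%C).
  { apply (ccont_mult (fun h : C => - p h)%C).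
    - apply ccont_ext with (fun h : C => (- (1)) * p h)%C. intros; ring.
      apply ccont_mult; auto; apply ccont_const.
    - apply ccont_mult; [|apply ccont_const].
      apply (ccont_inv (fun h : C => f (z + h)%C)).
      replace (z + 0)%C with z by ring; auto.
      apply (ccont_comp f (fun h : C => z + h)%C). apply ccont_plus; [apply ccont_const | apply ccont_id].
      replace (z + 0)%C with z by ring; auto. }
  destruct (Hc2 eps He) as [d1 [Hd1 H1]].
  destruct (Hc (Cmod (f z))) as [d2 [Hd2 H2]]. apply Cmod_gt_0; auto.
  exists (Rmin d1 d2); split; [apply Rmin_pos; auto|]. intros h Hh.
  destruct (Rmin_lt_inv _ _ _ Hh) as [Hmin1 Hmin2]. specialize (H1 h Hmin1). specialize (H2 h Hmin2).
  assert (Hn : f (z + h)%C <> 0%C).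
  { intros E. rewrite E in H2. replace (0 - f z)%C with (- f z)%C in H2 by ring.
    rewrite Cmod_opp in H2; lra. }
  replace (/ f (z + h) - / f z - h * (- l / (f z * f z)))%C with
    (h * (- p (0 + h) * (/ f (z + (0 + h)) * / f z) - - p 0 * (/ f (z + 0) * / f z)))%C.
  - rewrite Cmod_mult. generalize (Cmod_ge_0 h); nra.
  - replace (0 + h)%C with h by ring. replace (z + 0)%C with z by ring. rewrite Hp.
    assert (Hph : (h * p h = f (z + h) - f z)%C) by (rewrite Ep; ring).
    transitivity (- (h * p h) * (/ f (z + h) * / f z) - h * (- l * (/ f z * / f z)))%C; [ring|].
    rewrite Hph. field; auto.
Qed.

Lemma cder_unique f z l m : cder f z l -> cder f z m -> l = m.
Proof.
  intros H1 H2. apply NNPP; intros Hn.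
  assert (Hp : 0 < Cmod (l - m)%C).
  { apply Cmod_gt_0. intros E; apply Hn. replace l with ((l - m) + m)%C by ring. rewrite E; ring. }
  set (e := Cmod (l - m)%C / 4).
  destruct (H1 e) as [d1 [Hd1 K1]]; [unfold e; lra|].
  destruct (H2 e) as [d2 [Hd2 K2]]; [unfold e; lra|].
  set (h := Rmin d1 d2 / 2).
  assert (Hm : 0 < Rmin d1 d2) by (apply Rmin_pos; auto).
  assert (Hh : Cmod (RtoC h) = h) by (apply Cmod_RtoC_pos; unfold h; lra).
  specialize (K1 (RtoC h)). specialize (K2 (RtoC h)). rewrite Hh in *.
  generalize (Rmin_l d1 d2), (Rmin_r d1 d2); intros.
  assert (A1 := K1 ltac:(unfold h; lra)). assert (A2 := K2 ltac:(unfold h; lra)).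
  assert (Cmod (RtoC h * (l - m))%C <= e * h + e * h).
  { replace (RtoC h * (l - m))%C with
      ((f (z + RtoC h) - f z - RtoC h * m) + - (f (z + RtoC h) - f z - RtoC h * l))%C by ring.
    eapply Rle_trans; [apply Cmod_triangle|]. rewrite Cmod_opp. lra. }
  rewrite Cmod_mult, Hh in H3. assert (0 < h) by (unfold h; lra).
  unfold e in *. nra.
Qed.

Lemma cder_cexp z : cder cexp z (cexp z).
Proof.
  assert (H0 : cder cexp 0 1%C).
  { intros eps0 He0. set (eps := Rmin 1 eps0).
    assert (He : 0 < eps) by (apply Rmin_pos; lra).
    assert (He1 : eps <= 1) by apply Rmin_l. assert (He2 : eps <= eps0) by apply Rmin_r.
    (* Linear approximation of a real function at 0 with error [eps / 8]: the real part below
       collects three such errors and the imaginary part four. *)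
    assert (Hd : forall (g : R -> R) l, is_derive g 0 l -> exists del, 0 < del /\
      forall x, Rabs x < del -> Rabs (g x - g 0 - x * l) <= eps / 8 * Rabs x).
    { intros g l Hg. apply is_derive_Reals in Hg.
      destruct (Hg (eps / 8)) as [d Hd]; [lra|]. exists d; split; [apply cond_pos|].
      intros x Hx. destruct (Req_dec x 0) as [->|Hn].
      - rewrite Rmult_0_l, Rminus_0_r, Rminus_diag, Rabs_R0; lra.
      - specialize (Hd x Hn Hx). rewrite Rplus_0_l in Hd.
        replace (g x - g 0 - x * l) with (((g x - g 0) / x - l) * x) by (field; auto).
        rewrite Rabs_mult. generalize (Rabs_pos x); nra. }
    destruct (Hd exp 1) as [d1 [Hd1 K1]]; [auto_derive; auto; rewrite exp_0; ring|].
    destruct (Hd cos 0) as [d2 [Hd2 K2]]; [auto_derive; auto; rewrite sin_0; ring|].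
    destruct (Hd sin 1) as [d3 [Hd3 K3]]; [auto_derive; auto; rewrite cos_0; ring|].
    (* The bound [eps / 8] on the increment itself serves the mixed term [x * sin y], which is
       quadratic in [h]. *)
    exists (Rmin (Rmin d1 d2) (Rmin d3 (Rmin 1 (eps / 8)))); split.
    repeat apply Rmin_pos; lra.
    intros h Hh.
    generalize (Rmin_l (Rmin d1 d2) (Rmin d3 (Rmin 1 (eps / 8)))), (Rmin_r (Rmin d1 d2) (Rmin d3 (Rmin 1 (eps / 8)))),
      (Rmin_l d1 d2), (Rmin_r d1 d2), (Rmin_l d3 (Rmin 1 (eps / 8))), (Rmin_r d3 (Rmin 1 (eps / 8))),
      (Rmin_l 1 (eps / 8)), (Rmin_r 1 (eps / 8)); intros.
    generalize (Rmax_Cmod h); intros Hm.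
    assert (Hx : Rabs (fst h) <= Cmod h) by (eapply Rle_trans; [apply Rmax_l | apply Hm]).
    assert (Hy : Rabs (snd h) <= Cmod h) by (eapply Rle_trans; [apply Rmax_r | apply Hm]).
    destruct h as [x y]; simpl fst in Hx; simpl snd in Hy.
    specialize (K1 x ltac:(lra)). specialize (K2 y ltac:(lra)). specialize (K3 y ltac:(lra)).
    rewrite exp_0 in K1. rewrite cos_0 in K2. rewrite sin_0 in K3.
    set (E := exp x - 1 - x * 1) in *. set (c := cos y - 1 - y * 0) in *. set (s := sin y - 0 - y * 1) in *.
    apply Rle_trans with (eps * Cmod (x, y)); [|apply Rmult_le_compat_r; [apply Cmod_ge_0 | auto]].
    eapply Rle_trans; [apply Cmod_le_ReIm|].
    rewrite cexp_0. unfold cexp; simpl.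
    (* With [E = exp x - 1 - x] and [c = cos y - 1], the remainder [exp x * cos y - 1 - x] is
       exactly [E * cos y + c + x * c]; the imaginary part is split in the same way. *)
    replace (exp (0 + x) * cos (0 + y) + - (1) + - (x * 1 - y * 0)) with (E * cos y + c + x * c).
    2:{ rewrite !Rplus_0_l; unfold E, c; ring. }
    replace (exp (0 + x) * sin (0 + y) + - 0 + - (x * 0 + y * 1)) with (E * sin y + s + x * sin y).
    2:{ rewrite !Rplus_0_l; unfold E, s; ring. }
    set (r := Cmod (x, y)) in *.
    assert (HE : Rabs E <= eps / 8 * r) by (eapply Rle_trans; [apply K1 | apply Rmult_le_compat_l; lra]).
    assert (Hc : Rabs c <= eps / 8 * r) by (eapply Rle_trans; [apply K2 | apply Rmult_le_compat_l; lra]).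
    assert (Hs : Rabs s <= eps / 8 * r) by (eapply Rle_trans; [apply K3 | apply Rmult_le_compat_l; lra]).
    assert (Hb : forall a b u v, 0 <= a -> 0 <= b -> a <= u -> b <= v -> a * b <= u * v)
      by (intros; apply Rmult_le_compat; auto).
    assert (Hcos : Rabs (cos y) <= 1) by (apply Rabs_le, COS_bound).
    assert (Hsin : Rabs (sin y) <= 1) by (apply Rabs_le, SIN_bound).
    assert (Hsin2 : Rabs (sin y) <= 2 * r).
    { replace (sin y) with (s + y) by (unfold s; ring).
      eapply Rle_trans; [apply Rabs_triang|].
      assert (0 <= r) by apply Cmod_ge_0.
      assert (Rabs s <= r); [|lra]. eapply Rle_trans; [apply K3|].
      replace r with (1 * r) by ring. apply Hb; try lra. apply Rabs_pos. }
    generalize (Rabs_pos x), (Rabs_pos y), (Rabs_pos E), (Rabs_pos c), (Rabs_pos s), (Rabs_pos (sin y)), (Rabs_pos (cos y)); intros.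
    assert (Rabs (E * cos y + c + x * c) <= eps / 8 * r * 3).
    { eapply Rle_trans; [apply Rabs_triang|]. rewrite (Rabs_mult x c).
      eapply Rle_trans; [apply Rplus_le_compat_r, Rabs_triang|]. rewrite Rabs_mult.
      assert (Rabs E * Rabs (cos y) <= eps / 8 * r * 1) by (apply Hb; lra).
      assert (Rabs x * Rabs c <= 1 * (eps / 8 * r)) by (apply Hb; lra). lra. }
    assert (Rabs (E * sin y + s + x * sin y) <= eps / 8 * r * 4).
    { eapply Rle_trans; [apply Rabs_triang|]. rewrite (Rabs_mult x _).
      eapply Rle_trans; [apply Rplus_le_compat_r, Rabs_triang|]. rewrite Rabs_mult.
      assert (Rabs E * Rabs (sin y) <= eps / 8 * r * 1) by (apply Hb; lra).
      assert (Rabs x * Rabs (sin y) <= eps / 8 * (2 * r)) by (apply Hb; lra). lra. }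
    unfold Rminus in *. assert (0 <= eps * r) by (apply Rmult_le_pos; [lra | apply Cmod_ge_0]). lra. }
  intros eps He. assert (HM : 0 < Cmod (cexp z)) by (apply Cmod_gt_0, cexp_neq_0).
  destruct (H0 (eps / Cmod (cexp z))) as [d [Hd H]]; [apply Rdiv_lt_0_compat; auto|].
  exists d; split; auto. intros h Hh. specialize (H h Hh).
  replace (0 + h)%C with h in H by ring. rewrite cexp_0 in H.
  rewrite cexp_plus.
  replace (cexp z * cexp h - cexp z - h * cexp z)%C with (cexp z * (cexp h - 1 - h * 1))%C by ring.
  rewrite Cmod_mult. apply Rmult_le_compat_l with (r := Cmod (cexp z)) in H; [|lra].
  eapply Rle_trans; [apply H|]. right; field; lra.
Qed.

(** Restriction to a line makes the real mean value theorem and the real second-derivative test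
    available; the factor [v] selects the coordinate of [f] to be followed. *)
Lemma cder_Re_line (f : C -> C) (z u l v : C) (t : R) :
  cder f (z + RtoC t * u)%C l ->
  is_derive (fun t => Re (v * f (z + RtoC t * u))%C) t (Re (v * (l * u))%C).
Proof.
  intros H. apply is_derive_Reals. intros eps He.
  set (M := 1 + Cmod v * Cmod u).
  assert (HM : 0 < M) by (generalize (Cmod_ge_0 v), (Cmod_ge_0 u); unfold M; intros; nra).
  destruct (H (eps / (2 * M))) as [d [Hd K]]; [apply Rdiv_lt_0_compat; lra|].
  set (d' := d / (1 + Cmod u)).
  assert (Hu := Cmod_ge_0 u).
  assert (Hd' : 0 < d') by (apply Rdiv_lt_0_compat; lra).
  exists (mkposreal d' Hd'). intros h Hn Hh. simpl in Hh.
  assert (Hhu : Cmod (RtoC h * u)%C < d).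
  { rewrite Cmod_mult, Cmod_R. apply Rle_lt_trans with (Rabs h * (1 + Cmod u)).
    generalize (Rabs_pos h); nra. unfold d' in Hh.
    apply Rmult_lt_compat_r with (r := 1 + Cmod u) in Hh; [|lra].
    unfold Rdiv in Hh; rewrite Rmult_assoc, Rinv_l in Hh; lra. }
  specialize (K _ Hhu).
  replace (z + RtoC t * u + RtoC h * u)%C with (z + RtoC (t + h) * u)%C in K
    by (rewrite RtoC_plus; ring).
  set (w := (f (z + RtoC (t + h) * u) - f (z + RtoC t * u) - RtoC h * u * l)%C) in *.
  replace ((Re (v * f (z + RtoC (t + h) * u))%C - Re (v * f (z + RtoC t * u))%C) / h - Re (v * (l * u))%C)
    with (Re (v * w)%C / h).
  2:{ replace (Re (v * w)%C) with (Re (v * f (z + RtoC (t + h) * u))%C - Re (v * f (z + RtoC t * u))%C - h * Re (v * (l * u))%C).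
      field; auto. rewrite <- Re_scal, <- !Re_minus. f_equal. unfold w; ring. }
  rewrite Rabs_div by auto.
  assert (Hha : 0 < Rabs h) by (apply Rabs_pos_lt; auto).
  apply Rmult_lt_reg_r with (Rabs h); auto. unfold Rdiv at 1. rewrite Rmult_assoc, Rinv_l, Rmult_1_r by lra.
  eapply Rle_lt_trans; [apply re_le_Cmod|]. rewrite Cmod_mult.
  rewrite Cmod_mult, Cmod_R in K.
  apply Rle_lt_trans with (Cmod v * (eps / (2 * M) * (Rabs h * Cmod u))).
  apply Rmult_le_compat_l; [apply Cmod_ge_0 | auto].
  apply Rle_lt_trans with (Rabs h * (eps / (2 * M) * M)).
  - replace (Cmod v * (eps / (2 * M) * (Rabs h * Cmod u))) with (Rabs h * (eps / (2 * M) * (Cmod v * Cmod u))) by ring.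
    apply Rmult_le_compat_l; [lra|]. apply Rmult_le_compat_l; [|unfold M; lra].
    left; apply Rdiv_lt_0_compat; lra.
  - replace (eps / (2 * M) * M) with (eps / 2) by (field; lra). nra.
Qed.

(** The real mean value theorem is applied to the component of [f] along the total increment [u],
    namely [Re (Cconj u * f)], whose own increment is [|u| ^ 2]. *)
Lemma cder_mean_value (f f' : C -> C) (z : C) (M : R) :
  (forall t, 0 <= t <= 1 -> cder f (RtoC t * z)%C (f' (RtoC t * z)%C)) ->
  (forall t, 0 <= t <= 1 -> Cmod (f' (RtoC t * z)%C) <= M) ->
  Cmod (f z - f 0)%C <= M * Cmod z.
Proof.
  intros Hd Hb. set (u := (f z - f 0)%C).
  destruct (MVT_gen (fun t => Re (Cconj u * f (0 + RtoC t * z))%C) 0 1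
     (fun t => Re (Cconj u * (f' (RtoC t * z)%C * z))%C)) as [c [Hc He]].
  - intros t Ht. rewrite Rmin_left, Rmax_right in Ht by lra.
    apply cder_Re_line. replace (0 + RtoC t * z)%C with (RtoC t * z)%C by ring. apply Hd; lra.
  - intros t Ht. rewrite Rmin_left, Rmax_right in Ht by lra.
    apply derivable_continuous_pt. eexists. apply is_derive_Reals.
    apply cder_Re_line. replace (0 + RtoC t * z)%C with (RtoC t * z)%C by ring. apply Hd; lra.
  - rewrite Rmin_left, Rmax_right in Hc by lra.
    rewrite <- Re_minus in He.
    replace (Cconj u * f (0 + RtoC 1 * z) - Cconj u * f (0 + RtoC 0 * z))%C with (u * Cconj u)%C in He.
    2:{ replace (0 + RtoC 1 * z)%C with z by ring. replace (0 + RtoC 0 * z)%C with (RtoC 0) by ring.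
        unfold u; ring. }
    rewrite <- Cmod2_conj in He.
    assert (HR : Re (RtoC (Cmod u ^ 2)) = Cmod u * Cmod u) by (simpl; ring).
    rewrite HR in He.
    assert (Re (Cconj u * (f' (RtoC c * z) * z))%C <= Cmod u * (M * Cmod z)).
    { eapply Rle_trans; [apply Re_le_Cmod|]. rewrite !Cmod_mult, Cmod_conj.
      apply Rmult_le_compat_l; [apply Cmod_ge_0|]. apply Rmult_le_compat_r; [apply Cmod_ge_0|]. apply Hb; lra. }
    destruct (Req_dec (Cmod u) 0) as [H0|H0].
    + rewrite H0. apply Rmult_le_pos; [|apply Cmod_ge_0].
      eapply Rle_trans; [apply Cmod_ge_0 | apply (Hb 0); lra].
    + assert (0 < Cmod u) by (generalize (Cmod_ge_0 u); lra).
      apply Rmult_le_reg_l with (Cmod u); auto. lra.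
Qed.

Lemma cder_zero_const f : (forall z, cder f z 0%C) -> forall z, f z = f 0%C.
Proof.
  intros H z. generalize (cder_mean_value f (fun _ => 0%C) z 0 (fun _ _ => H _)).
  rewrite Rmult_0_l; intros K.
  assert (E : (f z - f 0)%C = 0%C).
  { apply Cmod_eq_0, Rle_antisym; [|apply Cmod_ge_0]. apply K. intros; rewrite Cmod_0; lra. }
  replace (f z) with ((f z - f 0) + f 0)%C by ring. rewrite E; ring.
Qed.

(** * The maximum principle *)

Definition ccont (f : C -> C) : Prop := forall z, ccont_at f z.

Definition rcont (H : C -> R) : Prop := forall z eps, 0 < eps ->
  exists del, 0 < del /\ forall h, Cmod h < del -> Rabs (H (z + h)%C - H z) < eps.

Lemma polar_dist (s t u v : R) :
  Cmod (polar u v - polar s t)%C <= Rabs (u - s) + 2 * Rabs s * Rabs (v - t).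
Proof.
  unfold polar.
  replace (RtoC u * cis v - RtoC s * cis t)%C with (RtoC (u - s) * cis v + RtoC s * (cis v - cis t))%C
    by (rewrite RtoC_minus; ring).
  eapply Rle_trans; [apply Cmod_triangle|]. rewrite !Cmod_mult, !Cmod_R, Cmod_cis.
  generalize (cis_dist v t), (Rabs_pos s); intros. nra.
Qed.

Lemma polar_cont_2d (H : C -> R) : rcont H -> forall s t, continuity_2d_pt (fun s t => H (polar s t)) s t.
Proof.
  intros Hc s t eps. destruct (Hc (polar s t) eps (cond_pos eps)) as [d [Hd K]].
  assert (Hs := Rabs_pos s).
  set (d' := d / (1 + 2 * Rabs s)).
  assert (Hd' : 0 < d') by (apply Rdiv_lt_0_compat; lra).
  exists (mkposreal d' Hd'). simpl; intros u v Hu Hv.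
  replace (polar u v) with (polar s t + (polar u v - polar s t))%C by ring.
  apply K. eapply Rle_lt_trans; [apply polar_dist|].
  apply Rlt_le_trans with (d' * (1 + 2 * Rabs s)); [|right; unfold d'; field; lra].
  generalize (Rabs_pos (u - s)), (Rabs_pos (v - t)); intros; nra.
Qed.

(** Maximum in the angle for each radius, then in the radius. The inner maximum is continuous in the
    radius because continuity on a compact rectangle is uniform. *)
Lemma disc_max (H : C -> R) (r : R) : 0 < r -> rcont H ->
  exists z0, Cmod z0 <= r /\ forall z, Cmod z <= r -> H z <= H z0.
Proof.
  intros Hr Hc. assert (H2 := polar_cont_2d H Hc).
  assert (HPI := PI_RGT_0).
  assert (Hth : forall s, exists t, (forall t', - PI <= t' <= PI -> H (polar s t') <= H (polar s t)) /\ - PI <= t <= PI).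
  { intros s. apply (continuity_ab_maj (fun t => H (polar s t))); [lra|].
    intros t _ eps He. destruct (H2 s t (mkposreal eps He)) as [d Hd].
    exists d; split; [apply cond_pos|]. intros x [_ Hx]. apply Hd; auto.
    rewrite Rminus_diag, Rabs_R0; apply cond_pos. }
  destruct (choice _ Hth) as [th Hm].
  destruct (continuity_ab_maj (fun s => H (polar s (th s))) 0 r) as [s0 [Hs0 Hb]]; [lra| |].
  - intros s Hs eps He.
    (* Radii slightly beyond [[0, r]] are included so that a neighbour at distance less than 1 stays
       in the rectangle. *)
    destruct (uniform_continuity_2d (fun s t => H (polar s t)) (-1) (r + 1) (- PI) PI
      (fun x y _ _ => H2 x y) (mkposreal eps He)) as [d Hd].
    simpl in Hd.
    exists (Rmin d 1); split; [apply Rmin_pos; [apply cond_pos | lra]|].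
    intros u [_ Hu]. simpl in Hu |- *. unfold R_dist in *.
    destruct (Rmin_lt_inv _ _ _ Hu) as [Hu1 Hu2].
    apply Rabs_def2 in Hu2. destruct (Hm s) as [M1 I1]. destruct (Hm u) as [M2 I2].
    assert (Hz : forall t, - PI <= t <= PI -> Rabs (H (polar u t) - H (polar s t)) < eps).
    { intros t Ht. apply Hd; try lra. rewrite Rminus_diag, Rabs_R0; apply cond_pos. }
    assert (K1 := Hz _ I1). assert (K2 := Hz _ I2).
    apply Rabs_def2 in K1. apply Rabs_def2 in K2.
    specialize (M1 _ I2). specialize (M2 _ I1). apply Rabs_def1; lra.
  - exists (polar s0 (th s0)); split; [rewrite Cmod_polar; lra|].
    intros z Hz. destruct (polar_exists z) as [t [Ht ->]].
    destruct (Hm (Cmod z)) as [M _]. eapply Rle_trans; [apply M; auto|].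
    apply (Hs0 (Cmod z)). generalize (Cmod_ge_0 z); lra.
Qed.

Lemma ccont_rcont_Cmod g : ccont g -> rcont (fun z => Cmod (g z)).
Proof.
  intros H z eps He. destruct (H z eps He) as [d [Hd K]]. exists d; split; auto.
  intros h Hh. specialize (K h Hh).
  generalize (Cmod_triangle_inv (g (z + h)%C) (g z)), (Cmod_triangle_inv (g z) (g (z + h)%C)).
  rewrite (Cmod_minus_sym (g z)). intros. apply Rabs_def1; lra.
Qed.

Lemma rcont_plus F G : rcont F -> rcont G -> rcont (fun z => F z + G z).
Proof.
  intros HF HG z eps He.
  destruct (HF z (eps / 2)) as [d1 [Hd1 H1]]; [lra|].
  destruct (HG z (eps / 2)) as [d2 [Hd2 H2]]; [lra|].
  exists (Rmin d1 d2); split; [apply Rmin_pos; auto|]. intros h Hh.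
  destruct (Rmin_lt_inv _ _ _ Hh) as [Hmin1 Hmin2]. specialize (H1 h Hmin1). specialize (H2 h Hmin2).
  apply Rabs_def2 in H1. apply Rabs_def2 in H2. apply Rabs_def1; lra.
Qed.

Lemma local_max_second_derivative (g g1 : R -> R) (c d : R) : 0 < d ->
  (forall t, Rabs t < d -> is_derive g t (g1 t)) -> is_derive g1 0 c ->
  (forall t, Rabs t < d -> g t <= g 0) -> c <= 0.
Proof.
  intros Hd Hg Hg1 Hm. apply Rnot_lt_le; intros Hc.
  assert (H0 : Rabs 0 < d) by (rewrite Rabs_R0; auto).
  assert (D0 : derivable_pt_lim g 0 (g1 0)) by (apply is_derive_Reals; auto).
  assert (E0 : g1 0 = 0).
  { assert (pr : derivable_pt g 0) by (exists (g1 0); auto).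
    rewrite <- (derive_pt_eq_0 g 0 (g1 0) pr D0).
    apply (deriv_maximum g (- d) d); try lra.
    intros x H1 H2; apply Hm, Rabs_def1; lra. }
  apply is_derive_Reals in Hg1. destruct (Hg1 (c / 2)) as [d1 K]; [lra|].
  assert (Hd1 := cond_pos d1).
  set (t := Rmin d d1 / 2).
  assert (Hmin : 0 < Rmin d d1) by (apply Rmin_pos; auto).
  generalize (Rmin_l d d1), (Rmin_r d d1); intros.
  assert (Ht : 0 < t) by (unfold t; lra).
  assert (Hmv : forall a b, 0 <= a < b -> b <= t -> exists x, a <= x <= b /\ g b - g a = g1 x * (b - a)).
  { intros a b Ha Hb. destruct (MVT_gen g a b g1) as [x Hx].
    - intros x Hx. rewrite Rmin_left, Rmax_right in Hx by lra.
      apply Hg, Rabs_def1; unfold t in *; lra.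
    - intros x Hx. rewrite Rmin_left, Rmax_right in Hx by lra.
      apply derivable_continuous_pt. exists (g1 x). apply is_derive_Reals, Hg, Rabs_def1; unfold t in *; lra.
    - rewrite Rmin_left, Rmax_right in Hx by lra. exists x; auto. }
  assert (Hp : forall x, 0 < x <= t -> 0 < g1 x).
  { intros x Hx. specialize (K x ltac:(lra)). rewrite Rplus_0_l, E0 in K.
    assert (Hx1 : Rabs x < d1) by (apply Rabs_def1; unfold t in *; lra).
    specialize (K Hx1). apply Rabs_def2 in K.
    replace (g1 x) with (((g1 x - 0) / x) * x) by (field; lra). apply Rmult_lt_0_compat; lra. }
  (* Two intervals, because the intermediate point of the first may be 0, where [g1] vanishes;
     strict growth comes from the second. *)
  destruct (Hmv 0 (t / 2)) as [x1 [Hx1 He1]]; [lra | lra |].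
  destruct (Hmv (t / 2) t) as [x2 [Hx2 He2]]; [lra | lra |].
  assert (g t <= g 0) by (apply Hm, Rabs_def1; unfold t; lra).
  assert (0 <= g1 x1).
  { destruct (Req_dec x1 0) as [->|]; [lra|]. left; apply Hp; lra. }
  assert (0 < g1 x2) by (apply Hp; lra).
  assert (0 <= g1 x1 * (t / 2 - 0)) by (apply Rmult_le_pos; lra).
  assert (0 < g1 x2 * (t - t / 2)) by (apply Rmult_lt_0_compat; lra). lra.
Qed.

(** The regularity used by the second-derivative test: a derivative near the point and a second one
    at the point, with no continuity asked of the latter. *)
Definition D2 (G : C -> C) (z : C) : Prop :=
  exists (G1 : C -> C) (l : C) (d : R), 0 < d /\
    (forall h, Cmod h < d -> cder G (z + h)%C (G1 (z + h)%C)) /\ cder G1 z l.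

(** [Re (- Ci * z)] is [Im z], so both squares have the form that is differentiated along lines. *)
Lemma Cmod_Re_Im_sqr (z : C) : Cmod z ^ 2 = Re (1 * z)%C * Re (1 * z)%C + Re (- Ci * z)%C * Re (- Ci * z)%C.
Proof. rewrite Cmod2_alt. destruct z; simpl; ring. Qed.

(** Subharmonicity: the Laplacian of [|G| ^ 2] is [4 |G'| ^ 2], and the term [eps |z| ^ 2] makes the
    total strictly positive, which is impossible at a maximum. *)
Lemma no_interior_max (G : C -> C) (z : C) (eps d : R) : 0 < eps -> 0 < d -> D2 G z ->
  (forall h, Cmod h < d -> Cmod (G (z + h)%C) ^ 2 + eps * Cmod (z + h)%C ^ 2 <= Cmod (G z) ^ 2 + eps * Cmod z ^ 2) ->
  False.
Proof.
  intros He Hd (G1 & l & d1 & Hd1 & HG & HG1) Hm.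
  assert (Hdir : forall u, Cmod u = 1 ->
    (Re (1 * u * G1 z)%C ^ 2 + Re (1 * G z)%C * Re (1 * u * (l * u))%C)
    + (Re (- Ci * u * G1 z)%C ^ 2 + Re (- Ci * G z)%C * Re (- Ci * u * (l * u))%C) + eps <= 0).
  { intros u Hu.
    set (a := Cmod z ^ 2). set (b := Re z * Re u + Im z * Im u).
    set (P := fun v t => Re (v * G (z + RtoC t * u))%C).
    set (P1 := fun v t => Re (v * u * G1 (z + RtoC t * u))%C).
    assert (Hz : forall t, Cmod (z + RtoC t * u)%C ^ 2 = a + 2 * b * t + t * t).
    { intros t. unfold a, b. rewrite !Cmod2_alt.
      generalize (Cmod_sqr u); rewrite Hu; destruct z, u; simpl; intros; nra. }
    assert (Htu : forall t, Rabs t < Rmin d d1 -> Cmod (RtoC t * u)%C < d /\ Cmod (RtoC t * u)%C < d1).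
    { intros t Ht. rewrite Cmod_mult, Cmod_R, Hu.
      generalize (Rmin_l d d1), (Rmin_r d d1); lra. }
    assert (HP : forall v t, Rabs t < Rmin d d1 -> is_derive (P v) t (P1 v t)).
    { intros v t Ht. unfold P, P1.
      replace (v * u * G1 (z + RtoC t * u))%C with (v * (G1 (z + RtoC t * u) * u))%C by ring.
      apply cder_Re_line, HG, Htu; auto. }
    assert (Hz0 : (z + RtoC 0 * u)%C = z) by ring.
    assert (HP1 : forall v, is_derive (P1 v) 0 (Re (v * u * (l * u))%C)).
    { intros v. apply (cder_Re_line G1 z u l (v * u) 0). rewrite Hz0; auto. }
    assert (Hmin : 0 < Rmin d d1) by (apply Rmin_pos; auto).
    generalize (local_max_second_derivative
      (fun t => P 1%C t * P 1%C t + P (- Ci)%C t * P (- Ci)%C t + eps * (a + 2 * b * t + t * t))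
      (fun t => 2 * (P 1%C t * P1 1%C t) + 2 * (P (- Ci)%C t * P1 (- Ci)%C t) + eps * (2 * b + 2 * t))
      (2 * (P1 1%C 0 * P1 1%C 0 + P 1%C 0 * Re (1 * u * (l * u))%C)
       + 2 * (P1 (- Ci)%C 0 * P1 (- Ci)%C 0 + P (- Ci)%C 0 * Re (- Ci * u * (l * u))%C) + eps * 2)
      (Rmin d d1) Hmin).
    intros L. unfold P, P1 in L. rewrite Hz0 in L. fold P in L.
    cut (2 * (Re (1 * u * G1 z)%C * Re (1 * u * G1 z)%C + Re (1 * G z)%C * Re (1 * u * (l * u))%C) +
         2 * (Re (- Ci * u * G1 z)%C * Re (- Ci * u * G1 z)%C + Re (- Ci * G z)%C * Re (- Ci * u * (l * u))%C) + eps * 2 <= 0).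
    { simpl; intros; lra. }
    apply L.
    - intros t Ht.
      assert (A1 := HP 1%C t Ht). assert (A2 := HP (- Ci)%C t Ht). unfold P, P1 in A1, A2.
      evar_last.
      { apply (is_derive_plus (K := R_AbsRing) (V := R_NormedModule)).
        apply (is_derive_plus (K := R_AbsRing) (V := R_NormedModule)).
        apply (is_derive_mult _ _ _ _ _ A1 A1 Rmult_comm).
        apply (is_derive_mult _ _ _ _ _ A2 A2 Rmult_comm).
        instantiate (1 := eps * (2 * b + 2 * t)). auto_derive; auto; ring. }
      unfold plus, mult; simpl; ring.
    - assert (Z0 : Rabs 0 < Rmin d d1) by (rewrite Rabs_R0; auto).
      assert (A1 := HP 1%C 0 Z0). assert (A2 := HP (- Ci)%C 0 Z0).
      assert (B1 := HP1 1%C). assert (B2 := HP1 (- Ci)%C). unfold P, P1 in A1, A2, B1, B2.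
      evar_last.
      { apply (is_derive_plus (K := R_AbsRing) (V := R_NormedModule)).
        apply (is_derive_plus (K := R_AbsRing) (V := R_NormedModule)).
        apply is_derive_scal. apply (is_derive_mult _ _ _ _ _ A1 B1 Rmult_comm).
        apply is_derive_scal. apply (is_derive_mult _ _ _ _ _ A2 B2 Rmult_comm).
        instantiate (1 := eps * 2). auto_derive; auto; ring. }
      rewrite Hz0. unfold plus, mult; simpl. unfold mult; simpl. ring.
    - intros t Ht. destruct (Htu t Ht) as [T1 _]. specialize (Hm _ T1).
      rewrite Hz in Hm. change (Cmod z ^ 2) with a in Hm.
      rewrite (Cmod_Re_Im_sqr (G z)), (Cmod_Re_Im_sqr (G (z + RtoC t * u)%C)) in Hm.
      rewrite ?Hz0. unfold P; rewrite ?Hz0. lra. }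
  (* The terms with [l] carry [u * u], which is 1 and -1 in the two directions, and cancel; what
     remains is [2 |G1 z| ^ 2 + 2 eps <= 0]. *)
  generalize (Hdir 1%C Cmod_1), (Hdir Ci Cmod_Ci).
  destruct (G1 z) as [a b], (G z) as [p q], l as [l1 l2]; simpl. intros; nra.
Qed.

(** Differentiability is asked only where [G] is non-zero: if the bound failed at [z0], a zero of
    [G] could not be a maximum of the perturbed modulus. *)
Theorem max_principle (G : C -> C) (r M : R) : 0 < r -> ccont G ->
  (forall z, Cmod z < r -> G z <> 0%C -> D2 G z) ->
  (forall z, Cmod z = r -> Cmod (G z) <= M) ->
  forall z, Cmod z <= r -> Cmod (G z) <= M.
Proof.
  intros Hr Hc HD Hb z0 Hz0. apply Rnot_lt_le; intros Hlt.
  assert (HM : 0 <= M) by (eapply Rle_trans; [apply Cmod_ge_0 | apply (Hb (RtoC r))]; apply Cmod_RtoC_pos; lra).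
  (* Half of the excess, spread over the disc: [e |z| ^ 2] stays below the gap, so the perturbed
     maximum is neither on the circle nor at a zero of [G]. *)
  set (e := (Cmod (G z0) ^ 2 - M ^ 2) / (2 * r ^ 2)).
  assert (Hr2 : 0 < r ^ 2) by (apply pow_lt; auto).
  assert (He : 0 < e) by (apply Rdiv_lt_0_compat; [simpl; nra | lra]).
  assert (Hbig : M ^ 2 + e * r ^ 2 < Cmod (G z0) ^ 2).
  { replace (e * r ^ 2) with ((Cmod (G z0) ^ 2 - M ^ 2) / 2) by (unfold e; field; lra). simpl; nra. }
  assert (Hsq : forall g, ccont g -> rcont (fun z => Cmod (g z) ^ 2)).
  { intros g Hg z eps Hp.
    destruct (ccont_rcont_Cmod (fun z => g z * g z)%C (fun z => ccont_mult _ _ _ (Hg z) (Hg z)) z eps Hp) as [d [Hd K]].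
    exists d; split; auto. intros h Hh. specialize (K h Hh). rewrite !Cmod_mult in K. simpl. rewrite !Rmult_1_r. auto. }
  destruct (disc_max (fun z => Cmod (G z) ^ 2 + e * Cmod z ^ 2) r Hr) as [z1 [Hz1 Hmax]].
  { apply rcont_plus. apply Hsq; auto.
    intros z eps Hp. destruct (Hsq (fun z => z) ccont_id z (eps / e)) as [d [Hd K]]. apply Rdiv_lt_0_compat; auto.
    exists d; split; auto. intros h Hh. specialize (K h Hh).
    rewrite <- Rmult_minus_distr_l, Rabs_mult, (Rabs_pos_eq e) by lra.
    apply Rmult_lt_compat_l with (r := e) in K; auto. replace (e * (eps / e)) with eps in K by (field; lra). auto. }
  assert (H1 := Hmax z0 Hz0). cbv beta in H1.
  assert (Hsmall : forall x y, 0 <= x <= y -> x ^ 2 <= y ^ 2) by (intros; simpl; nra).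
  assert (0 <= e * Cmod z0 ^ 2) by (apply Rmult_le_pos; [lra | apply pow_le, Cmod_ge_0]).
  assert (Hin : Cmod z1 < r).
  { destruct (Rle_lt_or_eq_dec _ _ Hz1) as [|E]; auto. exfalso.
    generalize (Hsmall _ _ (conj (Cmod_ge_0 (G z1)) (Hb z1 E))). rewrite E in *. lra. }
  assert (Hn : G z1 <> 0%C).
  { intros E. rewrite E, Cmod_0 in H1.
    generalize (Hsmall _ _ (conj (Cmod_ge_0 z1) Hz1)); intros.
    assert (e * Cmod z1 ^ 2 <= e * r ^ 2) by (apply Rmult_le_compat_l; lra). assert (0 <= M ^ 2) by (apply pow_le; auto). simpl in *; lra. }
  apply (no_interior_max G z1 e (r - Cmod z1)); auto; [lra|].
  intros h Hh. apply Hmax. generalize (Cmod_triangle z1 h); lra.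
Qed.

Lemma cder_ext_loc (f g : C -> C) z l d : 0 < d ->
  (forall h, Cmod h < d -> f (z + h)%C = g (z + h)%C) -> cder f z l -> cder g z l.
Proof.
  intros Hd He H eps Hp. destruct (H eps Hp) as [d1 [Hd1 K]].
  exists (Rmin d d1); split; [apply Rmin_pos; auto|]. intros h Hh.
  destruct (Rmin_lt_inv _ _ _ Hh) as [H1 H2].
  rewrite <- He by auto. specialize (He 0%C). replace (z + 0)%C with z in He by ring.
  rewrite <- He by (rewrite Cmod_0; auto). auto.
Qed.

Lemma D2_cder G z : D2 G z -> exists l, cder G z l.
Proof.
  intros (G1 & l & d & Hd & H & _). specialize (H 0%C). rewrite Cmod_0 in H.
  replace (z + 0)%C with z in H by ring. eexists; apply H; auto.
Qed.

Lemma D2_ext_loc (f g : C -> C) z d : 0 < d ->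
  (forall h, Cmod h < d -> f (z + h)%C = g (z + h)%C) -> D2 f z -> D2 g z.
Proof.
  intros Hd He (G1 & l & d1 & Hd1 & H & H1). exists G1, l, (Rmin d d1 / 2).
  assert (Hm : 0 < Rmin d d1) by (apply Rmin_pos; auto).
  generalize (Rmin_l d d1), (Rmin_r d d1); intros.
  split; [lra|split; auto]. intros h Hh.
  apply cder_ext_loc with f (Rmin d d1 / 2); [lra| |apply H; lra].
  intros k Hk. rewrite <- Cplus_assoc. apply He. generalize (Cmod_triangle h k); lra.
Qed.

Lemma D2_mult f g z : D2 f z -> D2 g z -> D2 (fun z => f z * g z)%C z.
Proof.
  intros Hf Hg. destruct (D2_cder f z Hf) as [fl Hfl]. destruct (D2_cder g z Hg) as [gl Hgl].
  destruct Hf as (f1 & l & d & Hd & H & H1). destruct Hg as (g1 & m & d' & Hd' & K & K1).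
  exists (fun z => f1 z * g z + f z * g1 z)%C. eexists. exists (Rmin d d').
  split; [apply Rmin_pos; auto|]. split.
  - intros h Hh. apply cder_mult; [apply H | apply K].
    eapply Rlt_le_trans; [apply Hh | apply Rmin_l]. eapply Rlt_le_trans; [apply Hh | apply Rmin_r].
  - apply (cder_plus (fun z => f1 z * g z)%C (fun z => f z * g1 z)%C); apply cder_mult; eassumption.
Qed.

Lemma D2_const c z : D2 (fun _ => c) z.
Proof. exists (fun _ => 0%C), 0%C, 1; split; [lra|split]; intros; apply cder_const. Qed.

Lemma D2_inv (f : C -> C) z : f z <> 0%C -> D2 f z -> D2 (fun z => / f z)%C z.
Proof.
  intros Hz Hf. destruct (D2_cder f z Hf) as [fl Hfl].
  destruct (cder_cont _ _ _ Hfl (Cmod (f z))) as [d2 [Hd2 H2]]. apply Cmod_gt_0; auto.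
  destruct Hf as (f1 & l & d & Hd & H & H1).
  exists (fun z => - f1 z / (f z * f z))%C. eexists. exists (Rmin d d2).
  split; [apply Rmin_pos; auto|]. split.
  - intros h Hh. apply cder_inv.
    + intros E. specialize (H2 h (Rlt_le_trans _ _ _ Hh (Rmin_r _ _))). rewrite E in H2.
      replace (0 - f z)%C with (- f z)%C in H2 by ring. rewrite Cmod_opp in H2; lra.
    + apply H. eapply Rlt_le_trans; [apply Hh | apply Rmin_l].
  - apply cder_ext with (fun z => (- (1)) * f1 z * / (f z * f z))%C.
    { intros; unfold Cdiv; ring. }
    apply (cder_mult (fun z => (- (1)) * f1 z)%C (fun z => / (f z * f z))%C).
    apply (cder_mult (fun _ => (- (1))%C)); [apply cder_const | eassumption].
    apply (cder_inv (fun z => f z * f z)%C). apply Cmult_neq_0; auto. apply cder_mult; eassumption.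
Qed.

Lemma D2_pow f z n : D2 f z -> D2 (fun z => cpow (f z) n) z.
Proof. intros H; induction n; simpl; [apply D2_const | apply D2_mult; auto]. Qed.

Lemma ccont_pow f n : ccont f -> ccont (fun z => cpow (f z) n).
Proof. intros H; induction n; simpl; intros z; [apply ccont_const | apply ccont_mult; auto; apply IHn]. Qed.

(** By Bernoulli, [(a / c) ^ n] is unbounded if [a > c > 0], so constant factors disappear under
    [n]-th roots. *)
Lemma pow_root_le (a b c d : R) : 0 <= a -> 0 <= c -> 0 < b ->
  (forall n, a ^ n * b <= c ^ n * d) -> a <= c.
Proof.
  intros Ha Hc Hb H. apply Rnot_lt_le; intros Hlt.
  destruct (Req_dec c 0) as [->|Hn].
  - specialize (H 1%nat). simpl in H. assert (0 < a * b) by (apply Rmult_lt_0_compat; lra). lra.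
  - assert (Hcp : 0 < c) by lra.
    set (x := a / c - 1).
    assert (Hx : 0 < x).
    { unfold x. apply Rmult_lt_reg_r with c; auto. unfold Rdiv. rewrite Rmult_minus_distr_r, Rmult_assoc, Rinv_l; lra. }
    assert (Hd : forall n, (1 + INR n * x) * b <= d).
    { intros n. apply Rle_trans with ((1 + x) ^ n * b).
      apply Rmult_le_compat_r; [lra | apply poly; auto].
      assert (Hcn : 0 < c ^ n) by (apply pow_lt; auto).
      apply Rmult_le_reg_l with (c ^ n); auto.
      rewrite <- Rmult_assoc, <- Rpow_mult_distr.
      replace (c * (1 + x)) with a by (unfold x; field; auto). auto. }
    destruct (INR_archimed (x * b) d) as [n Hn']; [apply Rmult_lt_0_compat; auto|].
    specialize (Hd n). nra.
Qed.

(* [D] is only known to be continuous at the zeros of [F]; multiplying [D ^ n] by [F] makes it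
   vanish there, and the factor [F] disappears when taking [n]-th roots. *)
Lemma max_principle_quotient (D F K : C -> C) (r M : R) : 0 < r -> ccont D ->
  (forall z, D2 F z) -> (forall z, D2 K z) -> (forall z, (D z * F z = K z)%C) ->
  (forall z, Cmod z = r -> Cmod (D z) <= M) ->
  forall z, Cmod z <= r -> F z <> 0%C -> Cmod (D z) <= M.
Proof.
  intros Hr Hc HF HK He Hb z0 Hz0 Hn.
  assert (cF : ccont F) by (intros z; destruct (D2_cder _ _ (HF z)); eapply cder_cont; eauto).
  assert (HM : 0 <= M) by (eapply Rle_trans; [apply Cmod_ge_0 | apply (Hb (RtoC r))]; apply Cmod_RtoC_pos; lra).
  destruct (disc_max (fun z => Cmod (F z)) r Hr (ccont_rcont_Cmod F cF)) as [z1 [_ HMF]].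
  set (MF := Cmod (F z1)) in *.
  apply pow_root_le with (b := Cmod (F z0)) (d := MF); auto; [apply Cmod_ge_0 | apply Cmod_gt_0; auto|].
  intros n.
  rewrite <- Cmod_cpow, <- Cmod_mult.
  apply (max_principle (fun z => cpow (D z) n * F z)%C r); auto.
  - intros z. apply (ccont_mult (fun z => cpow (D z) n)); auto. apply ccont_pow; auto.
  - intros z Hz Hnz.
    assert (HFz : F z <> 0%C) by (intros E; apply Hnz; rewrite E; ring).
    destruct (cF z (Cmod (F z))) as [d [Hd HdF]]. apply Cmod_gt_0; auto.
    (* Near a point where [F] does not vanish, [D] equals [K / F] and inherits its
       differentiability. *)
    apply D2_ext_loc with (fun z => cpow (K z * / F z) n * F z)%C d; auto.
    + intros h Hh. specialize (HdF h Hh). rewrite <- He.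
      assert (F (z + h)%C <> 0%C).
      { intros E. rewrite E in HdF. replace (0 - F z)%C with (- F z)%C in HdF by ring.
        rewrite Cmod_opp in HdF; lra. }
      f_equal. f_equal. field; auto.
    + apply (D2_mult (fun z => cpow (K z * / F z) n)); auto.
      apply (D2_pow (fun z => K z * / F z)%C). apply (D2_mult K (fun z => / F z)%C); auto. apply D2_inv; auto.
  - intros z Hz. rewrite Cmod_mult, Cmod_cpow. apply Rmult_le_compat.
    apply pow_le, Cmod_ge_0. apply Cmod_ge_0. apply pow_incr; split; [apply Cmod_ge_0 | auto].
    apply HMF; lra.
Qed.

(** * Taylor expansion and the identity theorem *)

(** Only a chain of derivatives is recorded, with no power series; exponential sums have one because
    their derivatives are again exponential sums. *)
Definition smooth (g : C -> C) : Prop :=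
  exists gs : nat -> C -> C, (forall z, gs 0%nat z = g z) /\ forall n z, cder (gs n) z (gs (S n) z).

Lemma smooth_D2 g z : smooth g -> D2 g z.
Proof.
  intros [gs [H0 H]]. exists (gs 1%nat), (gs 2%nat z), 1. split; [lra|]. split; auto.
  intros h _. apply cder_ext with (gs 0%nat); auto.
Qed.

Lemma smooth_cont g : smooth g -> ccont g.
Proof. intros H z. destruct (D2_cder _ _ (smooth_D2 g z H)). eapply cder_cont; eauto. Qed.

Lemma smooth_shift g w : smooth g -> smooth (fun z => g (w + z)%C).
Proof.
  intros [gs [H0 H]]. exists (fun n z => gs n (w + z)%C). split; auto.
  intros n z. replace (gs (S n) (w + z)%C) with ((0 + 1) * gs (S n) (w + z))%C by ring.
  apply (cder_comp (gs n) (fun z => w + z)%C); auto. apply cder_plus; [apply cder_const | apply cder_id].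
Qed.

Lemma cder_cpow n z : cder (fun z => cpow z (S n)) z (RtoC (INR (S n)) * cpow z n)%C.
Proof.
  induction n.
  - simpl. replace (1 * 1)%C with (1 * 1 + z * 0)%C by ring.
    apply (cder_mult (fun z => z) (fun _ => RtoC 1)). apply cder_id. apply cder_const.
  - rewrite S_INR, RtoC_plus.
    replace ((RtoC (INR (S n)) + 1) * cpow z (S n))%C with
     (1 * cpow z (S n) + z * (RtoC (INR (S n)) * cpow z n))%C by (simpl; ring).
    apply (cder_mult (fun z => z) (fun z => cpow z (S n))); auto. apply cder_id.
Qed.

(** Induction on [m] through the derivative: the expansion of [gs 1] is integrated with the mean
    value bound, which divides the coefficient by the new order. The implication for a vanishing
    derivative gives flatness when all derivatives vanish. *)
Lemma taylor_leading (gs : nat -> C -> C) (m : nat) :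
  (forall n z, cder (gs n) z (gs (S n) z)) -> (forall j, (j < m)%nat -> gs j 0%C = 0%C) ->
  exists b : C, (gs m 0%C <> 0%C -> b <> 0%C) /\ (gs m 0%C = 0%C -> b = 0%C) /\
    forall eps, 0 < eps -> exists rho, 0 < rho /\
      forall z, Cmod z < rho -> Cmod (gs 0%nat z - b * cpow z m)%C <= eps * Cmod z ^ m.
Proof.
  revert gs; induction m; intros gs Hd H0.
  - exists (gs 0%nat 0%C). repeat split; auto. intros eps He.
    destruct (cder_cont _ _ _ (Hd 0%nat 0%C) eps He) as [d [Hdp K]].
    exists d; split; auto. intros z Hz. specialize (K z Hz). replace (0 + z)%C with z in K by ring.
    simpl. replace (gs 0%nat 0 * 1)%C with (gs 0%nat 0%C) by ring. lra.
  - destruct (IHm (fun n => gs (S n))) as [b' [Hb1 [Hb2 Hb]]]; auto.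
    { intros j Hj. apply H0; lia. }
    assert (HS : RtoC (INR (S m)) <> RtoC 0).
    { intros E. apply RtoC_inj in E. revert E; apply not_0_INR; lia. }
    exists (b' / RtoC (INR (S m)))%C. split; [|split].
    + intros Hn E. apply (Hb1 Hn). replace b' with (b' / RtoC (INR (S m)) * RtoC (INR (S m)))%C by (field; auto).
      rewrite E; ring.
    + intros E. rewrite (Hb2 E). field; auto.
    + intros eps He. destruct (Hb eps He) as [rho [Hr K]]. exists rho; split; auto. intros z Hz.
      set (g := fun z => (gs 0%nat z - b' / RtoC (INR (S m)) * cpow z (S m))%C).
      assert (Hg0 : g 0%C = 0%C) by (unfold g; simpl; rewrite (H0 0%nat) by lia; ring).
      generalize (cder_mean_value g (fun z => (gs 1%nat z - b' * cpow z m))%C z (eps * Cmod z ^ m)).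
      intros L. rewrite Hg0 in L. unfold g in L. simpl (Cmod z ^ S m).
      replace (eps * (Cmod z * Cmod z ^ m)) with (eps * Cmod z ^ m * Cmod z) by ring.
      match type of L with _ -> _ -> Cmod ?x <= _ =>
        replace (gs 0%nat z - b' / RtoC (INR (S m)) * cpow z (S m))%C with x by ring end.
      apply L.
      * intros t _.
        set (y := (RtoC t * z)%C).
        apply cder_ext with (fun z => gs 0%nat z + (- (b' / RtoC (INR (S m)))) * cpow z (S m))%C.
        { intros; ring. }
        replace (gs 1%nat y - b' * cpow y m)%C with
          (gs 1%nat y + (0 * cpow y (S m) + (- (b' / RtoC (INR (S m)))) * (RtoC (INR (S m)) * cpow y m)))%C
          by (field; auto).
        apply cder_plus; auto.
        apply (cder_mult (fun _ => (- (b' / RtoC (INR (S m))))%C)). apply cder_const. apply cder_cpow.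
      * intros t Ht. assert (Hm : Cmod (RtoC t * z)%C <= Cmod z).
        { rewrite Cmod_mult, Cmod_RtoC_pos by lra. generalize (Cmod_ge_0 z); nra. }
        eapply Rle_trans; [apply K; lra|]. apply Rmult_le_compat_l; [lra|].
        apply pow_incr; split; [apply Cmod_ge_0 | auto].
Qed.

Lemma pow_to_0 (a M x : R) : 0 <= a < 1 -> (forall k : nat, x <= M * a ^ k) -> x <= 0.
Proof.
  intros Ha H. apply Rnot_lt_le; intros Hx.
  assert (HM : 0 < M) by (specialize (H 0%nat); simpl in H; lra).
  destruct (pow_lt_1_zero a) with (x / (2 * M)) as [N HN]; [rewrite Rabs_pos_eq; lra | apply Rdiv_lt_0_compat; lra|].
  specialize (HN N (le_n _)). specialize (H N).
  rewrite Rabs_pos_eq in HN by (apply pow_le; lra).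
  apply Rmult_lt_compat_l with (r := M) in HN; auto.
  replace (M * (x / (2 * M))) with (x / 2) in HN by (field; lra). lra.
Qed.

(* Maximum principle for [g / z ^ k], for every [k]. *)
Lemma flat_zero (g : C -> C) : smooth g ->
  (forall k, exists rho c, 0 < rho /\ forall z, Cmod z < rho -> Cmod (g z) <= c * Cmod z ^ k) ->
  forall z, g z = 0%C.
Proof.
  (* The radius exceeds [|z0|], so that the bounds [M * (|z0| / r) ^ k] tend to 0 as [k] grows. *)
  intros Hg Hk z0. set (r := 2 * (1 + Cmod z0)).
  assert (Hz0 := Cmod_ge_0 z0). assert (Hr : 0 < r) by (unfold r; lra).
  assert (cg := smooth_cont g Hg).
  destruct (disc_max (fun z => Cmod (g z)) r Hr (ccont_rcont_Cmod g cg)) as [z1 [_ HM]].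
  set (M := Cmod (g z1)) in *.
  destruct (excluded_middle_informative (z0 = RtoC 0)) as [->|Hn].
  { destruct (Hk 1%nat) as (rho & c & Hr1 & K). apply Cmod_eq_0, Rle_antisym; [|apply Cmod_ge_0].
    generalize (K 0%C); rewrite Cmod_0; simpl; intros L. specialize (L Hr1). lra. }
  apply Cmod_eq_0, Rle_antisym; [|apply Cmod_ge_0].
  apply pow_to_0 with (Cmod z0 / r) M.
  { split. apply Rdiv_le_0_compat; auto. apply Rmult_lt_reg_r with r; auto.
    unfold Rdiv; rewrite Rmult_assoc, Rinv_l; unfold r in *; lra. }
  intros k.
  (* The value 0 at the origin is the right one: flatness of order [k + 1] makes the quotient tend
     to 0 there, and the maximum principle asks for no derivative at a zero of [G]. *)
  set (G := fun z => match excluded_middle_informative (z = RtoC 0) with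
                     | left _ => RtoC 0 | right _ => (g z * / cpow z k)%C end).
  assert (HG : forall z : C, z <> 0%C -> exists d, 0 < d /\ forall h, Cmod h < d -> (g (z + h) * / cpow (z + h) k = G (z + h))%C).
  { intros z Hz. exists (Cmod z); split; [apply Cmod_gt_0; auto|]. intros h Hh. unfold G.
    destruct excluded_middle_informative as [E|]; auto. exfalso.
    replace h with (- z)%C in Hh. rewrite Cmod_opp in Hh; lra.
    replace h with ((z + h) - z)%C by ring. rewrite E; ring. }
  assert (HD : forall z : C, z <> 0%C -> D2 G z).
  { intros z Hz. destruct (HG z Hz) as [d [Hd E]].
    apply D2_ext_loc with (fun z => g z * / cpow z k)%C d; auto.
    apply (D2_mult g (fun z => / cpow z k)%C). apply smooth_D2; auto.
    apply (D2_inv (fun z => cpow z k)). apply cpow_neq_0; auto.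
    apply (D2_pow (fun z => z)). exists (fun _ => 1%C), 0%C, 1.
    split; [lra|]; split; intros; [apply cder_id | apply cder_const]. }
  assert (Hb : Cmod (G z0) <= M / r ^ k).
  { apply (max_principle G r); auto.
    - intros z. destruct (excluded_middle_informative (z = RtoC 0)) as [->|Hz].
      2:{ destruct (D2_cder _ _ (HD z Hz)). eapply cder_cont; eauto. }
      intros eps He. destruct (Hk (S k)) as (rho & c & Hrho & K).
      assert (Hc : 0 < Rabs c + 1) by (generalize (Rabs_pos c); lra).
      exists (Rmin rho (eps / (Rabs c + 1))). split; [apply Rmin_pos; auto; apply Rdiv_lt_0_compat; auto|].
      intros h Hh. replace (0 + h)%C with h by ring.
      destruct (Rmin_lt_inv _ _ _ Hh) as [H1 H2].
      unfold G. destruct (excluded_middle_informative (RtoC 0 = RtoC 0)) as [_|]; [|congruence].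
      destruct excluded_middle_informative as [|Hn0].
      replace (0 - 0)%C with (RtoC 0) by ring. rewrite Cmod_0; auto.
      replace (g h * / cpow h k - 0)%C with (g h * / cpow h k)%C by ring.
      rewrite Cmod_mult, Cmod_inv, Cmod_cpow by (apply cpow_neq_0; auto).
      assert (Hp : 0 < Cmod h) by (apply Cmod_gt_0; auto).
      assert (Hpk : 0 < Cmod h ^ k) by (apply pow_lt; auto).
      specialize (K h H1). simpl in K.
      apply Rle_lt_trans with ((Rabs c + 1) * Cmod h).
      + apply Rmult_le_reg_r with (Cmod h ^ k); auto. rewrite Rmult_assoc, Rinv_l, Rmult_1_r by lra.
        eapply Rle_trans; [apply K|]. rewrite <- Rmult_assoc. apply Rmult_le_compat_r; [lra|].
        apply Rmult_le_compat_r; [lra|]. generalize (Rle_abs c); lra.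
      + apply Rmult_lt_compat_l with (r := Rabs c + 1) in H2; auto.
        replace ((Rabs c + 1) * (eps / (Rabs c + 1))) with eps in H2 by (field; lra). auto.
    - intros z Hz HGz. apply HD. intros E. apply HGz. unfold G. rewrite E.
      destruct excluded_middle_informative; congruence.
    - intros z Hz. unfold G. destruct excluded_middle_informative as [->|Hnz].
      { rewrite Cmod_0 in Hz; lra. }
      rewrite Cmod_mult, Cmod_inv, Cmod_cpow, Hz by (apply cpow_neq_0; auto).
      apply Rmult_le_compat_r. left; apply Rinv_0_lt_compat, pow_lt; auto. apply HM; lra.
    - unfold r; lra. }
  unfold G in Hb. destruct excluded_middle_informative as [|_]; [contradiction|].
  rewrite Cmod_mult, Cmod_inv, Cmod_cpow in Hb by (apply cpow_neq_0; auto).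
  assert (Hp : 0 < Cmod z0) by (apply Cmod_gt_0; auto).
  assert (Hpk : 0 < Cmod z0 ^ k) by (apply pow_lt; auto).
  apply Rmult_le_compat_r with (r := Cmod z0 ^ k) in Hb; [|lra].
  rewrite Rmult_assoc, Rinv_l, Rmult_1_r in Hb by lra.
  eapply Rle_trans; [apply Hb|]. right. unfold Rdiv. rewrite Rpow_mult_distr, pow_inv. ring.
Qed.

Lemma smooth_leading (g : C -> C) : smooth g -> (exists z, g z <> 0%C) ->
  exists (b : C) (m : nat), b <> 0%C /\ forall eps, 0 < eps -> exists rho, 0 < rho /\
      forall z, Cmod z < rho -> Cmod (g z - b * cpow z m)%C <= eps * Cmod z ^ m.
Proof.
  intros Hg [z0 Hz0]. assert (Hg' := Hg). destruct Hg' as [gs [H0 H]].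
  destruct (classic (exists m, gs m 0%C <> 0%C)) as [Hex|Hno].
  - assert (Hmin : exists m, gs m 0%C <> 0%C /\ forall j, (j < m)%nat -> gs j 0%C = 0%C).
    { destruct Hex as [m Hm]. revert Hm. induction m as [m IH] using Wf_nat.lt_wf_ind. intros Hm.
      destruct (classic (exists j, (j < m)%nat /\ gs j 0%C <> 0%C)) as [[j [Hj Hj']]|Hn].
      - apply (IH j); auto.
      - exists m; split; auto. intros j Hj. apply NNPP; intros E; apply Hn; eauto. }
    destruct Hmin as [m [Hm Hj]]. destruct (taylor_leading gs m H Hj) as [b [Hb [_ Ht]]].
    exists b, m; split; auto. intros eps He. destruct (Ht eps He) as [rho [Hr K]].
    exists rho; split; auto. intros z Hz; rewrite <- H0; auto.
  - exfalso; apply Hz0. apply flat_zero; auto. intros k.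
    assert (Hall : forall j, gs j 0%C = 0%C) by (intros j; apply NNPP; intros E; apply Hno; eauto).
    destruct (taylor_leading gs k H (fun j _ => Hall j)) as [b [_ [Hb Ht]]].
    destruct (Ht 1 Rlt_0_1) as [rho [Hr K]]. exists rho, 1; split; auto. intros z Hz.
    rewrite <- H0. specialize (K z Hz). rewrite (Hb (Hall k)) in K.
    replace (gs 0%nat z - 0 * cpow z k)%C with (gs 0%nat z) in K by ring. auto.
Qed.

Lemma smooth_identity (g : C -> C) (w : C) (d : R) : smooth g -> 0 < d ->
  (forall h, Cmod h < d -> g (w + h)%C = 0%C) -> forall z, g z = 0%C.
Proof.
  intros Hg Hd H z. replace z with (w + (z - w))%C by ring.
  apply (flat_zero (fun z => g (w + z)%C)). apply smooth_shift; auto.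
  intros k. exists d, 1; split; auto. intros h Hh. rewrite H, Cmod_0 by auto.
  rewrite Rmult_1_l. apply pow_le, Cmod_ge_0.
Qed.

(** * A discrete Jensen inequality *)

Definition logp (x : R) : R := Rmax 0 (ln x).

(** [ln] takes the default value 0 on non-positive reals and is not continuous at 0; this form shows
    that its positive part is continuous everywhere. *)
Lemma logp_eq x : logp x = ln (Rmax 1 x).
Proof.
  unfold logp. destruct (Rle_dec x 1) as [H|H].
  - rewrite (Rmax_left 1) by auto. rewrite ln_1. apply Rmax_left.
    destruct (Rlt_dec 0 x) as [Hx|Hx].
    + rewrite <- ln_1. destruct (Rle_lt_or_eq_dec _ _ H) as [| ->]; [left; apply ln_increasing; auto | right; auto].
    + unfold ln. destruct (Rlt_dec 0 x); [contradiction | lra].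
  - rewrite (Rmax_right 1) by lra. apply Rmax_right. rewrite <- ln_1. left; apply ln_increasing; lra.
Qed.

Lemma logp_pos x : 0 <= logp x.
Proof. apply Rmax_l. Qed.

Lemma le_exp_logp x : x <= exp (logp x).
Proof. rewrite logp_eq, exp_ln; [apply Rmax_r | generalize (Rmax_l 1 x); lra]. Qed.

Lemma logp_le x y : 0 <= y -> x <= exp y -> logp x <= y.
Proof.
  intros Hy Hx. rewrite logp_eq. rewrite <- (ln_exp y).
  assert (H : Rmax 1 x <= exp y).
  { apply Rmax_lub; auto. rewrite <- exp_0. destruct Hy as [| <-]; [left; apply exp_increasing; auto | lra]. }
  assert (0 < Rmax 1 x) by (generalize (Rmax_l 1 x); lra).
  destruct H as [| ->]; [left; apply ln_increasing; auto | lra].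
Qed.

Lemma continuous_logp x : continuous logp x.
Proof.
  apply continuous_ext with (fun x => ln (Rmax 1 x)); [intros; symmetry; apply logp_eq|].
  apply continuous_comp.
  - apply (continuous_ext (fun x => (1 + x + Rabs (x - 1)) / 2)).
    { intros y. unfold Rmax; destruct Rle_dec; [rewrite Rabs_pos_eq | rewrite Rabs_left]; lra. }
    apply continuity_pt_filterlim. reg.
  - apply continuity_pt_filterlim. apply derivable_continuous_pt. exists (/ Rmax 1 x).
    apply derivable_pt_lim_ln. generalize (Rmax_l 1 x); lra.
Qed.

Lemma continuous_circle (H : C -> R) r th : rcont H -> continuous (fun th => H (polar r th)) th.
Proof.
  intros Hc. apply continuity_pt_filterlim. intros eps He.
  destruct (polar_cont_2d H Hc r th (mkposreal eps He)) as [d Hd].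
  exists d; split; [apply cond_pos|]. intros x [_ Hx]. apply Hd; auto.
  rewrite Rminus_diag, Rabs_R0; apply cond_pos.
Qed.

Lemma continuous_logp_circle D r th : ccont D -> continuous (fun th => logp (Cmod (D (polar r th)))) th.
Proof.
  intros H. apply (continuous_comp (fun th => Cmod (D (polar r th))) logp); [|apply continuous_logp].
  apply (continuous_circle (fun z => Cmod (D z))), ccont_rcont_Cmod; auto.
Qed.

Lemma ex_RInt_cont (phi : R -> R) a b : (forall x, continuous phi x) -> ex_RInt phi a b.
Proof. intros H; apply (ex_RInt_continuous (V := R_CompleteNormedModule)); intros; apply H. Qed.

Lemma RInt_split (phi : R -> R) a b c : (forall x, continuous phi x) ->
  RInt phi a c = RInt phi a b + RInt phi b c.
Proof.
  intros H. symmetry. apply (RInt_Chasles (V := R_CompleteNormedModule) phi); apply ex_RInt_cont; auto.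
Qed.

Lemma RInt_period (phi : R -> R) a : (forall x, continuous phi x) -> (forall x, phi (x + 2 * PI) = phi x) ->
  RInt phi a (a + 2 * PI) = RInt phi 0 (2 * PI).
Proof.
  intros Hc Hp. rewrite (RInt_split phi a 0) by auto.
  rewrite (RInt_split phi 0 (2 * PI) (a + 2 * PI)) by auto.
  rewrite <- (opp_RInt_swap phi 0 a) by (apply ex_RInt_cont; auto).
  assert (E : RInt phi (2 * PI) (a + 2 * PI) = RInt phi 0 a).
  { generalize (RInt_comp_lin phi 1 (2 * PI) 0 a). intros L.
    replace (1 * 0 + 2 * PI) with (2 * PI) in L by ring. replace (1 * a + 2 * PI) with (a + 2 * PI) in L by ring.
    rewrite <- L by (apply ex_RInt_cont; auto). apply RInt_ext. intros x _.
    replace (1 * x + 2 * PI) with (x + 2 * PI) by ring. rewrite Hp. apply Rmult_1_l. }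
  rewrite E. unfold opp; simpl. ring.
Qed.

(** * Riemann sums and products over rotated points *)

Fixpoint rsum (g : nat -> R) (n : nat) : R :=
  match n with O => 0 | S k => rsum g k + g k end.

(** The number of points is uniform in the starting angle [a]: the step is below a modulus of
    uniform continuity for tolerance 1, so each sample is at most 1 plus the mean over its
    subinterval. *)
Lemma riemann_sum_le (phi : R -> R) : (forall x, continuous phi x) -> (forall x, phi (x + 2 * PI) = phi x) ->
  exists N, (0 < N)%nat /\ forall a, - PI <= a <= PI ->
    rsum (fun k => phi (a + INR k * (2 * PI / INR N))) N <= INR N * (1 + RInt phi 0 (2 * PI) / (2 * PI)).
Proof.
  intros Hc Hp. assert (HPI := PI_RGT_0).
  (* This interval contains [[a, a + 2 * PI]] for every [a] in [[- PI, PI]]. *)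
  destruct (Heine_cor2 (f := phi) (a := - PI) (b := 3 * PI)
    (fun x _ => proj2 (continuity_pt_filterlim phi x) (Hc x)) (mkposreal 1 Rlt_0_1)) as [d Hd].
  simpl in Hd. assert (Hdp := cond_pos d).
  destruct (INR_archimed d (2 * PI)) as [N HN]; auto.
  assert (HN0 : (0 < N)%nat).
  { destruct N; [|lia]. simpl in HN; lra. }
  exists N; split; auto. intros a Ha.
  assert (HNp : 0 < INR N) by (apply lt_0_INR; auto).
  set (h := 2 * PI / INR N). assert (Hh : 0 < h) by (apply Rdiv_lt_0_compat; lra).
  assert (Hhd : h < d).
  { unfold h. apply Rmult_lt_reg_r with (INR N); auto. unfold Rdiv. rewrite Rmult_assoc, Rinv_l; lra. }
  assert (HNh : INR N * h = 2 * PI) by (unfold h; field; lra).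
  assert (L : forall n, (n <= N)%nat ->
    h * rsum (fun k => phi (a + INR k * h)) n <= RInt phi a (a + INR n * h) + INR n * h).
  { induction n; intros Hn.
    - replace (a + INR 0 * h) with a by (simpl; ring). rewrite RInt_point.
      simpl. unfold zero; simpl. lra.
    - simpl rsum. rewrite S_INR, (RInt_split phi a (a + INR n * h)) by auto.
      specialize (IHn ltac:(lia)).
      assert (HnN : INR n + 1 <= INR N) by (rewrite <- S_INR; apply le_INR; auto).
      assert (Hn0 := pos_INR n).
      set (x0 := a + INR n * h) in *.
      assert (K : RInt (fun _ => phi x0 - 1) x0 (a + (INR n + 1) * h) <= RInt phi x0 (a + (INR n + 1) * h)).
      { apply RInt_le.
        - unfold x0; lra.
        - apply ex_RInt_const.
        - apply ex_RInt_cont; auto.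
        - intros x Hx.
          assert (0 <= INR n * h) by (apply Rmult_le_pos; lra).
          assert ((INR n + 1) * h <= 2 * PI) by (rewrite <- HNh; apply Rmult_le_compat_r; lra).
          unfold x0 in *.
          generalize (Hd (a + INR n * h) x). intros Q.
          assert (Q' : Rabs (phi (a + INR n * h) - phi x) < 1).
          { apply Q; try lra. apply Rabs_def1; lra. }
          apply Rabs_def2 in Q'; lra. }
      rewrite RInt_const in K. unfold scal in K; simpl in K. unfold mult in K; simpl in K.
      replace (a + (INR n + 1) * h - x0) with h in K by (unfold x0; ring). lra. }
  specialize (L N (le_n _)). rewrite HNh, RInt_period in L by auto.
  apply Rmult_le_reg_l with h; auto.
  replace (h * (INR N * (1 + RInt phi 0 (2 * PI) / (2 * PI)))) with (RInt phi 0 (2 * PI) + 2 * PI).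
  auto. rewrite <- Rmult_assoc, (Rmult_comm h), HNh. field; lra.
Qed.

Fixpoint cprod (g : nat -> C) (n : nat) : C :=
  match n with O => RtoC 1 | S k => (cprod g k * g k)%C end.

Lemma cprod_D2 (g : nat -> C -> C) n : (forall k z, D2 (g k) z) -> forall z, D2 (fun z => cprod (fun k => g k z) n) z.
Proof. intros H z; induction n; simpl; [apply D2_const | apply (D2_mult (fun z => cprod (fun k => g k z) n)); auto]. Qed.

Lemma cprod_cont (g : nat -> C -> C) n : (forall k, ccont (g k)) -> ccont (fun z => cprod (fun k => g k z) n).
Proof. intros H z; induction n; simpl; [apply ccont_const | apply (ccont_mult (fun z => cprod (fun k => g k z) n)); auto; apply H]. Qed.

Lemma cprod_mult f g n : cprod (fun k => f k * g k)%C n = (cprod f n * cprod g n)%C.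
Proof. induction n; simpl; [ring | rewrite IHn; ring]. Qed.

Lemma cprod_ext f g n : (forall k, f k = g k) -> cprod f n = cprod g n.
Proof. intros H; induction n; simpl; congruence. Qed.

Lemma cprod_neq_0 (f : nat -> C) n : (forall k : nat, f k <> 0%C) -> cprod f n <> 0%C.
Proof.
  intros H; induction n; simpl; [|apply Cmult_neq_0; auto].
  intros E; apply (f_equal Re) in E; simpl in E; lra.
Qed.

Lemma cprod_le (f : nat -> C) phi n : (forall k, Cmod (f k) <= exp (phi k)) -> Cmod (cprod f n) <= exp (rsum phi n).
Proof.
  intros H; induction n; simpl; [rewrite Cmod_1, exp_0; lra|].
  rewrite Cmod_mult, exp_plus. apply Rmult_le_compat; auto; apply Cmod_ge_0.
Qed.

Lemma cprod_ge (f : nat -> C) eta n : 0 <= eta -> (forall k, eta <= Cmod (f k)) -> eta ^ n <= Cmod (cprod f n).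
Proof.
  intros He H; induction n; simpl; [rewrite Cmod_1; lra|].
  rewrite Cmod_mult, Rmult_comm. apply Rmult_le_compat; auto. apply pow_le; auto.
Qed.

Lemma D2_scale f w z : (forall z, D2 f z) -> D2 (fun z => f (z * w)%C) z.
Proof.
  intros H. destruct (H (z * w)%C) as (f1 & l & d & Hd & H1 & H2).
  assert (Hm : forall y, cder (fun z => z * w)%C y w).
  { intros y. evar_last. apply (cder_mult (fun z => z) (fun _ => w)). apply cder_id. apply cder_const. ring. }
  assert (Hw := Cmod_ge_0 w).
  exists (fun z => w * f1 (z * w))%C. eexists. exists (d / (1 + Cmod w)).
  split; [apply Rdiv_lt_0_compat; lra|]. split.
  - intros h Hh. apply (cder_comp f (fun z => z * w)%C); auto.
    replace ((z + h) * w)%C with (z * w + h * w)%C by ring. apply H1. rewrite Cmod_mult.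
    apply Rle_lt_trans with (Cmod h * (1 + Cmod w)). generalize (Cmod_ge_0 h); nra.
    apply Rmult_lt_compat_r with (r := 1 + Cmod w) in Hh; [|lra].
    unfold Rdiv in Hh; rewrite Rmult_assoc, Rinv_l in Hh; lra.
  - apply (cder_mult (fun _ => w)); [apply cder_const|]. apply (cder_comp f1 (fun z => z * w)%C); eauto.
Qed.

Lemma polar_rot r a b : (polar r a * cis b)%C = polar r (a + b).
Proof. unfold polar. rewrite cis_plus. ring. Qed.

(** Angles enter [bump] through a cosine, which forgets the period; here a representative inside the
    sector is recovered. *)
Lemma cos_gt_sector (th w : R) : 0 < w < PI -> cos w < cos th -> exists t, - w < t < w /\ cis th = cis t.
Proof.
  intros Hw Hc. destruct (polar_exists (cis th)) as [t [Ht E]]. rewrite Cmod_cis in E.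
  assert (E' : cis th = cis t) by (rewrite E; unfold polar; ring).
  exists t; split; auto. rewrite !cis_val in E'. injection E' as E1 E2.
  rewrite E1 in Hc. split; apply Rnot_le_lt; intros Hl.
  - assert (cos (- t) <= cos w); [|rewrite cos_neg in *; lra].
    destruct (Req_dec (- t) w) as [->|]; [lra|]. left; apply cos_decreasing_1; lra.
  - assert (cos t <= cos w); [|lra].
    destruct (Req_dec t w) as [->|]; [lra|]. left; apply cos_decreasing_1; lra.
Qed.

(** A continuous periodic weight, at most 1 since a difference of cosines is at most 2; for
    [0 < w < PI] it is positive exactly on the sector of half-width [w] about [th0], modulo
    [2 * PI]. *)
Definition bump (th0 w th : R) : R := Rmax 0 (cos (th - th0) - cos w) / 2.

Lemma bump_cont th0 w th : continuous (bump th0 w) th.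
Proof.
  apply (continuous_ext (fun th => (cos (th - th0) - cos w + Rabs (cos (th - th0) - cos w)) / 4)).
  { intros y. unfold bump, Rmax; destruct Rle_dec; [rewrite Rabs_pos_eq | rewrite Rabs_left]; lra. }
  apply continuity_pt_filterlim. reg.
Qed.

Lemma bump_period th0 w th : bump th0 w (th + 2 * PI) = bump th0 w th.
Proof.
  unfold bump. replace (th + 2 * PI - th0) with (th - th0 + 2 * PI) by ring.
  rewrite cos_plus, cos_2PI, sin_2PI. do 3 f_equal. ring.
Qed.

Lemma bump_bounds th0 w th : 0 <= bump th0 w th <= 1.
Proof.
  unfold bump. generalize (Rmax_l 0 (cos (th - th0) - cos w)), (COS_bound (th - th0)), (COS_bound w); intros.
  assert (Rmax 0 (cos (th - th0) - cos w) <= 2) by (apply Rmax_lub; lra). lra.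
Qed.

Lemma bump_RInt th0 w : 0 < w < PI -> 0 < RInt (bump th0 w) 0 (2 * PI).
Proof.
  intros Hw. rewrite <- (RInt_period (bump th0 w) (th0 - w)); [|apply bump_cont | apply bump_period].
  rewrite (RInt_split _ (th0 - w) (th0 + w)) by apply bump_cont.
  assert (0 < RInt (bump th0 w) (th0 - w) (th0 + w)).
  { apply RInt_gt_0; [lra| |intros; apply bump_cont].
    intros x Hx. unfold bump.
    assert (cos w < cos (x - th0)).
    { destruct (Rle_dec 0 (x - th0)). apply cos_decreasing_1; lra.
      rewrite <- (cos_neg (x - th0)). apply cos_decreasing_1; lra. }
    rewrite Rmax_right; lra. }
  assert (0 <= RInt (bump th0 w) (th0 + w) (th0 - w + 2 * PI)).
  { apply RInt_ge_0; [lra | apply ex_RInt_cont, bump_cont | intros; apply bump_bounds]. }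
  lra.
Qed.

(* The product of the rotates of [D] turns the mean of [ln |D|] over a circle into a supremum,
   so that Jensen's inequality follows from the maximum principle. *)
Lemma quotient_decay_zero (D F K : C -> C) (s : nat) (c a b R1 : R) :
  ccont D -> smooth F -> smooth K -> (forall z, (D z * F z = K z)%C) ->
  (1 <= s)%nat -> 0 < c -> a < b ->
  (forall r th, R1 <= r -> a <= th <= b -> Cmod (D (polar r th)) <= exp (- c * r ^ s)) ->
  (forall eps, 0 < eps -> exists R0, forall r, R0 <= r ->
     RInt (fun th => logp (Cmod (D (polar r th)))) 0 (2 * PI) <= eps * r ^ s) ->
  forall z, K z = 0%C.
Proof.
  intros cD sF sK He Hs Hc Hab Hsec HT z0. apply NNPP; intros Hz0.
  assert (HPI := PI_RGT_0).
  destruct (smooth_leading K sK (ex_intro _ z0 Hz0)) as (b0 & m & Hb0 & Hlead).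
  assert (Hb0p : 0 < Cmod b0) by (apply Cmod_gt_0; auto).
  destruct (Hlead (Cmod b0 / 2)) as (rho1 & Hrho1 & K1); [lra|].
  destruct (smooth_cont F sF 0%C 1 Rlt_0_1) as (rho2 & Hrho2 & K2).
  set (rho := Rmin rho1 rho2 / 2).
  assert (Hm : 0 < Rmin rho1 rho2) by (apply Rmin_pos; auto).
  assert (Hr1 : rho < rho1) by (generalize (Rmin_l rho1 rho2); unfold rho; lra).
  assert (Hr2 : rho < rho2) by (generalize (Rmin_r rho1 rho2); unfold rho; lra).
  assert (Hrho : 0 < rho) by (unfold rho; lra).
  (* On a small circle [|K| >= |b0| / 2 * rho ^ m] by the leading term and [|F| <= |F 0| + 1] by
     continuity, whence this lower bound for [|D|]. *)
  set (eta := Cmod b0 / 2 * rho ^ m / (Cmod (F 0%C) + 1)).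
  assert (HF0 := Cmod_ge_0 (F 0%C)).
  assert (Heta : 0 < eta).
  { unfold eta. apply Rdiv_lt_0_compat; [|lra]. apply Rmult_lt_0_compat; [lra | apply pow_lt; auto]. }
  assert (Hcirc : forall z, Cmod z = rho -> eta <= Cmod (D z) /\ F z <> 0%C).
  { intros z Hz. assert (Hkz : Cmod b0 / 2 * rho ^ m <= Cmod (K z)).
    { specialize (K1 z ltac:(lra)). rewrite Hz in K1.
      generalize (Cmod_triangle_inv (b0 * cpow z m)%C (b0 * cpow z m - K z)%C).
      replace (b0 * cpow z m - (b0 * cpow z m - K z))%C with (K z) by ring.
      rewrite (Cmod_minus_sym _ (K z)), Cmod_mult, Cmod_cpow, Hz. lra. }
    assert (Hkp : 0 < Cmod b0 / 2 * rho ^ m) by (apply Rmult_lt_0_compat; [lra | apply pow_lt; auto]).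
    rewrite <- He, Cmod_mult in Hkz.
    assert (HFz : Cmod (F z) <= Cmod (F 0%C) + 1).
    { specialize (K2 z ltac:(lra)). replace (0 + z)%C with z in K2 by ring.
      generalize (Cmod_triangle_inv (F z) (F 0%C)); lra. }
    split.
    - unfold eta. apply Rmult_le_reg_r with (Cmod (F 0%C) + 1); [lra|].
      unfold Rdiv at 1. rewrite Rmult_assoc, Rinv_l, Rmult_1_r by lra.
      eapply Rle_trans; [apply Hkz|]. apply Rmult_le_compat_l; [apply Cmod_ge_0 | auto].
    - intros E. rewrite E, Cmod_0 in Hkz. lra. }
  set (th0 := (a + b) / 2). set (w := Rmin ((b - a) / 2) 1).
  assert (Hw : 0 < w < PI).
  { split. apply Rmin_pos; lra. apply Rle_lt_trans with 1; [apply Rmin_r | generalize PI2_1; lra]. }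
  assert (Hwab : w <= (b - a) / 2) by apply Rmin_l.
  set (beta := RInt (bump th0 w) 0 (2 * PI)).
  assert (Hbeta : 0 < beta) by (apply bump_RInt; auto).
  destruct (HT (c * beta / 2)) as [R0 HR0].
  { assert (0 < c * beta) by (apply Rmult_lt_0_compat; auto). lra. }
  (* Half of the gain [c * beta * r ^ s] pays for the positive part of [ln |D|], so the mean of
     [phi] is at most [- A * r ^ s]; the radius chosen next puts this below [ln eta - 1]. *)
  set (A := c * beta / (4 * PI)).
  assert (HA : 0 < A) by (apply Rdiv_lt_0_compat; [apply Rmult_lt_0_compat; auto | lra]).
  set (r := Rmax (Rmax 1 rho) (Rmax (Rmax R0 R1) ((2 - ln eta) / A))).
  assert (Hrr : 1 <= r /\ rho <= r /\ R0 <= r /\ R1 <= r /\ (2 - ln eta) / A <= r).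
  { unfold r. generalize (Rmax_l (Rmax 1 rho) (Rmax (Rmax R0 R1) ((2 - ln eta) / A))),
      (Rmax_r (Rmax 1 rho) (Rmax (Rmax R0 R1) ((2 - ln eta) / A))), (Rmax_l 1 rho), (Rmax_r 1 rho),
      (Rmax_l (Rmax R0 R1) ((2 - ln eta) / A)), (Rmax_r (Rmax R0 R1) ((2 - ln eta) / A)),
      (Rmax_l R0 R1), (Rmax_r R0 R1). lra. }
  destruct Hrr as (Hr1' & Hrho' & HrR0 & HrR1 & HrA).
  assert (Hrs : r <= r ^ s).
  { rewrite <- (pow_1 r) at 1. apply Rle_pow; auto. }
  (* A continuous majorant of [ln |D|] on the circle. In the sector [ln |D| <= - c * r ^ s <= phi],
     because the positive part is at least 0 and the bump at most 1. *)
  set (phi := fun th => logp (Cmod (D (polar r th))) - c * r ^ s * bump th0 w th).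
  assert (cphi : forall x, continuous phi x).
  { intros x. apply (continuous_minus (V := R_NormedModule)). apply continuous_logp_circle; auto.
    apply (continuous_scal_r (V := R_NormedModule) (c * r ^ s) (bump th0 w)). apply bump_cont. }
  assert (pphi : forall x, phi (x + 2 * PI) = phi x).
  { intros x. unfold phi. rewrite bump_period. unfold polar.
    replace (x + 2 * PI) with (x + 2 * INR 1 * PI) by (simpl; ring). rewrite cis_period. auto. }
  assert (Hcrs : 0 < c * r ^ s) by (apply Rmult_lt_0_compat; lra).
  assert (Dphi : forall x, Cmod (D (polar r x)) <= exp (phi x)).
  { intros x. unfold phi. destruct (bump_bounds th0 w x) as [B0 B1].
    destruct (Req_dec (bump th0 w x) 0) as [->|Hn].
    - rewrite Rmult_0_r, Rminus_0_r. apply le_exp_logp.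
    - assert (Hcos : cos w < cos (x - th0)).
      { apply Rnot_le_lt; intros Hl. apply Hn. unfold bump. rewrite Rmax_left; lra. }
      destruct (cos_gt_sector _ _ Hw Hcos) as [t [Ht Et]].
      assert (Hsx : Cmod (D (polar r x)) <= exp (- c * r ^ s)).
      { replace (polar r x) with (polar r (th0 + t)). apply Hsec; auto. unfold th0; lra.
        rewrite <- !(polar_rot r th0), <- Et, polar_rot. f_equal; ring. }
      eapply Rle_trans; [apply Hsx|].
      assert (Hl := logp_pos (Cmod (D (polar r x)))).
      assert (- c * r ^ s <= logp (Cmod (D (polar r x))) - c * r ^ s * bump th0 w x) by nra.
      destruct H as [| ->]; [left; apply exp_increasing; auto | lra]. }
  assert (Iphi : RInt phi 0 (2 * PI) <= - (c * beta / 2) * r ^ s).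
  { assert (E : RInt phi 0 (2 * PI) = RInt (fun th => logp (Cmod (D (polar r th)))) 0 (2 * PI) - c * r ^ s * beta).
    { unfold phi. apply is_RInt_unique.
      apply (is_RInt_minus (V := R_NormedModule)).
      - apply (RInt_correct (V := R_CompleteNormedModule)), ex_RInt_cont. intros; apply continuous_logp_circle; auto.
      - apply (is_RInt_scal (V := R_NormedModule) (bump th0 w)).
        apply (RInt_correct (V := R_CompleteNormedModule)), ex_RInt_cont, bump_cont. }
    rewrite E. specialize (HR0 r HrR0). nra. }
  destruct (riemann_sum_le phi cphi pphi) as (N & HN & HRie).
  assert (HNp : 0 < INR N) by (apply lt_0_INR; auto).
  set (h := 2 * PI / INR N) in *. set (wk := fun k => cis (INR k * h)).
  assert (Hwk : forall k z, Cmod (z * wk k)%C = Cmod z) by (intros; unfold wk; rewrite Cmod_mult, Cmod_cis; ring).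
  set (M := exp (INR N * (1 + RInt phi 0 (2 * PI) / (2 * PI)))).
  assert (HF2 := fun z => smooth_D2 F z sF). assert (HK2 := fun z => smooth_D2 K z sK).
  (* The product over the rotations by [N]-th roots of unity is at most [M] on the circle of radius
     [r], by the Riemann sum bound, hence also at [rho]. *)
  assert (Hmp : Cmod (cprod (fun k => D (RtoC rho * wk k)%C) N) <= M).
  { apply (max_principle_quotient (fun z => cprod (fun k => D (z * wk k)%C) N)
      (fun z => cprod (fun k => F (z * wk k)%C) N) (fun z => cprod (fun k => K (z * wk k)%C) N) r M).
    - lra.
    - apply (cprod_cont (fun k z => D (z * wk k)%C)). intros k z. apply (ccont_comp D (fun z => z * wk k)%C); auto.
      apply ccont_mult; [apply ccont_id | apply ccont_const].
    - apply (cprod_D2 (fun k z => F (z * wk k)%C)). intros; apply D2_scale; auto.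
    - apply (cprod_D2 (fun k z => K (z * wk k)%C)). intros; apply D2_scale; auto.
    - intros z. rewrite <- cprod_mult. apply cprod_ext. auto.
    - intros z Hz. destruct (polar_exists z) as [t [Ht E]]. rewrite Hz in E. rewrite E.
      eapply Rle_trans; [apply (cprod_le _ (fun k => phi (t + INR k * h)))|].
      + intros k. unfold wk. rewrite polar_rot. auto.
      + unfold M. specialize (HRie t Ht). destruct HRie as [| ->]; [left; apply exp_increasing; auto | lra].
    - rewrite Cmod_RtoC_pos; lra.
    - apply (cprod_neq_0 (fun k => F (RtoC rho * wk k)%C)). intros k. apply Hcirc. rewrite Hwk, Cmod_RtoC_pos; lra. }
  assert (Hlow : eta ^ N <= M).
  { eapply Rle_trans; [|apply Hmp]. apply cprod_ge; [lra|]. intros k. apply Hcirc. rewrite Hwk, Cmod_RtoC_pos; lra. }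
  assert (Hln : INR N * ln eta <= INR N * (1 + RInt phi 0 (2 * PI) / (2 * PI))).
  { rewrite <- ln_pow, <- (ln_exp (INR N * _)) by auto. fold M.
    assert (0 < eta ^ N) by (apply pow_lt; auto).
    destruct Hlow as [| ->]; [left; apply ln_increasing; auto | lra]. }
  apply Rmult_le_reg_l in Hln; auto.
  assert (RInt phi 0 (2 * PI) / (2 * PI) <= - A * r ^ s).
  { apply Rmult_le_reg_r with (2 * PI); [lra|]. unfold Rdiv at 1. rewrite Rmult_assoc, Rinv_l, Rmult_1_r by lra.
    eapply Rle_trans; [apply Iphi|]. right. unfold A. field; lra. }
  assert (2 - ln eta <= A * r).
  { apply Rmult_le_compat_l with (r := A) in HrA; [|lra].
    replace (A * ((2 - ln eta) / A)) with (2 - ln eta) in HrA by (field; lra). auto. }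
  assert (A * r <= A * r ^ s) by (apply Rmult_le_compat_l; lra).
  lra.
Qed.

(** * Finite sums *)

(** A classical decision turned into a boolean, so that [filter] applies to arbitrary conditions on
    exponents. *)
Definition cb (P : Prop) : bool := if excluded_middle_informative P then true else false.

Lemma cb_true P : cb P = true <-> P.
Proof. unfold cb; destruct excluded_middle_informative; split; intros; auto; discriminate. Qed.

Lemma cb_false P : cb P = false <-> ~ P.
Proof. unfold cb; destruct excluded_middle_informative; split; intros; auto; try discriminate; contradiction. Qed.

Fixpoint csum {X : Type} (phi : X -> C) (l : list X) : C :=
  match l with [] => RtoC 0 | x :: l' => (phi x + csum phi l')%C end.

Section Sums.
Context {X Y : Type}.
Implicit Types (phi psi : X -> C) (l : list X).

Lemma csum_ext phi psi l : (forall x, In x l -> phi x = psi x) -> csum phi l = csum psi l.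
Proof. induction l; simpl; intros H; [auto | rewrite IHl, H; auto]. Qed.

Lemma csum_app phi l1 l2 : csum phi (l1 ++ l2) = (csum phi l1 + csum phi l2)%C.
Proof. induction l1; simpl; [ring | rewrite IHl1; ring]. Qed.

Lemma csum_scal c phi l : csum (fun x => c * phi x)%C l = (c * csum phi l)%C.
Proof. induction l; simpl; [ring | rewrite IHl; ring]. Qed.

Lemma csum_plus phi psi l : csum (fun x => phi x + psi x)%C l = (csum phi l + csum psi l)%C.
Proof. induction l; simpl; [ring | rewrite IHl; ring]. Qed.

Lemma csum_0 phi l : (forall x, In x l -> phi x = RtoC 0) -> csum phi l = 0%C.
Proof. induction l; simpl; intros H; [auto | rewrite IHl, H; auto; ring]. Qed.

Lemma csum_filter phi p l : csum phi (filter p l) = csum (fun x => if p x then phi x else RtoC 0) l.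
Proof. induction l; simpl; auto. destruct (p a); simpl; rewrite IHl; ring. Qed.

Lemma csum_filter_split phi (p : X -> bool) l :
  csum phi l = (csum phi (filter p l) + csum phi (filter (fun x => negb (p x)) l))%C.
Proof. induction l; simpl; [ring|]. destruct (p a); simpl; rewrite IHl; ring. Qed.

Lemma csum_map (f : Y -> X) phi (l : list Y) : csum phi (map f l) = csum (fun y => phi (f y)) l.
Proof. induction l; simpl; congruence. Qed.

Lemma csum_flat_map (f : Y -> list X) phi (l : list Y) : csum phi (flat_map f l) = csum (fun y => csum phi (f y)) l.
Proof. induction l; simpl; auto. rewrite csum_app, IHl; auto. Qed.

End Sums.

Lemma csum_single {Y} (k : Y) (ks : list Y) (c : C) : NoDup ks -> In k ks ->
  csum (fun k' => if cb (k = k') then c else RtoC 0) ks = c.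
Proof.
  induction ks; simpl; intros Hn Hi; [contradiction|]. inversion_clear Hn. destruct Hi as [->|Hi].
  - replace (cb (k = k)) with true by (symmetry; apply cb_true; auto).
    rewrite csum_0. ring. intros x Hx. replace (cb (k = x)) with false; auto.
    symmetry; apply cb_false; congruence.
  - rewrite IHks by auto. replace (cb (k = a)) with false. ring.
    symmetry; apply cb_false; congruence.
Qed.

Lemma csum_regroup {X Y} (phi : X -> C) (kappa : X -> Y) (ks : list Y) (l : list X) : NoDup ks -> (forall x, In x l -> In (kappa x) ks) ->
  csum phi l = csum (fun k => csum phi (filter (fun x => cb (kappa x = k)) l)) ks.
Proof.
  intros Hn. induction l; intros Hi; simpl.
  - symmetry; apply csum_0; auto.
  - rewrite IHl by (intros; apply Hi; simpl; auto).
    rewrite <- (csum_single (kappa a) ks (phi a)) by (auto; apply Hi; simpl; auto).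
    rewrite <- csum_plus. apply csum_ext. intros k _. destruct (cb (kappa a = k)); simpl; ring.
Qed.

(** * Polynomials *)

Lemma peval_cons a l z : peval (a :: l) z = (a + z * peval l z)%C.
Proof. reflexivity. Qed.

Lemma peval_nil z : peval [] z = 0%C.
Proof. reflexivity. Qed.

Lemma poly_ext f g : (forall z, f z = g z) -> is_polynomial f -> is_polynomial g.
Proof. intros E [l H]; exists l; intros; rewrite <- E; auto. Qed.

Lemma poly_const c : is_polynomial (fun _ => c).
Proof. exists [c]; intros; simpl; ring. Qed.

Lemma poly_id : is_polynomial (fun z => z).
Proof. exists [RtoC 0; RtoC 1]; intros; simpl; ring. Qed.

Lemma poly_plus f g : is_polynomial f -> is_polynomial g -> is_polynomial (fun z => f z + g z)%C.
Proof.
  intros [l Hl] [m Hm].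
  assert (H : forall l m, exists n, forall z, (peval l z + peval m z = peval n z)%C).
  { clear. induction l as [|a l IH]; intros m; [exists m; intros; rewrite peval_nil; ring|].
    destruct m as [|b m]; [exists (a :: l); intros; rewrite peval_nil; ring|].
    destruct (IH m) as [n Hn]. exists ((a + b)%C :: n); intros; rewrite !peval_cons.
    rewrite <- Hn; ring. }
  destruct (H l m) as [n Hn]. exists n; intros; rewrite Hl, Hm; auto.
Qed.

Lemma poly_mult f g : is_polynomial f -> is_polynomial g -> is_polynomial (fun z => f z * g z)%C.
Proof.
  intros [l Hl] Hg. apply poly_ext with (fun z => peval l z * g z)%C; [intros; rewrite Hl; auto|].
  clear f Hl. induction l as [|a l IH].
  - apply poly_ext with (fun _ => RtoC 0); [intros; rewrite peval_nil; ring | apply poly_const].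
  - apply poly_ext with (fun z => a * g z + z * (peval l z * g z))%C; [intros; rewrite peval_cons; ring|].
    apply poly_plus.
    + destruct Hg as [m Hm]. exists (map (Cmult a) m). intros z. rewrite Hm.
      clear. induction m; simpl map; [rewrite peval_nil; ring|]. rewrite !peval_cons, <- IHm; ring.
    + destruct IH as [m Hm]. exists (RtoC 0 :: m). intros z. rewrite peval_cons, <- Hm; ring.
Qed.

Lemma poly_csum {X} (F : X -> C -> C) (l : list X) : (forall x, In x l -> is_polynomial (F x)) ->
  is_polynomial (fun z => csum (fun x => F x z) l).
Proof.
  induction l; intros H; simpl; [apply poly_const|].
  apply (poly_plus (F a)); [apply H; simpl; auto | apply IHl; intros; apply H; simpl; auto].
Qed.

Lemma poly_pow n : is_polynomial (fun z => cpow z n).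
Proof. induction n; simpl; [apply poly_const | apply poly_mult; [apply poly_id | auto]]. Qed.

Lemma poly_derivative P : is_polynomial P -> exists P', is_polynomial P' /\ forall z, cder P z (P' z).
Proof.
  intros [l Hl].
  assert (H : exists P', is_polynomial P' /\ forall z, cder (peval l) z (P' z)).
  { clear. induction l as [|a l [P' [H1 H2]]].
    - exists (fun _ => RtoC 0); split; [apply poly_const|]. intros z; exact (cder_const (RtoC 0) z).
    - exists (fun z => 0 + (1 * peval l z + z * P' z))%C. split.
      + apply poly_plus; [apply poly_const|]. apply poly_plus; apply poly_mult; auto.
        apply poly_const. exists l; auto. apply poly_id.
      + intros z. apply (cder_plus (fun _ => a) (fun z => z * peval l z)%C). apply cder_const.
        apply (cder_mult (fun z => z)); auto. apply cder_id. }
  destruct H as [P' [H1 H2]]. exists P'; split; auto. intros z. apply cder_ext with (peval l); auto.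
Qed.

Lemma poly_upper P : is_polynomial P -> exists (c : R) (m : nat), 0 <= c /\
  forall z, 1 <= Cmod z -> Cmod (P z) <= c * Cmod z ^ m.
Proof.
  intros [l Hl].
  assert (H : exists (c : R) (m : nat), 0 <= c /\ forall z, 1 <= Cmod z -> Cmod (peval l z) <= c * Cmod z ^ m).
  { clear. induction l as [|a l (c & m & Hc & H)].
    - exists 0, 0%nat. split; [lra|]. intros; simpl; rewrite Cmod_0; lra.
    - exists (Cmod a + c), (S m). assert (Ha := Cmod_ge_0 a). split; [lra|]. intros z Hz. rewrite peval_cons.
      eapply Rle_trans; [apply Cmod_triangle|]. rewrite Cmod_mult. specialize (H z Hz).
      assert (1 <= Cmod z ^ m) by (apply pow_R1_Rle; auto).
      set (x := Cmod z) in *. set (y := x ^ m) in *.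
      assert (1 <= x * y) by nra. assert (x * Cmod (peval l z) <= x * (c * y)) by (apply Rmult_le_compat_l; lra).
      assert (Cmod a * 1 <= Cmod a * (x * y)) by (apply Rmult_le_compat_l; lra). simpl; fold y; lra. }
  destruct H as (c & m & Hc & H). exists c, m; split; auto. intros; rewrite Hl; auto.
Qed.

(** A positive constant is enough as a lower bound, since powers of [r] are negligible against the
    exponentials compared later. Inside, the alternative of a zero polynomial carries the induction
    along the coefficients. *)
Lemma poly_lower P : is_polynomial P -> (exists z, P z <> RtoC 0) -> exists c R0 : R, 0 < c /\
  forall z, R0 <= Cmod z -> c <= Cmod (P z).
Proof.
  intros [l Hl] Hn.
  assert (H : (forall z, peval l z = RtoC 0) \/ exists c R0 : R, 0 < c /\ forall z, R0 <= Cmod z -> c <= Cmod (peval l z)).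
  { clear. induction l as [|a l [H|(c & R0 & Hc & H)]].
    - left; auto.
    - destruct (excluded_middle_informative (a = RtoC 0)) as [->|Ha].
      + left; intros; rewrite peval_cons; rewrite H; ring.
      + right. exists (Cmod a), 0; split; [apply Cmod_gt_0; auto|]. intros; rewrite peval_cons.
        rewrite H. replace (a + z * 0)%C with a by ring. lra.
    - right. exists c, (Rmax R0 ((Cmod a + c) / c)). split; auto. intros z Hz. rewrite peval_cons.
      destruct (Rmax_le_inv _ _ _ Hz) as [H1 H2].
      specialize (H z H1). generalize (Cmod_plus_inv (z * peval l z)%C a). rewrite Cmod_mult.
      replace (z * peval l z + a)%C with (a + z * peval l z)%C by ring.
      apply Rmult_le_compat_r with (r := c) in H2; [|lra].
      unfold Rdiv in H2. rewrite Rmult_assoc, Rinv_l, Rmult_1_r in H2 by lra.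
      assert (Cmod z * c <= Cmod z * Cmod (peval l z)) by (apply Rmult_le_compat_l; [apply Cmod_ge_0 | auto]). lra. }
  destruct H as [H|(c & R0 & Hc & H)].
  - destruct Hn as [z Hz]. exfalso; apply Hz. rewrite Hl; auto.
  - exists c, R0; split; auto. intros; rewrite Hl; auto.
Qed.

(** In [exp (eps * r) >= (eps * r / n) ^ n] with [n = m + 1], one factor [r] is left over and
    absorbs [c]. *)
Lemma pow_le_exp (m : nat) (c eps : R) : 0 < eps -> exists R0, 1 <= R0 /\ forall r, R0 <= r -> c * r ^ m <= exp (eps * r).
Proof.
  intros He. set (n := INR (S m)). assert (Hn : 0 < n) by (apply lt_0_INR; lia).
  set (q := (eps / n) ^ S m). assert (Hq : 0 < q) by (apply pow_lt, Rdiv_lt_0_compat; auto).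
  exists (Rmax 1 (c / q)); split; [apply Rmax_l|]. intros r Hr.
  destruct (Rmax_le_inv _ _ _ Hr) as [H1 H2].
  apply Rle_trans with (q * r ^ S m).
  - simpl. rewrite <- Rmult_assoc. apply Rmult_le_compat_r; [apply pow_le; lra|].
    apply Rmult_le_compat_r with (r := q) in H2; [|lra]. unfold Rdiv in H2. rewrite Rmult_assoc, Rinv_l, Rmult_1_r in H2; lra.
  - unfold q. rewrite <- Rpow_mult_distr.
    replace (exp (eps * r)) with (exp (eps * r / n) ^ S m).
    + apply pow_incr. split. apply Rmult_le_pos; [left; apply Rdiv_lt_0_compat; auto | lra].
      generalize (exp_ineq1_le (eps * r / n)). intros. replace (eps / n * r) with (eps * r / n) by (field; lra). lra.
    + rewrite <- Rpower_pow by apply exp_pos. unfold Rpower. rewrite ln_exp. f_equal. fold n. field; lra.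
Qed.

(** * Exponents *)

(* An exponent is the coefficient function of a polynomial without constant term; [valid L] bounds its degree by [L]. *)
Definition expo := nat -> C.
Notation degree_le d e := (forall k : nat, (d < k)%nat -> e k = RtoC 0).
Definition term : Type := ((C -> C) * expo)%type.

Fixpoint ev (L : nat) (e : expo) (z : C) : C :=
  match L with O => RtoC 0 | S k => (ev k e z + e (S k) * cpow z (S k))%C end.

Lemma ev_S k e z : ev (S k) e z = (ev k e z + e (S k) * cpow z (S k))%C.
Proof. reflexivity. Qed.

(** With no constant term and no coefficient above [L], equality of exponents as functions is
    equality of polynomials; constants are absorbed into the coefficients of the exponentials. *)
Definition valid (L : nat) (e : expo) : Prop := e 0%nat = RtoC 0 /\ degree_le L e.

Definition e0 : expo := fun _ => RtoC 0.
Definition eadd (e e' : expo) : expo := fun k => (e k + e' k)%C.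
Definition esub (e e' : expo) : expo := fun k => (e k - e' k)%C.

Lemma ev_eadd L e e' z : ev L (eadd e e') z = (ev L e z + ev L e' z)%C.
Proof. unfold eadd; induction L; simpl; [ring | rewrite IHL; ring]. Qed.

Lemma ev_esub L e e' z : ev L (esub e e') z = (ev L e z - ev L e' z)%C.
Proof. unfold esub; induction L; simpl; [ring | rewrite IHL; ring]. Qed.

Lemma ev_e0 L z : ev L e0 z = 0%C.
Proof. induction L; simpl; auto. rewrite IHL. unfold e0; ring. Qed.

Lemma valid_e0 L : valid L e0.
Proof. split; auto. Qed.

Lemma valid_eadd L e e' : valid L e -> valid L e' -> valid L (eadd e e').
Proof. intros [H1 H2] [H3 H4]; unfold eadd; split; [rewrite H1, H3; ring | intros; rewrite H2, H4; auto; ring]. Qed.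

Lemma valid_esub L e e' : valid L e -> valid L e' -> valid L (esub e e').
Proof. intros [H1 H2] [H3 H4]; unfold esub; split; [rewrite H1, H3; ring | intros; rewrite H2, H4; auto; ring]. Qed.

Lemma esub_eq e e' : esub e e' = e0 -> e = e'.
Proof.
  intros H; extensionality k. apply (f_equal (fun g => g k)) in H. unfold esub, e0 in H.
  replace (e k) with (e k - e' k + e' k)%C by ring. rewrite H; ring.
Qed.

Lemma ev_ext L e e' z : (forall k, (1 <= k <= L)%nat -> e k = e' k) -> ev L e z = ev L e' z.
Proof. induction L; simpl; intros H; auto. rewrite IHL, H; auto; intros; try apply H; lia. Qed.

Lemma ev_shrink L d e z : (d <= L)%nat -> (degree_le d e) -> ev L e z = ev d e z.
Proof.
  intros Hd H. induction L; [replace d with 0%nat by lia; auto|].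
  destruct (Nat.eq_dec d (S L)) as [->|]; auto. simpl. rewrite IHL, H by lia. ring.
Qed.

Lemma poly_ev L e : is_polynomial (ev L e).
Proof.
  induction L; simpl; [apply poly_const|]. apply poly_plus; auto.
  apply (poly_mult (fun _ => e (S L)) (fun z => cpow z (S L))). apply poly_const. apply poly_pow.
Qed.

Lemma ev_upper L d e : (d <= L)%nat -> (degree_le d e) ->
  exists c, 0 <= c /\ forall z, 1 <= Cmod z -> Cmod (ev L e z) <= c * Cmod z ^ d.
Proof.
  intros HdL Hk.
  assert (H : exists c, 0 <= c /\ forall z, 1 <= Cmod z -> Cmod (ev d e z) <= c * Cmod z ^ d).
  { clear Hk. induction d.
    - exists 0; split; [lra|]. intros; simpl; rewrite Cmod_0; lra.
    - destruct IHd as [c [Hc H]]; [lia|]. exists (c + Cmod (e (S d))). assert (Hp := Cmod_ge_0 (e (S d))).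
      split; [lra|]. intros z Hz. rewrite ev_S. eapply Rle_trans; [apply Cmod_triangle|].
      rewrite Cmod_mult, Cmod_cpow, Rmult_plus_distr_r. apply Rplus_le_compat_r.
      eapply Rle_trans; [apply H; auto|]. apply Rmult_le_compat_l; auto. apply Rle_pow; auto. }
  destruct H as [c [Hc H]]. exists c; split; auto. intros. rewrite (ev_shrink L d); auto.
Qed.

Lemma ev_lead L d e : (1 <= d <= L)%nat -> (degree_le d e) ->
  exists c, 0 <= c /\ forall z, 1 <= Cmod z -> Cmod (ev L e z - e d * cpow z d)%C <= c * Cmod z ^ (d - 1).
Proof.
  intros HdL Hk. destruct d as [|d]; [lia|].
  destruct (ev_upper d d (fun k => if Nat.leb k d then e k else RtoC 0)) as [c [Hc H]]; [lia| |].
  { intros k Hk'. replace (Nat.leb k d) with false; auto. symmetry. apply Nat.leb_gt; auto. }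
  exists c; split; auto. intros z Hz. rewrite (ev_shrink L (S d)) by (auto; lia). rewrite ev_S.
  replace (S d - 1)%nat with d by lia.
  replace (ev d e z + e (S d) * cpow z (S d) - e (S d) * cpow z (S d))%C with (ev d e z) by ring.
  rewrite (ev_ext d e (fun k => if Nat.leb k d then e k else RtoC 0)); auto.
  intros k Hk'. replace (Nat.leb k d) with true; auto. symmetry. apply Nat.leb_le; lia.
Qed.

Lemma expo_degree L e : valid L e -> e <> e0 ->
  exists d, (1 <= d <= L)%nat /\ e d <> RtoC 0 /\ degree_le d e.
Proof.
  intros [H0 HL] Hn. induction L.
  - exfalso; apply Hn. extensionality k. destruct k; auto. apply HL; lia.
  - destruct (excluded_middle_informative (e (S L) = RtoC 0)) as [E|E].
    + destruct IHL as [d [Hd H]]. { intros k Hk. destruct (Nat.eq_dec k (S L)) as [->|]; auto. apply HL; lia. }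
      exists d; split; auto; lia.
    + exists (S L); repeat split; auto; lia.
Qed.

(** * Exponential sums *)

Definition tval (L : nat) (x : term) (z : C) : C := (fst x z * cexp (ev L (snd x) z))%C.
Definition esum (L : nat) (t : list term) (z : C) : C := csum (fun x => tval L x z) t.
Definition vlist (L : nat) (t : list term) : Prop := forall x, In x t -> is_polynomial (fst x) /\ valid L (snd x).
Definition canonical (L : nat) (t : list term) : Prop :=
  vlist L t /\ NoDup (map snd t) /\ forall x, In x t -> exists z, fst x z <> RtoC 0.
Definition efilter (chi : expo -> bool) (t : list term) : list term := filter (fun x => chi (snd x)) t.

Lemma esum_app L t1 t2 z : esum L (t1 ++ t2) z = (esum L t1 z + esum L t2 z)%C.
Proof. apply csum_app. Qed.

Lemma esum_efilter_split L chi t z :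
  esum L t z = (esum L (efilter chi t) z + esum L (efilter (fun e => negb (chi e)) t) z)%C.
Proof. apply csum_filter_split. Qed.

Lemma in_efilter chi t x : In x (efilter chi t) <-> In x t /\ chi (snd x) = true.
Proof. apply filter_In. Qed.

Lemma efilter_app chi t1 t2 : efilter chi (t1 ++ t2) = efilter chi t1 ++ efilter chi t2.
Proof. apply filter_app. Qed.

Lemma NoDup_filter_snd {X Y} (p : X * Y -> bool) (t : list (X * Y)) : NoDup (map snd t) -> NoDup (map snd (filter p t)).
Proof.
  induction t; simpl; intros H; auto. inversion_clear H. destruct (p a); simpl; auto.
  constructor; auto. intros Hi. apply H0. apply in_map_iff in Hi as [x [Ex Hx]]. apply filter_In in Hx as [Hx _].
  rewrite <- Ex. apply in_map; auto.
Qed.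

Lemma canonical_efilter L chi t : canonical L t -> canonical L (efilter chi t).
Proof.
  intros (H1 & H2 & H3). split; [|split].
  - intros x Hx. apply in_efilter in Hx; apply H1, Hx.
  - apply NoDup_filter_snd; auto.
  - intros x Hx. apply in_efilter in Hx; apply H3, Hx.
Qed.

Lemma vlist_app L t1 t2 : vlist L t1 -> vlist L t2 -> vlist L (t1 ++ t2).
Proof. intros H1 H2 x Hx. apply in_app_or in Hx as [|]; auto. Qed.

Lemma vlist_efilter L chi t : vlist L t -> vlist L (efilter chi t).
Proof. intros H x Hx. apply in_efilter in Hx; apply H, Hx. Qed.

(** Only terms with equal exponents are merged, and a condition on exponents cannot separate them;
    so the sums agree for every [chi] and not just in total. *)
Lemma canonicalize L t : vlist L t -> exists t', canonical L t' /\
  (forall x, In x t' -> In (snd x) (map snd t)) /\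
  forall chi z, esum L (efilter chi t) z = esum L (efilter chi t') z.
Proof.
  intros Hv.
  set (dec := fun e e' : expo => excluded_middle_informative (e = e')).
  set (ks := nodup dec (map snd t)).
  set (coef := fun (e : expo) z => csum (fun x : term => fst x z) (filter (fun x => cb (snd x = e)) t)).
  set (t' := filter (fun x : term => cb (exists z, fst x z <> RtoC 0)) (map (fun e => (coef e, e)) ks)).
  assert (Ht' : forall x, In x t' -> exists e, x = (coef e, e) /\ In e (map snd t) /\ exists z, fst x z <> RtoC 0).
  { intros x Hx. apply filter_In in Hx as [Hx Hz]. apply (proj1 (cb_true _)) in Hz. apply in_map_iff in Hx as [e [<- He]].
    exists e. split; [reflexivity | split; [|exact Hz]]. apply nodup_In in He; auto. }
  exists t'. split; [split; [|split]|split].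
  - intros x Hx. destruct (Ht' x Hx) as [e [-> [He _]]]. simpl. split.
    + apply (poly_csum (fun x : term => fst x)). intros x Hx'. apply filter_In in Hx' as [Hx' _]. apply Hv; auto.
    + apply in_map_iff in He as [y [<- Hy]]. apply Hv; auto.
  - apply NoDup_filter_snd. rewrite map_map; simpl. rewrite map_id. apply NoDup_nodup.
  - intros x Hx. destruct (Ht' x Hx) as [e H]; apply H.
  - intros x Hx. destruct (Ht' x Hx) as [e [-> [He _]]]. auto.
  - intros chi z. unfold esum, efilter. rewrite csum_filter.
    etransitivity; [apply (csum_regroup _ snd ks); [apply NoDup_nodup | intros x Hx; apply nodup_In, in_map; auto]|].
    rewrite csum_filter. unfold t'. rewrite csum_filter, csum_map. apply csum_ext. intros e _.
    assert (E : csum (fun x : term => if chi (snd x) then tval L x z else RtoC 0) (filter (fun x => cb (snd x = e)) t) =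
      (if chi e then coef e z * cexp (ev L e z) else RtoC 0)%C).
    { rewrite (csum_ext _ (fun x : term => ((if chi e then cexp (ev L e z) else RtoC 0) * fst x z))%C).
      - rewrite csum_scal. fold (coef e z). destruct (chi e); ring.
      - intros x Hx. apply filter_In in Hx as [_ Hx]. apply (proj1 (cb_true _)) in Hx. unfold tval. rewrite Hx. destruct (chi e); ring. }
    etransitivity; [exact E|]. unfold cb; cbn [fst snd]; destruct excluded_middle_informative as [_|Hn]; [reflexivity|].
    destruct (chi e); auto. replace (coef e z) with (RtoC 0). ring.
    apply NNPP; intros Hc. apply Hn. exists z; auto.
Qed.

Definition emul (t1 t2 : list term) : list term :=
  flat_map (fun x => map (fun y => (fun z => fst x z * fst y z, eadd (snd x) (snd y))%C) t2) t1.

Lemma in_emul t1 t2 u : In u (emul t1 t2) -> exists x y, In x t1 /\ In y t2 /\ snd u = eadd (snd x) (snd y).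
Proof.
  intros H. apply in_flat_map in H as [x [Hx H]]. apply in_map_iff in H as [y [<- Hy]]. exists x, y; auto.
Qed.

Lemma vlist_emul L t1 t2 : vlist L t1 -> vlist L t2 -> vlist L (emul t1 t2).
Proof.
  intros H1 H2 u H. apply in_flat_map in H as [x [Hx H]]. apply in_map_iff in H as [y [<- Hy]]. simpl.
  destruct (H1 x Hx), (H2 y Hy). split; [apply poly_mult | apply valid_eadd]; auto.
Qed.

(** If adding an exponent of [t2] does not change the class seen by [chi], filtering the product
    amounts to filtering the first factor. It is applied to membership in a group of frequencies. *)
Lemma esum_efilter_emul L chi chi1 t1 t2 z :
  (forall x y, In x t1 -> In y t2 -> chi (eadd (snd x) (snd y)) = chi1 (snd x)) ->
  esum L (efilter chi (emul t1 t2)) z = (esum L (efilter chi1 t1) z * esum L t2 z)%C.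
Proof.
  intros H. unfold esum, efilter, emul. rewrite !csum_filter, csum_flat_map.
  rewrite Cmult_comm, <- csum_scal. apply csum_ext. intros x Hx. rewrite csum_map. simpl.
  rewrite (csum_ext _ (fun y => (if chi1 (snd x) then tval L x z else RtoC 0) * tval L y z)%C).
  - rewrite csum_scal. ring.
  - intros y Hy. rewrite H by auto. destruct (chi1 (snd x)); [|ring].
    unfold tval; simpl. rewrite ev_eadd, cexp_plus. ring.
Qed.

Lemma efilter_true t : efilter (fun _ => true) t = t.
Proof. unfold efilter; induction t as [|x t IH]; simpl; [auto | rewrite IH; auto]. Qed.

Lemma esum_emul L t1 t2 z : esum L (emul t1 t2) z = (esum L t1 z * esum L t2 z)%C.
Proof.
  generalize (esum_efilter_emul L (fun _ => true) (fun _ => true) t1 t2 z).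
  rewrite !efilter_true. auto.
Qed.

Definition escal (c : C) (t : list term) : list term := map (fun x : term => (fun z => c * fst x z, snd x)%C) t.

Lemma esum_escal L c t z : esum L (escal c t) z = (c * esum L t z)%C.
Proof.
  unfold esum, escal. rewrite csum_map, <- csum_scal. apply csum_ext. intros; unfold tval; simpl; ring.
Qed.

Lemma in_escal c t u : In u (escal c t) -> exists x, In x t /\ snd u = snd x.
Proof. intros H; apply in_map_iff in H as [x [<- Hx]]; eauto. Qed.

Lemma vlist_escal L c t : vlist L t -> vlist L (escal c t).
Proof.
  intros H u Hu. apply in_map_iff in Hu as [x [<- Hx]]. destruct (H x Hx). simpl; split; auto.
  apply (poly_mult (fun _ => c)); auto. apply poly_const.
Qed.

Lemma tval_derivative L (x : term) : is_polynomial (fst x) ->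
  exists P', is_polynomial P' /\ forall z, cder (tval L x) z (tval L (P', snd x) z).
Proof.
  intros Hp. destruct (poly_derivative _ Hp) as [P' [H1 H2]].
  destruct (poly_derivative _ (poly_ev L (snd x))) as [Q' [H3 H4]].
  exists (fun z => P' z + fst x z * Q' z)%C. split.
  - apply poly_plus; auto. apply poly_mult; auto.
  - intros z. unfold tval; simpl.
    replace ((P' z + fst x z * Q' z) * cexp (ev L (snd x) z))%C with
      (P' z * cexp (ev L (snd x) z) + fst x z * (Q' z * cexp (ev L (snd x) z)))%C by ring.
    apply (cder_mult (fst x) (fun z => cexp (ev L (snd x) z))); auto.
    apply (cder_comp cexp (ev L (snd x))); auto. apply cder_cexp.
Qed.

Lemma esum_derivative L t : vlist L t -> exists t1, vlist L t1 /\ (forall x, In x t1 -> In (snd x) (map snd t)) /\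
  forall z, cder (esum L t) z (esum L t1 z).
Proof.
  induction t as [|x t IH]; intros H.
  - exists []. split; [|split]; auto. intros z; exact (cder_const (RtoC 0) z).
  - destruct IH as (t1 & H1 & H2 & H3); [intros y Hy; apply H; simpl; auto|].
    destruct (H x (or_introl eq_refl)) as [Hp Hx].
    destruct (tval_derivative L x Hp) as [P' [K1 K2]].
    exists ((P', snd x) :: t1). split; [|split].
    + intros y [<-|Hy]; auto.
    + intros y [<-|Hy]; simpl; auto.
    + intros z. apply (cder_plus (tval L x) (esum L t)); auto.
Qed.

(** Differentiation preserves valid lists, so iterating a choice of derivative yields the whole
    chain. *)
Lemma esum_smooth L t : vlist L t -> smooth (esum L t).
Proof.
  intros H.
  assert (Hex : forall u : {t | vlist L t}, exists u' : {t | vlist L t}, forall z, cder (esum L (proj1_sig u)) z (esum L (proj1_sig u') z)).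
  { intros [u Hu]. destruct (esum_derivative L u Hu) as (t1 & H1 & _ & H2). exists (exist _ t1 H1); auto. }
  destruct (choice _ Hex) as [d Hd].
  exists (fun n => esum L (proj1_sig (Nat.iter n d (exist _ t H)))). split; auto.
Qed.

(** * Growth in sectors *)

Lemma Re_le_dist (x y : C) (c : R) : Cmod (x - y)%C <= c -> Re y - c <= Re x.
Proof. intros H. generalize (Re_ge_Cmod (x - y)%C). rewrite Re_minus. lra. Qed.

Lemma Re_mult_polar_pow (w : C) r th d : Re (w * cpow (polar r th) d)%C = r ^ d * Re (w * cis (INR d * th))%C.
Proof.
  rewrite cpow_polar. unfold polar.
  replace (w * (RtoC (r ^ d) * cis (INR d * th)))%C with (RtoC (r ^ d) * (w * cis (INR d * th)))%C by ring.
  apply Re_scal.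
Qed.

Lemma top_lower L d e a b c0 : (1 <= d <= L)%nat -> (degree_le d e) -> 0 < c0 ->
  (forall th, a <= th <= b -> c0 <= Re (e d * cis (INR d * th))%C) ->
  exists R0, 1 <= R0 /\ forall r th, R0 <= r -> a <= th <= b -> c0 / 2 * r ^ d <= Re (ev L e (polar r th)).
Proof.
  intros Hd Hk Hc H. destruct (ev_lead L d e Hd Hk) as [c [Hc0 Hl]].
  exists (Rmax 1 (2 * c / c0)); split; [apply Rmax_l|]. intros r th Hr Hth.
  destruct (Rmax_le_inv _ _ _ Hr) as [H1 H2].
  specialize (Hl (polar r th)). rewrite Cmod_polar in Hl by lra. specialize (Hl H1).
  apply Re_le_dist in Hl. rewrite Re_mult_polar_pow in Hl.
  specialize (H th Hth). destruct d as [|d]; [lia|]. replace (S d - 1)%nat with d in Hl by lia.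
  assert (Hp : 0 < r ^ d) by (apply pow_lt; lra).
  assert (c * r ^ d <= c0 / 2 * r ^ S d).
  { apply Rmult_le_compat_r with (r := c0) in H2; [|lra]. unfold Rdiv in H2. rewrite Rmult_assoc, Rinv_l, Rmult_1_r in H2 by lra.
    simpl. rewrite <- Rmult_assoc. apply Rmult_le_compat_r; lra. }
  assert (r ^ S d * c0 <= r ^ S d * Re (e (S d) * cis (INR (S d) * th))%C).
  { apply Rmult_le_compat_l; auto. apply pow_le; lra. }
  lra.
Qed.

Lemma cis_near (w : C) d th0 : 0 < Re (w * cis (INR d * th0))%C -> exists eta, 0 < eta /\
  forall th, Rabs (th - th0) <= eta -> Re (w * cis (INR d * th0))%C / 2 <= Re (w * cis (INR d * th))%C.
Proof.
  intros Hv. set (v := Re (w * cis (INR d * th0))%C) in *.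
  set (M := (Cmod w + 1) * (INR d + 1)).
  assert (Hw := Cmod_ge_0 w). assert (Hd := pos_INR d).
  assert (HM : 0 < M) by (apply Rmult_lt_0_compat; lra).
  exists (v / (4 * M)); split; [apply Rdiv_lt_0_compat; lra|]. intros th Hth.
  assert (K : Cmod (w * cis (INR d * th) - w * cis (INR d * th0))%C <= v / 2).
  { replace (w * cis (INR d * th) - w * cis (INR d * th0))%C with (w * (cis (INR d * th) - cis (INR d * th0)))%C by ring.
    rewrite Cmod_mult.
    apply Rle_trans with (Cmod w * (2 * Rabs (INR d * th - INR d * th0))).
    apply Rmult_le_compat_l; [auto | apply cis_dist].
    rewrite <- Rmult_minus_distr_l, Rabs_mult, (Rabs_pos_eq (INR d)) by auto.
    apply Rle_trans with (2 * (M * Rabs (th - th0))).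
    - replace (Cmod w * (2 * (INR d * Rabs (th - th0)))) with (2 * (Cmod w * INR d * Rabs (th - th0))) by ring.
      apply Rmult_le_compat_l; [lra|]. apply Rmult_le_compat_r; [apply Rabs_pos|].
      unfold M. apply Rmult_le_compat; lra.
    - apply Rle_trans with (2 * (M * (v / (4 * M)))).
      apply Rmult_le_compat_l; [lra|]. apply Rmult_le_compat_l; lra. right; field; lra. }
  apply Re_le_dist in K. fold v in K. lra.
Qed.

Lemma Re_polar_cis (m g x : R) : Re (polar m g * cis x)%C = m * cos (g + x).
Proof. rewrite polar_rot. unfold polar. rewrite Re_scal, cis_val. reflexivity. Qed.

(** A cosine cannot vanish at two angles whose distance lies strictly between 0 and [PI]; the shift
    [del] changes the angle by [INR d * del <= 1]. *)
Lemma cis_nonzero_in (w : C) d a b : a < b -> (1 <= d)%nat -> w <> RtoC 0 ->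
  exists th, a < th < b /\ Re (w * cis (INR d * th))%C <> 0.
Proof.
  intros Hab Hd Hw. destruct (polar_exists w) as [g [_ E]].
  assert (Hm : 0 < Cmod w) by (apply Cmod_gt_0; auto).
  assert (HD : 1 <= INR d) by (apply (le_INR 1); auto).
  set (del := Rmin ((b - a) / 4) (1 / INR d)).
  assert (Hdel : 0 < del) by (apply Rmin_pos; [lra | apply Rdiv_lt_0_compat; lra]).
  assert (Hd1 : del <= (b - a) / 4) by apply Rmin_l.
  assert (Hd2 : INR d * del <= 1).
  { apply Rle_trans with (INR d * (1 / INR d)). apply Rmult_le_compat_l; [lra | apply Rmin_r]. right; field; lra. }
  set (t1 := (a + b) / 2).
  destruct (Req_dec (cos (g + INR d * t1)) 0) as [H1|H1].
  - exists (t1 + del). split; [unfold t1; lra|]. rewrite E, Re_polar_cis.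
    apply Rmult_integral_contrapositive_currified; [lra|].
    replace (g + INR d * (t1 + del)) with (g + INR d * t1 + INR d * del) by ring.
    rewrite cos_plus, H1. assert (0 < sin (INR d * del)).
    { apply sin_gt_0. apply Rmult_lt_0_compat; lra. generalize PI2_1; lra. }
    assert (sin (g + INR d * t1) <> 0).
    { intros Hs. generalize (sin2_cos2 (g + INR d * t1)). rewrite H1, Hs. unfold Rsqr; lra. }
    intros K. assert (sin (g + INR d * t1) * sin (INR d * del) = 0) by lra.
    apply Rmult_integral in H2 as [|]; lra.
  - exists t1. split; [unfold t1; lra|]. rewrite E, Re_polar_cis.
    apply Rmult_integral_contrapositive_currified; lra.
Qed.

(** * The growth order of exponents in a sector *)

Definition epos (L : nat) (a b : R) (e : expo) : Prop :=
  exists c R0, 0 < c /\ 1 <= R0 /\ forall r th, R0 <= r -> a <= th <= b -> c * r <= Re (ev L e (polar r th)).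

(** Linear growth of the difference, whatever its degree, already outweighs every polynomial
    coefficient; the relation is a strict order, uniform on the sector. *)
Definition elt (L : nat) (a b : R) (e e' : expo) : Prop := epos L a b (esub e' e).

Lemma epos_sub L a b a' b' e : a <= a' -> b' <= b -> epos L a b e -> epos L a' b' e.
Proof. intros Ha Hb (c & R0 & Hc & HR & H). exists c, R0. repeat split; auto. intros; apply H; lra. Qed.

Lemma top_epos L d e a b c0 : (1 <= d <= L)%nat -> (degree_le d e) -> 0 < c0 ->
  (forall th, a <= th <= b -> c0 <= Re (e d * cis (INR d * th))%C) -> epos L a b e.
Proof.
  intros Hd Hk Hc H. destruct (top_lower L d e a b c0 Hd Hk Hc H) as [R0 [HR K]].
  exists (c0 / 2), R0. repeat split; auto; [lra|]. intros r th Hr Hth. eapply Rle_trans; [|apply K; auto].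
  apply Rmult_le_compat_l; [lra|]. rewrite <- (pow_1 r) at 1. apply Rle_pow; [lra | lia].
Qed.

(** The leading coefficient has a non-zero real part at some angle of the sector, and its sign
    persists nearby. *)
Lemma shrink_one L e a b : valid L e -> e <> e0 -> a < b -> exists a' b', a <= a' /\ a' < b' /\ b' <= b /\
  (epos L a' b' e \/ epos L a' b' (esub e0 e)).
Proof.
  intros Hv Hn Hab. destruct (expo_degree L e Hv Hn) as (d & Hd & Hed & Hk).
  destruct (cis_nonzero_in (e d) d a b Hab) as [th0 [Hth Hnz]]; [lia | auto |].
  assert (H : forall e', degree_le d e' -> 0 < Re (e' d * cis (INR d * th0))%C ->
    exists a' b', a <= a' /\ a' < b' /\ b' <= b /\ epos L a' b' e').
  { intros e' Hk' Hp. destruct (cis_near (e' d) d th0 Hp) as [eta [He K]].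
    set (h := Rmin eta (Rmin (th0 - a) (b - th0))).
    assert (Hh : 0 < h) by (repeat apply Rmin_pos; lra).
    assert (h <= eta) by apply Rmin_l.
    assert (h <= th0 - a) by (eapply Rle_trans; [apply Rmin_r | apply Rmin_l]).
    assert (h <= b - th0) by (eapply Rle_trans; [apply Rmin_r | apply Rmin_r]).
    exists (th0 - h), (th0 + h). repeat split; try lra.
    eapply (top_epos L d); [auto | auto | | intros th Ht; apply K; apply Rabs_le; lra]. lra. }
  destruct (Rlt_dec 0 (Re (e d * cis (INR d * th0))%C)) as [Hp|Hp].
  - destruct (H e Hk Hp) as (a' & b' & H1 & H2 & H3 & H4). exists a', b'; auto.
  - destruct (H (esub e0 e)) as (a' & b' & H1 & H2 & H3 & H4); [| |exists a', b'; auto]; unfold esub, e0.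
    + intros k Hk'. rewrite Hk by auto. ring.
    + replace ((0 - e d) * cis (INR d * th0))%C with (- (e d * cis (INR d * th0)))%C by ring. rewrite Re_opp. lra.
Qed.

Lemma shrink_list L (es : list expo) a b : (forall e, In e es -> valid L e) -> a < b ->
  exists a' b', a <= a' /\ a' < b' /\ b' <= b /\
  forall e, In e es -> e = e0 \/ epos L a' b' e \/ epos L a' b' (esub e0 e).
Proof.
  intros Hv. revert a b. induction es as [|e es IH]; intros a b Hab.
  - exists a, b. repeat split; try lra. intros e [].
  - destruct (IH (fun e' H => Hv e' (or_intror H)) a b Hab) as (a1 & b1 & H1 & H2 & H3 & H).
    destruct (excluded_middle_informative (e = e0)) as [He|He].
    + exists a1, b1. repeat split; auto. intros e' [<-|He']; auto.
    + destruct (shrink_one L e a1 b1) as (a2 & b2 & K1 & K2 & K3 & K); auto. apply Hv; simpl; auto.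
      exists a2, b2. repeat split; try lra. intros e' [<-|He']; auto.
      destruct (H e' He') as [|[|]]; auto; right; [left | right]; eapply epos_sub; eauto.
Qed.

Definition comparable (L : nat) (a b : R) (E : list expo) : Prop :=
  forall e e', In e E -> In e' E -> e = e' \/ elt L a b e e' \/ elt L a b e' e.

Lemma epos_ext L a b e e' : (forall z, ev L e z = ev L e' z) -> epos L a b e -> epos L a b e'.
Proof.
  intros E (c & R0 & Hc & HR & H). exists c, R0. repeat split; auto. intros r th Hr Hth. rewrite <- E; auto.
Qed.

(** All pairwise differences are given a definite sign one after another; a smaller sector keeps
    what was already decided. *)
Lemma shrink_comparable L (E : list expo) a b : (forall e, In e E -> valid L e) -> a < b ->
  exists a' b', a <= a' /\ a' < b' /\ b' <= b /\ comparable L a' b' E.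
Proof.
  intros Hv Hab.
  destruct (shrink_list L (flat_map (fun e => map (fun e' => esub e' e) E) E) a b) as (a' & b' & H1 & H2 & H3 & H); auto.
  { intros e He. apply in_flat_map in He as [x [Hx He]]. apply in_map_iff in He as [y [<- Hy]]. apply valid_esub; auto. }
  exists a', b'. repeat split; auto. intros e e' He He'.
  destruct (H (esub e' e)) as [K|[K|K]].
  - apply in_flat_map; exists e; split; auto. apply (in_map (fun e' => esub e' e)); auto.
  - left. symmetry; apply esub_eq; auto.
  - right; left; auto.
  - right; right. eapply epos_ext; [|apply K]. intros z. rewrite !ev_esub, ev_e0. ring.
Qed.

Lemma elt_trans L a b e1 e2 e3 : elt L a b e1 e2 -> elt L a b e2 e3 -> elt L a b e1 e3.
Proof.
  intros (c & R0 & Hc & HR & H) (c' & R1 & Hc' & HR' & H'). exists c, (Rmax R0 R1). split; [auto|split].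
  - eapply Rle_trans; [apply HR | apply Rmax_l].
  - intros r th Hr Hth.
    destruct (Rmax_le_inv _ _ _ Hr) as [H1 H2].
    specialize (H r th H1 Hth). specialize (H' r th H2 Hth).
    rewrite ev_esub, Re_minus in *. assert (0 <= c' * r) by (apply Rmult_le_pos; lra). lra.
Qed.

Definition edom (L : nat) (a b : R) (E : list expo) (e : expo) : Prop :=
  forall e', In e' E -> e' = e \/ elt L a b e' e.

Lemma dominant_exists L a b E : comparable L a b E -> E <> [] -> exists e, In e E /\ edom L a b E e.
Proof.
  intros Hc Hn. induction E as [|e E IH]; [congruence|].
  destruct E as [|e1 E].
  - exists e; split; [simpl; auto|]. intros e' [->|[]]; auto.
  - destruct IH as [m [Hm Hd]]; [|congruence|].
    { intros x y Hx Hy; apply Hc; simpl; auto. }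
    destruct (Hc e m) as [<-|[K|K]]; [simpl; auto | simpl; auto | | |].
    + exists e; split; [simpl; auto|]. intros e' [<-|He']; auto.
    + exists m; split; [simpl; auto|]. intros e' [<-|He']; auto.
    + exists e; split; [simpl; auto|]. intros e' [<-|He']; auto.
      destruct (Hd e' He') as [->|K']; auto. right; eapply elt_trans; eauto.
Qed.

Lemma elt_Re_le L a b e e' : elt L a b e e' -> exists R0, 1 <= R0 /\ forall r th, R0 <= r -> a <= th <= b ->
  Re (ev L e (polar r th)) <= Re (ev L e' (polar r th)).
Proof.
  intros (c & R0 & Hc & HR & H). exists R0; split; auto. intros r th Hr Hth. specialize (H r th Hr Hth).
  rewrite ev_esub, Re_minus in H. assert (0 <= c * r) by (apply Rmult_le_pos; lra). lra.
Qed.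

Lemma edom_Re_le L a b E e : edom L a b E e -> exists R0, 1 <= R0 /\ forall r th, R0 <= r -> a <= th <= b ->
  forall e', In e' E -> Re (ev L e' (polar r th)) <= Re (ev L e (polar r th)).
Proof.
  induction E as [|x E IH]; intros H.
  - exists 1; split; [lra|]. intros r th _ _ e' [].
  - destruct IH as (R0 & HR & K); [intros e' He'; apply H; simpl; auto|].
    destruct (H x (or_introl eq_refl)) as [->|Hx].
    + exists R0; split; auto. intros r th Hr Hth e' [<-|He']; [lra | auto].
    + destruct (elt_Re_le _ _ _ _ _ Hx) as (R1 & HR1 & K1). exists (Rmax R0 R1).
      split; [eapply Rle_trans; [apply HR | apply Rmax_l]|]. intros r th Hr Hth.
      destruct (Rmax_le_inv _ _ _ Hr) as [H1 H2].
      intros e' [<-|He']; auto.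
Qed.

Lemma Cmod_tval L x z : Cmod (tval L x z) = Cmod (fst x z) * exp (Re (ev L (snd x) z)).
Proof. unfold tval. rewrite Cmod_mult, Cmod_cexp. reflexivity. Qed.

(** The dominating exponent is given separately from the list, so the bound also covers derivatives,
    whose exponents are among those of the original sum. *)
Lemma esum_upper L a b t e : vlist L t -> edom L a b (map snd t) e ->
  exists (c : R) (m : nat) R0, 0 <= c /\ 1 <= R0 /\ forall r th, R0 <= r -> a <= th <= b ->
    Cmod (esum L t (polar r th)) <= c * r ^ m * exp (Re (ev L e (polar r th))).
Proof.
  intros Hv Hd. destruct (edom_Re_le _ _ _ _ _ Hd) as (R0 & HR & K). clear Hd.
  revert K. induction t as [|x t IH]; intros K.
  - exists 0, 0%nat, 1. repeat split; try lra. intros. unfold esum; simpl. rewrite Cmod_0. lra.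
  - destruct IH as (c & m & R1 & Hc & HR1 & H1).
    { intros y Hy; apply Hv; simpl; auto. } { intros; apply K; simpl; auto. }
    destruct (poly_upper (fst x)) as (c' & m' & Hc' & H'). { apply Hv; simpl; auto. }
    exists (c + c'), (m + m')%nat, (Rmax R0 R1). split; [lra|]. split; [eapply Rle_trans; [apply HR | apply Rmax_l]|].
    intros r th Hr Hth.
    destruct (Rmax_le_inv _ _ _ Hr) as [Hr0 Hr1].
    unfold esum; simpl. fold (esum L t (polar r th)).
    eapply Rle_trans; [apply Cmod_triangle|]. rewrite Cmod_tval.
    specialize (H1 r th Hr1 Hth). specialize (K r th Hr0 Hth (snd x) (or_introl eq_refl)).
    specialize (H' (polar r th)). rewrite Cmod_polar in H' by lra. specialize (H' ltac:(lra)).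
    set (X := exp (Re (ev L e (polar r th)))) in *.
    assert (HX : 0 < X) by apply exp_pos.
    assert (HX' : exp (Re (ev L (snd x) (polar r th))) <= X).
    { destruct K as [|K]; [left; apply exp_increasing; auto | unfold X; rewrite K; lra]. }
    assert (Hm : 1 <= r ^ m) by (apply pow_R1_Rle; lra). assert (Hm' : 1 <= r ^ m') by (apply pow_R1_Rle; lra).
    rewrite pow_add.
    assert (Cmod (fst x (polar r th)) * exp (Re (ev L (snd x) (polar r th))) <= c' * r ^ m' * X).
    { apply Rmult_le_compat; auto. apply Cmod_ge_0. left; apply exp_pos. }
    assert (c * r ^ m * X <= c * (r ^ m * r ^ m') * X).
    { apply Rmult_le_compat_r; [lra|]. apply Rmult_le_compat_l; [lra|]. nra. }
    assert (c' * r ^ m' * X <= c' * (r ^ m * r ^ m') * X).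
    { apply Rmult_le_compat_r; [lra|]. apply Rmult_le_compat_l; [lra|]. nra. }
    lra.
Qed.

Lemma esum_small L a b t e : vlist L t -> (forall x, In x t -> elt L a b (snd x) e) -> forall eps, 0 < eps ->
  exists R0, 1 <= R0 /\ forall r th, R0 <= r -> a <= th <= b ->
    Cmod (esum L t (polar r th)) <= eps * exp (Re (ev L e (polar r th))).
Proof.
  intros Hv. induction t as [|x t IH]; intros Hl eps He.
  - exists 1. split; [lra|]. intros. unfold esum; simpl. rewrite Cmod_0. apply Rmult_le_pos; [lra | left; apply exp_pos].
  - destruct (IH (fun y Hy => Hv y (or_intror Hy)) (fun y Hy => Hl y (or_intror Hy)) (eps / 2)) as (R1 & HR1 & H1); [lra|].
    destruct (poly_upper (fst x)) as (c' & m' & Hc' & H'). { apply Hv; simpl; auto. }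
    destruct (Hl x (or_introl eq_refl)) as (c & R0 & Hc & HR & H).
    destruct (pow_le_exp m' (c' * (2 / eps)) c Hc) as (R2 & HR2 & H2).
    exists (Rmax R0 (Rmax R1 R2)). split; [eapply Rle_trans; [apply HR | apply Rmax_l]|]. intros r th Hr Hth.
    destruct (Rmax_le_inv _ _ _ Hr) as [Hr0 Hr12].
    destruct (Rmax_le_inv _ _ _ Hr12) as [Hr1 Hr2].
    unfold esum; simpl. fold (esum L t (polar r th)).
    eapply Rle_trans; [apply Cmod_triangle|]. rewrite Cmod_tval.
    specialize (H1 r th Hr1 Hth). specialize (H r th Hr0 Hth). rewrite ev_esub, Re_minus in H. specialize (H2 r Hr2).
    specialize (H' (polar r th)). rewrite Cmod_polar in H' by lra. specialize (H' ltac:(lra)).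
    set (X := Re (ev L e (polar r th))) in *. set (Y := Re (ev L (snd x) (polar r th))) in *.
    assert (HY : exp Y <= exp (- (c * r)) * exp X).
    { rewrite <- exp_plus. assert (HYX : Y <= - (c * r) + X) by lra.
      destruct HYX as [|HYX]; [left; apply exp_increasing; auto | rewrite HYX; lra]. }
    assert (Hc2 : c' * r ^ m' * exp (- (c * r)) <= eps / 2).
    { apply Rmult_le_reg_r with (exp (c * r)); [apply exp_pos|]. rewrite Rmult_assoc, <- exp_plus.
      replace (- (c * r) + c * r) with 0 by ring. rewrite exp_0, Rmult_1_r.
      apply Rmult_le_reg_l with (2 / eps); [apply Rdiv_lt_0_compat; lra|].
      replace (2 / eps * (eps / 2 * exp (c * r))) with (exp (c * r)) by (field; lra).
      eapply Rle_trans; [|apply H2]. right; ring. }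
    assert (HX := exp_pos X).
    assert (Cmod (fst x (polar r th)) * exp Y <= c' * r ^ m' * (exp (- (c * r)) * exp X)).
    { apply Rmult_le_compat; auto. apply Cmod_ge_0. left; apply exp_pos. }
    assert (c' * r ^ m' * exp (- (c * r)) * exp X <= eps / 2 * exp X) by (apply Rmult_le_compat_r; lra).
    lra.
Qed.

(** The dominant coefficient stays away from 0 at infinity, and the remaining terms together fall
    below half of the resulting bound. *)
Lemma esum_lower L a b t x : canonical L t -> In x t -> edom L a b (map snd t) (snd x) ->
  exists c R0, 0 < c /\ 1 <= R0 /\ forall r th, R0 <= r -> a <= th <= b ->
    c * exp (Re (ev L (snd x) (polar r th))) <= Cmod (esum L t (polar r th)).
Proof.
  intros (Hv & Hnd & Hnz) Hx Hd.
  destruct (poly_lower (fst x)) as (c & R0 & Hc & Hl); [apply Hv; auto | apply Hnz; auto |].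
  destruct (in_split x t Hx) as (l1 & l2 & E).
  destruct (esum_small L a b (l1 ++ l2) (snd x)) with (eps := c / 2) as (R1 & HR1 & Hs); [| | lra |].
  - intros y Hy. apply Hv. rewrite E. apply in_or_app. apply in_app_or in Hy as [|]; simpl; auto.
  - intros y Hy. destruct (Hd (snd y)) as [K|K]; auto.
    + apply in_map. rewrite E. apply in_or_app. apply in_app_or in Hy as [|]; simpl; auto.
    + exfalso. rewrite E, map_app in Hnd. simpl in Hnd. apply NoDup_remove_2 in Hnd. apply Hnd.
      rewrite <- K, <- map_app. apply in_map; auto.
  - exists (c / 2), (Rmax R0 R1). split; [lra|]. split; [eapply Rle_trans; [apply HR1 | apply Rmax_r]|]. intros r th Hr Hth.
    destruct (Rmax_le_inv _ _ _ Hr) as [Hr0 Hr1].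
    specialize (Hs r th Hr1 Hth). specialize (Hl (polar r th)). rewrite Cmod_polar in Hl by lra. specialize (Hl Hr0).
    replace (esum L t (polar r th)) with (tval L x (polar r th) + esum L (l1 ++ l2) (polar r th))%C.
    2:{ rewrite E. unfold esum. rewrite !csum_app. simpl. ring. }
    generalize (Cmod_plus_inv (tval L x (polar r th)) (esum L (l1 ++ l2) (polar r th))). rewrite Cmod_tval.
    assert (HX := exp_pos (Re (ev L (snd x) (polar r th)))).
    assert (c * exp (Re (ev L (snd x) (polar r th))) <= Cmod (fst x (polar r th)) * exp (Re (ev L (snd x) (polar r th)))).
    { apply Rmult_le_compat_r; lra. }
    lra.
Qed.

Lemma vlist_exps L t e : vlist L t -> In e (map snd t) -> valid L e.
Proof. intros Hv He. apply in_map_iff in He as [x [<- Hx]]. apply Hv; auto. Qed.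

(** Linear independence over the polynomials of exponentials with distinct exponents: in a suitable
    sector the dominant term cannot be cancelled. *)
Lemma canonical_nonzero L t : canonical L t -> t <> [] -> exists z, esum L t z <> RtoC 0.
Proof.
  intros Hc Hn. destruct (shrink_comparable L (map snd t) 0 1) as (a & b & _ & Hab & _ & Hcmp).
  { intros e He; eapply vlist_exps; eauto. apply Hc. } { lra. }
  destruct (dominant_exists L a b (map snd t) Hcmp) as [e [He Hd]].
  { destruct t; simpl; congruence. }
  apply in_map_iff in He as [x [<- Hx]].
  destruct (esum_lower L a b t x Hc Hx Hd) as (c & R0 & Hcp & HR & H).
  exists (polar R0 a). apply Cmod_gt_0. eapply Rlt_le_trans; [|apply H; lra].
  apply Rmult_lt_0_compat; [auto | apply exp_pos].
Qed.

(** An identity between exponential sums holds exponent by exponent, so it may be projected by any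
    condition on exponents. *)
Lemma esum_zero_efilter L t : vlist L t -> (forall z, esum L t z = RtoC 0) ->
  forall chi z, esum L (efilter chi t) z = RtoC 0.
Proof.
  intros Hv H0 chi z. destruct (canonicalize L t Hv) as (t' & Hc & _ & Hf).
  destruct t' as [|x t'].
  - rewrite Hf. reflexivity.
  - destruct (canonical_nonzero L (x :: t') Hc) as [z' Hz']; [congruence|]. exfalso; apply Hz'.
    generalize (Hf (fun _ => true) z'). rewrite !efilter_true. intros <-. auto.
Qed.

(** Filters commute with differentiation, so a projected solution can be differentiated. A term lost
    in [t1] is a constant function, and independence of exponentials makes its exponent 0. *)
Lemma esum_derivative_canonical L t : canonical L t -> exists t1, canonical L t1 /\
  (forall x, In x t1 -> In (snd x) (map snd t)) /\
  (forall chi z, cder (esum L (efilter chi t)) z (esum L (efilter chi t1) z)) /\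
  forall x, In x t -> In (snd x) (map snd t1) \/ (snd x = e0 /\ exists c, c <> RtoC 0 /\ forall z, fst x z = c).
Proof.
  induction t as [|x t IH]; intros (Hv & Hnd & Hnz).
  - exists []. split; [|split; [|split]].
    + split; [intros x []|split; [constructor | intros x []]].
    + intros x [].
    + intros chi z; exact (cder_const (RtoC 0) z).
    + intros x [].
  - inversion_clear Hnd as [|? ? Hnin Hnd'].
    destruct IH as (t1 & (Hv1 & Hnd1 & Hnz1) & Hin & Hder & Hor).
    { split; [intros y Hy; apply Hv; simpl; auto | split; [auto | intros y Hy; apply Hnz; simpl; auto]]. }
    destruct (Hv x (or_introl eq_refl)) as [Hp Hx].
    destruct (tval_derivative L x Hp) as [P' [K1 K2]].
    destruct (classic (exists z, P' z <> RtoC 0)) as [Hnz'|Hz'].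
    + exists ((P', snd x) :: t1). split; [split; [|split]|split; [|split]].
      * intros y [<-|Hy]; auto.
      * simpl. constructor; auto. intros Hi. apply Hnin. apply in_map_iff in Hi as [y [<- Hy]]. auto.
      * intros y [<-|Hy]; auto.
      * intros y [<-|Hy]; simpl; auto.
      * intros chi z. unfold efilter; simpl. destruct (chi (snd x)); [|apply Hder].
        apply (cder_plus (tval L x) (esum L (efilter chi t))); [apply K2 | apply Hder].
      * intros y [<-|Hy]; simpl; auto. destruct (Hor y Hy); auto.
    + exists t1. split; [split; [|split]|split; [|split]]; auto.
      * intros y Hy; simpl; auto.
      * intros chi z. unfold efilter; simpl. destruct (chi (snd x)); [|apply Hder].
        assert (E0 : esum L (efilter chi t1) z = (RtoC 0 + esum L (efilter chi t1) z)%C) by ring.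
        change (cder (fun z => tval L x z + esum L (efilter chi t) z)%C z (esum L (efilter chi t1) z)). rewrite E0.
        apply (cder_plus (tval L x) (esum L (efilter chi t))); [|apply Hder].
        replace (RtoC 0) with (tval L (P', snd x) z); auto.
        unfold tval; simpl. replace (P' z) with (RtoC 0). ring. apply NNPP; intros E; apply Hz'; exists z; auto.
      * intros y [<-|Hy]; simpl; auto. right.
        assert (Hz : forall z, P' z = RtoC 0) by (intros z; apply NNPP; intros E; apply Hz'; exists z; auto).
        assert (Hconst : forall z, tval L x z = tval L x 0%C).
        { apply cder_zero_const. intros z. replace (RtoC 0) with (tval L (P', snd x) z); auto.
          unfold tval; simpl; rewrite Hz; ring. }
        set (c0 := tval L x 0%C) in *.
        destruct (Hnz x (or_introl eq_refl)) as [z1 Hz1].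
        assert (Hc0 : c0 <> RtoC 0).
        { rewrite <- (Hconst z1). unfold tval. apply Cmult_neq_0; auto. apply cexp_neq_0. }
        (* Otherwise the term and the constant [- c0] would form a canonical list with zero sum. *)
        assert (He : snd x = e0).
        { apply NNPP; intros Hne.
          destruct (canonical_nonzero L [x; ((fun _ => - c0)%C, e0)]) as [z Hz2]; [|congruence|].
          - split; [|split].
            + intros y [<-|[<-|[]]]; auto. simpl; split; [apply poly_const | apply valid_e0].
            + simpl. constructor; [intros [E|[]]; congruence|]. constructor; [auto|constructor].
            + intros y [<-|[<-|[]]]; [exists z1; auto|]. exists 0%C. simpl. intros E. apply Hc0.
              replace c0 with (- - c0)%C by ring. rewrite E; ring.
          - apply Hz2. unfold esum; simpl. rewrite Hconst. unfold tval; simpl. rewrite ev_e0, cexp_0. ring. }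
        split; auto. exists c0; split; auto. intros z. rewrite <- (Hconst z). unfold tval. rewrite He, ev_e0, cexp_0. ring.
Qed.

(** * Conversion between coefficient lists and exponents *)

Lemma ev_succ L e z : ev (S L) e z = (z * (e 1%nat + ev L (fun k => e (S k)) z))%C.
Proof.
  induction L; [simpl; ring|].
  rewrite ev_S, IHL, (ev_S L (fun k => e (S k))). simpl. ring.
Qed.

Definition list_expo (Q : list C) : expo := fun k => match k with O => RtoC 0 | S _ => nth k Q (RtoC 0) end.

Lemma peval_list_expo Q : forall L z, (length Q <= S L)%nat -> peval Q z = (nth 0 Q (RtoC 0) + ev L (list_expo Q) z)%C.
Proof.
  induction Q as [|a Q IH]; intros L z HL.
  - simpl nth. rewrite peval_nil, (ev_ext L _ e0), ev_e0. ring. intros [|[|k]] _; reflexivity.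
  - rewrite peval_cons. simpl in HL. destruct L as [|L].
    + destruct Q; [|simpl in HL; lia]. rewrite peval_nil. simpl. ring.
    + rewrite (IH L) by lia. rewrite ev_succ. simpl nth.
      rewrite (ev_ext L (fun k => list_expo (a :: Q) (S k)) (list_expo Q)). reflexivity.
      intros [|k] Hk; [lia | reflexivity].
Qed.

Lemma peval_map_seq p : forall (e : expo) z, peval (map e (seq 0 (S p))) z = (e 0%nat + ev p e z)%C.
Proof.
  induction p; intros e z.
  - simpl. ring.
  - change (seq 0 (S (S p))) with (0%nat :: seq 1 (S p)). rewrite <- seq_shift, map_cons, map_map, peval_cons.
    rewrite (IHp (fun k => e (S k))), ev_succ. ring.
Qed.

(** The constant term of each exponent becomes a factor of its coefficient, after which equal
    exponents are merged. The bound [L] may exceed [p], so that [f] and [A] can share one. *)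
Lemma expoly_esum p f L : expoly_le p f -> (p <= L)%nat -> exists t, canonical L t /\ forall z, f z = esum L t z.
Proof.
  intros [t [Ht Hf]] HL.
  set (t0 := map (fun pq : list C * list C => (fun z => peval (fst pq) z * cexp (nth 0 (snd pq) (RtoC 0)), list_expo (snd pq))%C) t).
  assert (Hv : vlist L t0).
  { intros x Hx. apply in_map_iff in Hx as [pq [<- Hpq]]. simpl. split.
    - apply (poly_mult (peval (fst pq)) (fun _ => cexp (nth 0 (snd pq) (RtoC 0)))). exists (fst pq); auto. apply poly_const.
    - split; auto. intros k Hk. unfold list_expo. destruct k; auto. apply nth_overflow. specialize (Ht _ Hpq). lia. }
  destruct (canonicalize L t0 Hv) as (t' & Hc & _ & He). exists t'; split; auto.
  intros z. specialize (He (fun _ => true) z). rewrite !efilter_true in He. rewrite <- He, Hf.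
  unfold t0, esum. clear -Ht HL. induction t as [|pq t IH]; [reflexivity|].
  assert (Ht' : forall pq, In pq t -> (length (snd pq) <= S p)%nat) by (intros; apply Ht; simpl; auto).
  specialize (Ht pq (or_introl eq_refl)). simpl. rewrite <- (IH Ht'). f_equal. unfold tval; simpl.
  rewrite (peval_list_expo (snd pq) L) by lia. rewrite cexp_plus. ring.
Qed.

Lemma esum_expoly p t : vlist p t -> expoly_le p (esum p t).
Proof.
  intros Hv. induction t as [|x t IH].
  - exists []. split; [intros pq []|]. reflexivity.
  - destruct IH as [u [Hu Eu]]; [intros y Hy; apply Hv; simpl; auto|].
    destruct (Hv x (or_introl eq_refl)) as [[l Hl] [H0 _]].
    exists ((l, map (snd x) (seq 0 (S p))) :: u). split.
    + intros pq [<-|Hpq]; auto. cbn [snd]. rewrite length_map, length_seq. lia.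
    + intros z. unfold esum, expsum. cbn [csum fold_right fst snd]. fold (esum p t z). fold (expsum u z).
      rewrite Eu. f_equal. unfold tval. rewrite peval_map_seq, H0, Hl. f_equal. f_equal. ring.
Qed.

Lemma esum_shrink L p t z : (p <= L)%nat -> (forall x, In x t -> degree_le p (snd x)) ->
  esum L t z = esum p t z.
Proof.
  intros Hp H. apply csum_ext. intros x Hx. unfold tval. rewrite (ev_shrink L p); auto.
Qed.

Lemma nonpolynomial_expo L t : vlist L t -> ~ is_polynomial (esum L t) -> exists x, In x t /\ snd x <> e0.
Proof.
  intros Hv Hn. apply NNPP; intros Hno. apply Hn.
  apply (poly_csum (tval L)). intros x Hx.
  apply poly_ext with (fst x); [|apply Hv; auto]. intros z. unfold tval.
  assert (E : snd x = e0) by (apply NNPP; intros E; apply Hno; eauto). rewrite E, ev_e0, cexp_0. ring.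
Qed.

Lemma max_degree L t : vlist L t -> (exists x, In x t /\ snd x <> e0) -> exists s, (1 <= s <= L)%nat /\
  (forall x, In x t -> degree_le s (snd x)) /\ exists x, In x t /\ snd x s <> RtoC 0.
Proof.
  intros Hv [x0 [Hx0 Hne]].
  assert (H : forall n, (n <= L)%nat -> (forall x, In x t -> degree_le n (snd x)) -> exists s, (1 <= s <= L)%nat /\
    (forall x, In x t -> degree_le s (snd x)) /\ exists x, In x t /\ snd x s <> RtoC 0).
  { intros n; induction n as [|n IHn]; intros Hn Hk.
    - exfalso; apply Hne. extensionality k. destruct k; [destruct (Hv x0 Hx0) as [_ [Z0 _]]; exact Z0 | apply Hk; auto; lia].
    - destruct (classic (exists x, In x t /\ snd x (S n) <> RtoC 0)) as [Hex|Hno].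
      + exists (S n). repeat split; auto; lia.
      + apply IHn; [lia|]. intros x Hx k Hk'. destruct (Nat.eq_dec k (S n)) as [->|]; [|apply Hk; auto; lia].
        apply NNPP; intros E; apply Hno; eauto. }
  apply (H L); auto. intros x Hx k Hk. apply (Hv x Hx); auto.
Qed.

(** * Growth and the smallness of B *)

Lemma esum_growth L d t : (d <= L)%nat -> vlist L t -> (forall x, In x t -> degree_le d (snd x)) ->
  exists (c : R) (m : nat) (K : R), 0 <= c /\ 0 <= K /\ forall z, 1 <= Cmod z -> Cmod (esum L t z) <= c * Cmod z ^ m * exp (K * Cmod z ^ d).
Proof.
  intros Hd. induction t as [|x t IH]; intros Hv Hk.
  - exists 0, 0%nat, 0. repeat split; try lra. intros. unfold esum; simpl. rewrite Cmod_0. lra.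
  - destruct IH as (c & m & K & Hc & HK & H). { intros y Hy; apply Hv; simpl; auto. } { intros; apply Hk; simpl; auto. }
    destruct (poly_upper (fst x)) as (c' & m' & Hc' & H'). { apply Hv; simpl; auto. }
    destruct (ev_upper L d (snd x) Hd) as (K' & HK' & H''). { apply Hk; simpl; auto. }
    exists (c + c'), (m + m')%nat, (K + K'). repeat split; try lra. intros z Hz.
    unfold esum; simpl. fold (esum L t z). eapply Rle_trans; [apply Cmod_triangle|]. rewrite Cmod_tval.
    specialize (H z Hz). specialize (H' z Hz). specialize (H'' z Hz).
    assert (Hr := Re_le_Cmod (ev L (snd x) z)).
    set (r := Cmod z) in *.
    assert (Hm : 1 <= r ^ m) by (apply pow_R1_Rle; lra). assert (Hm' : 1 <= r ^ m') by (apply pow_R1_Rle; lra).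
    assert (Hrd : 1 <= r ^ d) by (apply pow_R1_Rle; lra).
    rewrite pow_add. set (X := exp ((K + K') * r ^ d)).
    assert (HX : 0 < X) by apply exp_pos.
    assert (X1 : exp (K * r ^ d) <= X) by (apply exp_le_compat; nra).
    assert (X2 : exp (Re (ev L (snd x) z)) <= X) by (apply exp_le_compat; nra).
    assert (Cmod (fst x z) * exp (Re (ev L (snd x) z)) <= c' * (r ^ m * r ^ m') * X).
    { apply Rmult_le_compat; auto. apply Cmod_ge_0. left; apply exp_pos.
      eapply Rle_trans; [apply H'|]. apply Rmult_le_compat_l; [lra|]. nra. }
    assert (c * r ^ m * exp (K * r ^ d) <= c * (r ^ m * r ^ m') * X).
    { apply Rmult_le_compat; auto. apply Rmult_le_pos; lra. left; apply exp_pos.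
      apply Rmult_le_compat_l; [lra|]. nra. }
    lra.
Qed.

Lemma exp_le_inv x y : exp x <= exp y -> x <= y.
Proof. intros H; apply Rnot_lt_le; intros Hl; apply exp_increasing in Hl; lra. Qed.

Lemma pow_le_self r s : 1 <= r -> (1 <= s)%nat -> r <= r ^ s.
Proof. intros. rewrite <- (pow_1 r) at 1. apply Rle_pow; auto. Qed.

Lemma esum_order L s t : (1 <= s <= L)%nat -> vlist L t -> (forall x, In x t -> degree_le s (snd x)) ->
  exists K R0, 0 < K /\ 1 <= R0 /\ forall z, R0 <= Cmod z -> Cmod (esum L t z) <= exp (K * Cmod z ^ s).
Proof.
  intros Hs Hv Hk. destruct (esum_growth L s t) as (c & m & K & Hc & HK & H); auto; [lia|].
  destruct (pow_le_exp m c 1 Rlt_0_1) as (R0 & HR & H0).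
  exists (1 + K), R0. repeat split; auto; [lra|]. intros z Hz. eapply Rle_trans; [apply H; lra|].
  rewrite Rmult_plus_distr_r, exp_plus. apply Rmult_le_compat_r; [left; apply exp_pos|].
  eapply Rle_trans; [apply H0; auto|]. apply exp_le_compat. apply Rmult_le_compat_l; [lra|]. apply pow_le_self; [lra | lia].
Qed.

Lemma esum_low_order L s t : (1 <= s <= L)%nat -> vlist L t -> (forall x, In x t -> degree_le (s - 1) (snd x)) ->
  forall eps, 0 < eps -> exists R0, 1 <= R0 /\ forall z, R0 <= Cmod z -> Cmod (esum L t z) <= exp (eps * Cmod z ^ s).
Proof.
  intros Hs Hv Hk eps He. destruct (esum_growth L (s - 1) t) as (c & m & K & Hc & HK & H); auto; [lia|].
  destruct (pow_le_exp m c (eps / 2)) as (R0 & HR & H0); [lra|].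
  exists (Rmax R0 (2 * K / eps)). split; [eapply Rle_trans; [apply HR | apply Rmax_l]|]. intros z Hz.
  destruct (Rmax_le_inv _ _ _ Hz) as [H1 H2].
  eapply Rle_trans; [apply H; lra|]. set (r := Cmod z) in *.
  destruct s as [|s]; [lia|]. replace (S s - 1)%nat with s by lia.
  replace (eps * r ^ S s) with (eps / 2 * r ^ S s + eps / 2 * r ^ S s) by field. rewrite exp_plus.
  apply Rmult_le_compat; [apply Rmult_le_pos; [auto | apply pow_le; lra] | left; apply exp_pos | |].
  - eapply Rle_trans; [apply H0; auto|]. apply exp_le_compat. apply Rmult_le_compat_l; [lra|]. apply pow_le_self; [lra | lia].
  - apply exp_le_compat. simpl. rewrite <- Rmult_assoc. apply Rmult_le_compat_r; [apply pow_le; lra|].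
    apply Rmult_le_compat_r with (r := eps / 2) in H2; [|lra]. replace (2 * K / eps * (eps / 2)) with K in H2 by (field; lra). lra.
Qed.

(** * Smallness of [B] in the mean and at points *)

Definition log_small (B : C -> C) (s : nat) : Prop := forall eps, 0 < eps -> exists R0, forall r, R0 <= r ->
  RInt (fun th => logp (Cmod (B (polar r th)))) 0 (2 * PI) <= eps * r ^ s.

Lemma nevT_polar g r : nevT g r = / (2 * PI) * RInt (fun th => logp (Cmod (g (polar r th)))) 0 (2 * PI).
Proof. reflexivity. Qed.

Lemma log_mean_le g r c : ccont g -> (forall th, logp (Cmod (g (polar r th))) <= c) ->
  RInt (fun th => logp (Cmod (g (polar r th)))) 0 (2 * PI) <= 2 * PI * c.
Proof.
  intros Hc H. assert (HPI := PI_RGT_0).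
  eapply Rle_trans; [apply (RInt_le _ (fun _ => c)); try lra|].
  - apply ex_RInt_cont. intros; apply continuous_logp_circle; auto.
  - apply ex_RInt_const.
  - intros; apply H.
  - rewrite RInt_const. unfold scal; simpl. unfold mult; simpl. lra.
Qed.

(** What enters is an upper bound for [A]: its characteristic is [O (r ^ s)], so that of [B] is
    [o (r ^ s)]. *)
Lemma little_o_log_small A B s K R0 : ccont A -> ccont B -> 0 < K ->
  (forall z, R0 <= Cmod z -> Cmod (A z) <= exp (K * Cmod z ^ s)) ->
  little_o_infty (nevT B) (nevT A) -> log_small B s.
Proof.
  intros cA cB HK HA Ho eps He. assert (HPI := PI_RGT_0).
  set (e := eps / (2 * PI * K)). assert (Hep : 0 < e) by (apply Rdiv_lt_0_compat; auto; apply Rmult_lt_0_compat; lra).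
  destruct (Ho e Hep) as [R1 H1]. exists (Rmax 0 (Rmax R0 R1)). intros r Hr.
  destruct (Rmax_le_inv _ _ _ Hr) as [Hr0 Hr12].
  destruct (Rmax_le_inv _ _ _ Hr12) as [Hr1 Hr2].
  specialize (H1 r Hr2). rewrite !nevT_polar in H1.
  assert (LA : RInt (fun th => logp (Cmod (A (polar r th)))) 0 (2 * PI) <= 2 * PI * (K * r ^ s)).
  { apply log_mean_le; auto. intros th. apply logp_le. apply Rmult_le_pos; [lra | apply pow_le; auto].
    rewrite <- (Cmod_polar r th) at 2 by auto. apply HA. rewrite Cmod_polar; auto. }
  assert (PA : 0 <= RInt (fun th => logp (Cmod (A (polar r th)))) 0 (2 * PI)).
  { apply RInt_ge_0; [lra | apply ex_RInt_cont; intros; apply continuous_logp_circle; auto | intros; apply logp_pos]. }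
  set (IA := RInt _ _ _) in LA, PA. fold IA in H1. set (IB := RInt (fun th => logp (Cmod (B (polar r th)))) 0 (2 * PI)) in *.
  assert (Hi : 0 < / (2 * PI)) by (apply Rinv_0_lt_compat; lra).
  rewrite (Rabs_pos_eq (/ (2 * PI) * IA)) in H1 by (apply Rmult_le_pos; lra).
  assert (H2 := Rle_trans _ _ _ (Rle_abs _) H1).
  apply Rmult_le_reg_l with (/ (2 * PI)); auto. eapply Rle_trans; [apply H2|].
  replace (e * (/ (2 * PI) * IA)) with (/ (2 * PI) * (e * IA)) by ring. apply Rmult_le_compat_l; [lra|].
  apply Rle_trans with (e * (2 * PI * (K * r ^ s))). apply Rmult_le_compat_l; lra.
  right. unfold e. field. split; lra.
Qed.

(** Smallness in the mean does not exclude large values at individual points, so a pointwise bound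
    is claimed only somewhere in each sector, at arbitrarily large radii. *)
Definition often_small (B : C -> C) (s : nat) : Prop := forall a b delta R0, a < b -> 0 < delta ->
  exists r th, R0 <= r /\ a <= th <= b /\ Cmod (B (polar r th)) <= exp (delta * r ^ s).

Lemma log_small_often_small B s : ccont B -> log_small B s -> often_small B s.
Proof.
  intros cB HB a b0 delta R0 Hab Hd. assert (HPI := PI_RGT_0).
  (* A sector wider than a full turn is cut, so that its integral is part of one over a period. *)
  set (b := Rmin b0 (a + 2 * PI)).
  assert (Hb : a < b) by (apply Rmin_glb_lt; lra). assert (Hb1 : b <= b0) by apply Rmin_l. assert (Hb2 : b <= a + 2 * PI) by apply Rmin_r.
  destruct (HB (delta * (b - a) / 2)) as [R1 H1].
  { assert (0 < delta * (b - a)) by (apply Rmult_lt_0_compat; lra). lra. }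
  set (r := Rmax (Rmax R0 R1) 1).
  assert (Hr1 : 1 <= r) by apply Rmax_r.
  assert (Hr2 : Rmax R0 R1 <= r) by apply Rmax_l. generalize (Rmax_l R0 R1), (Rmax_r R0 R1); intros.
  apply NNPP; intros Hno.
  assert (Hbig : forall th, a <= th <= b -> delta * r ^ s <= logp (Cmod (B (polar r th)))).
  { intros th Hth. apply Rnot_lt_le; intros Hlt. apply Hno. exists r, th. split; [lra|]. split; [lra|].
    eapply Rle_trans; [apply le_exp_logp|]. apply exp_le_compat; lra. }
  set (phi := fun th : R => logp (Cmod (B (polar r th)))) in *.
  assert (cB' : forall x, continuous phi x) by (intros; apply continuous_logp_circle; auto).
  specialize (H1 r ltac:(lra)). fold phi in H1.
  rewrite <- (RInt_period phi a cB') in H1.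
  2:{ intros x. unfold phi, polar. replace (x + 2 * PI) with (x + 2 * INR 1 * PI) by (simpl; ring). rewrite cis_period. auto. }
  rewrite (RInt_split phi a b _ cB') in H1.
  assert (0 <= RInt phi b (a + 2 * PI)).
  { apply RInt_ge_0; [lra | apply ex_RInt_cont; auto | intros; apply logp_pos]. }
  assert (L : RInt (fun _ => delta * r ^ s) a b <= RInt phi a b).
  { apply RInt_le; [lra | apply ex_RInt_const | apply ex_RInt_cont; auto | intros; apply Hbig; lra]. }
  rewrite RInt_const in L. unfold scal in L; simpl in L. unfold mult in L; simpl in L.
  assert (0 < delta * (b - a) * r ^ s).
  { apply Rmult_lt_0_compat; [apply Rmult_lt_0_compat; lra | apply pow_lt; lra]. }
  nra.
Qed.

(** Logarithms in a comparison of dominant terms: constants and powers of [r] cost only [delta * r],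
    from a radius on that serves all [X] and [Y]. *)
Lemma exp_balance (k c : R) (m : nat) (delta : R) : 0 < k -> 0 < delta -> exists R0, 1 <= R0 /\ forall r, R0 <= r ->
  forall X Y, k * exp X <= c * r ^ m * exp Y -> X <= Y + delta * r.
Proof.
  intros Hk Hd. destruct (pow_le_exp m (c / k) delta Hd) as (R0 & HR & H). exists R0; split; auto.
  intros r Hr X Y HXY. specialize (H r Hr). apply exp_le_inv. rewrite exp_plus.
  apply Rmult_le_reg_l with k; auto. eapply Rle_trans; [apply HXY|].
  replace (c * r ^ m) with (k * (c / k * r ^ m)) by (field; lra).
  assert (HY := exp_pos Y). replace (k * (c / k * r ^ m) * exp Y) with (k * (exp Y * (c / k * r ^ m))) by ring.
  apply Rmult_le_compat_l; [lra|]. apply Rmult_le_compat_l; lra.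
Qed.

(** * Exponents of a solution *)

(* At points of a sector where [A] is large and [B] is small, [A f'] must be balanced by [B f];
   so the dominant term of [f] disappears in [f'], i.e. it is constant. *)
Lemma solution_exponents L s tf tA B f1 f2 :
  canonical L tf -> tf <> [] -> canonical L tA -> (1 <= s <= L)%nat ->
  often_small B s ->
  (forall z, cder (esum L tf) z (f1 z)) -> (forall z, cder f1 z (f2 z)) ->
  (forall z, (f2 z + (esum L tA z * f1 z + B z * esum L tf z) = 0)%C) ->
  forall xA a b c0, In xA tA -> (degree_le s (snd xA)) -> a < b -> 0 < c0 ->
  (forall th, a <= th <= b -> c0 <= Re (snd xA s * cis (INR s * th))%C) ->
  (exists x, In x tf /\ snd x = e0 /\ exists c, c <> RtoC 0 /\ forall z, fst x z = c) /\
  (forall delta R0, 0 < delta -> exists r th, R0 <= r /\ 1 <= r /\ a <= th <= b /\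
     forall x y, In x tf -> In y tA -> snd x <> e0 -> Re (ev L (eadd (snd x) (snd y)) (polar r th)) <= delta * r ^ s).
Proof.
  intros Hcf Hne HcA Hs HB Hd1 Hd2 Heq xA a0 b0 c0 HxA HkA Hab0 Hc0 Hlam.
  destruct (esum_derivative_canonical L tf Hcf) as (t1 & Hc1 & Hin1 & Hder1 & Hor).
  destruct (esum_derivative_canonical L t1 Hc1) as (t2 & Hc2 & Hin2 & Hder2 & _).
  assert (E1 : forall z, f1 z = esum L t1 z).
  { intros z. apply cder_unique with (esum L tf) z; auto. generalize (Hder1 (fun _ => true) z). rewrite !efilter_true; auto. }
  assert (E2 : forall z, f2 z = esum L t2 z).
  { intros z. apply cder_unique with f1 z; auto. apply cder_ext with (esum L t1); auto.
    generalize (Hder2 (fun _ => true) z). rewrite !efilter_true; auto. }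
  destruct (shrink_comparable L (map snd tf ++ map snd tA) a0 b0) as (a & b & Ha & Hab & Hb & Hcmp); auto.
  { intros e He. apply in_app_or in He as [He|He]; eapply vlist_exps; eauto; [apply Hcf | apply HcA]. }
  destruct (dominant_exists L a b (map snd tf)) as [ef [Hef Hdf]].
  { intros x y Hx Hy; apply Hcmp; apply in_or_app; auto. } { destruct tf; simpl; congruence. }
  destruct (dominant_exists L a b (map snd tA)) as [eA [HeA HdA]].
  { intros x y Hx Hy; apply Hcmp; apply in_or_app; auto. } { destruct tA; simpl in *; [tauto | congruence]. }
  apply in_map_iff in HeA as [yA [EyA HyA]]. apply in_map_iff in Hef as [xf [Exf Hxf]].
  assert (HdA' := HdA). rewrite <- EyA in HdA'.
  destruct (esum_lower L a b tA yA HcA HyA HdA') as (cA & RA & HcAp & HRA & HA). rewrite EyA in HA. clear HdA'.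
  destruct (edom_Re_le _ _ _ _ _ HdA) as (RA2 & HRA2 & HA2).
  destruct (top_lower L s (snd xA) a b c0) as (RA3 & HRA3 & HA3); auto. { intros; apply Hlam; lra. }
  destruct (esum_upper L a b tf ef) as (cf & mf & Rf & Hcfp & HRf & Hf); auto. { apply Hcf. }
  destruct (edom_Re_le _ _ _ _ _ Hdf) as (Rf2 & HRf2 & Hf2).
  (* Comparison of dominant terms in [A f' = - f'' - B f]. Derivatives bring no new exponents, so
     [f''] is controlled by the dominant term of [f'], hence by that of [f]. *)
  assert (key : forall x1, In x1 t1 -> edom L a b (map snd t1) (snd x1) -> forall delta, 0 < delta -> exists R1, 1 <= R1 /\
    forall r th, R1 <= r -> a <= th <= b -> Cmod (B (polar r th)) <= exp (delta * r ^ s) ->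
    Re (ev L eA (polar r th)) + Re (ev L (snd x1) (polar r th)) <= delta * r ^ s + Re (ev L ef (polar r th)) + delta * r).
  { intros x1 Hx1 Hdom delta Hdel.
    destruct (esum_lower L a b t1 x1 Hc1 Hx1 Hdom) as (c1 & R1 & Hc1p & HR1 & H1).
    destruct (esum_upper L a b t2 (snd x1)) as (c2 & m2 & R2 & Hc2p & HR2 & H2).
    { apply Hc2. } { intros e He. apply in_map_iff in He as [y [<- Hy]]. apply Hdom, Hin2; auto. }
    destruct (exp_balance (cA * c1) (c2 + cf) (m2 + mf) delta) as (R3 & HR3 & H3); auto.
    { apply Rmult_lt_0_compat; auto. }
    exists (Rmax RA (Rmax (Rmax R1 R2) (Rmax R3 (Rmax Rf Rf2)))). split; [eapply Rle_trans; [apply HRA | apply Rmax_l]|].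
    intros r th Hr Hth HBr.
    destruct (Rmax_le_inv _ _ _ Hr) as [K1 K2].
    destruct (Rmax_le_inv _ _ _ K2) as [K3 K4].
    destruct (Rmax_le_inv _ _ _ K3) as [K5 K6].
    destruct (Rmax_le_inv _ _ _ K4) as [K7 K8].
    destruct (Rmax_le_inv _ _ _ K8) as [K9 K10].
    specialize (HA r th K1 Hth). specialize (H1 r th K5 Hth). specialize (H2 r th K6 Hth). specialize (Hf r th K9 Hth).
    assert (Hle : Re (ev L (snd x1) (polar r th)) <= Re (ev L ef (polar r th))) by (apply (Hf2 r th K10 Hth), Hin1; auto).
    specialize (Heq (polar r th)). rewrite E1, E2 in Heq.
    assert (Hprod : Cmod (esum L tA (polar r th)) * Cmod (esum L t1 (polar r th)) <=
      Cmod (esum L t2 (polar r th)) + Cmod (B (polar r th)) * Cmod (esum L tf (polar r th))).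
    { rewrite <- !Cmod_mult.
      replace (esum L tA (polar r th) * esum L t1 (polar r th))%C with
        ((esum L t2 (polar r th) + (esum L tA (polar r th) * esum L t1 (polar r th) + B (polar r th) * esum L tf (polar r th)))
         + - (esum L t2 (polar r th) + B (polar r th) * esum L tf (polar r th)))%C by ring.
      rewrite Heq. replace (0 + - (esum L t2 (polar r th) + B (polar r th) * esum L tf (polar r th)))%C with
        (- (esum L t2 (polar r th) + B (polar r th) * esum L tf (polar r th)))%C by ring.
      rewrite Cmod_opp. apply Cmod_triangle. }
    apply (H3 r K7).
    set (XA := Re (ev L eA (polar r th))) in *. set (X1 := Re (ev L (snd x1) (polar r th))) in *.
    set (Xf := Re (ev L ef (polar r th))) in *.
    assert (Hr1 : 1 <= r) by lra.
    assert (Hp2 : 1 <= r ^ m2) by (apply pow_R1_Rle; auto). assert (Hpf : 1 <= r ^ mf) by (apply pow_R1_Rle; auto).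
    assert (Hps : 0 <= delta * r ^ s) by (apply Rmult_le_pos; [lra | apply pow_le; lra]).
    rewrite pow_add, !exp_plus.
    assert (P1 := exp_pos X1). assert (P2 := exp_pos XA). assert (P3 := exp_pos Xf). assert (P4 := exp_pos (delta * r ^ s)).
    assert (Q1 : exp X1 <= exp Xf) by (apply exp_le_compat; auto).
    assert (Q2 : 1 <= exp (delta * r ^ s)) by (rewrite <- exp_0; apply exp_le_compat; auto).
    assert (U1 : cA * c1 * (exp XA * exp X1) <= Cmod (esum L tA (polar r th)) * Cmod (esum L t1 (polar r th))).
    { replace (cA * c1 * (exp XA * exp X1)) with ((cA * exp XA) * (c1 * exp X1)) by ring.
      apply Rmult_le_compat; auto; apply Rmult_le_pos; lra. }
    assert (U2 : Cmod (esum L t2 (polar r th)) <= c2 * (r ^ m2 * r ^ mf) * (exp (delta * r ^ s) * exp Xf)).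
    { eapply Rle_trans; [apply H2|]. apply Rmult_le_compat; try lra. apply Rmult_le_pos; lra.
      apply Rmult_le_compat_l; nra. nra. }
    assert (U3 : Cmod (B (polar r th)) * Cmod (esum L tf (polar r th)) <= cf * (r ^ m2 * r ^ mf) * (exp (delta * r ^ s) * exp Xf)).
    { replace (cf * (r ^ m2 * r ^ mf) * (exp (delta * r ^ s) * exp Xf)) with (exp (delta * r ^ s) * (cf * (r ^ m2 * r ^ mf) * exp Xf)) by ring.
      apply Rmult_le_compat; auto; try apply Cmod_ge_0. eapply Rle_trans; [apply Hf|].
      apply Rmult_le_compat_r; [lra|]. apply Rmult_le_compat_l; nra. }
    lra. }
  destruct (Hor xf Hxf) as [Hin|[He0 Hconst]].
  (* If the dominant term of [f] survives in [f'], it cancels from [key], which bounds the dominant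
     exponent of [A] by [c0 / 4 * r ^ s]; the top coefficient of [xA] gives at least
     [c0 / 2 * r ^ s]. *)
  - exfalso. apply in_map_iff in Hin as [x1 [Ex1 Hx1]].
    destruct (key x1 Hx1) with (delta := c0 / 8) as (R1 & HR1 & H1); [|lra|].
    { intros e He. apply in_map_iff in He as [y [<- Hy]]. rewrite Ex1, Exf. apply Hdf, Hin1; auto. }
    destruct (HB a b (c0 / 8) (Rmax R1 (Rmax RA2 RA3))) as (r & th & Hr & Hth & HBr); [auto | lra |].
    destruct (Rmax_le_inv _ _ _ Hr) as [K1 K2].
    destruct (Rmax_le_inv _ _ _ K2) as [K3 K4].
    specialize (H1 r th K1 Hth HBr). rewrite Ex1, Exf in H1.
    specialize (HA3 r th K4 Hth). specialize (HA2 r th K3 Hth (snd xA) (in_map snd _ _ HxA)).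
    assert (r <= r ^ s) by (apply pow_le_self; [lra | lia]). nra.
  - split.
    { exists xf; auto. }
    intros delta R0 Hdel.
    (* An empty [f'] means that [f] is constant, and the claim on non-zero exponents is vacuous. *)
    destruct t1 as [|x0 t1'].
    { exists (Rmax R0 1), a0. split; [apply Rmax_l|]. split; [apply Rmax_r|]. split; [lra|]. intros x y Hx _ Hn. exfalso.
      destruct (Hor x Hx) as [[]|[E _]]; auto. }
    set (t1 := x0 :: t1') in *.
    destruct (dominant_exists L a b (map snd t1)) as [e1 [He1 Hde1]].
    { intros x y Hx Hy. apply Hcmp; apply in_or_app; left.
      apply in_map_iff in Hx as [x' [<- Hx]]; auto. apply in_map_iff in Hy as [y' [<- Hy]]; auto. }
    { unfold t1; simpl; congruence. }
    apply in_map_iff in He1 as [x1 [Ex1 Hx1]]. rewrite <- Ex1 in Hde1.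
    destruct (key x1 Hx1 Hde1 (delta / 2)) as (R1 & HR1 & H1); [lra|].
    destruct (edom_Re_le _ _ _ _ _ Hde1) as (R2 & HR2 & H2).
    destruct (HB a b (delta / 2) (Rmax R0 (Rmax R1 (Rmax RA2 R2)))) as (r & th & Hr & Hth & HBr); [auto | lra |].
    destruct (Rmax_le_inv _ _ _ Hr) as [K0 K1].
    destruct (Rmax_le_inv _ _ _ K1) as [K2 K3].
    destruct (Rmax_le_inv _ _ _ K3) as [K4 K5].
    exists r, th. split; [auto|]. split; [lra|]. split; [lra|]. intros x y Hx Hy Hn.
    (* The dominant exponent of [f] is 0, so [key] bounds the sum of the dominant exponents of [A]
       and [f'], which majorise all those of [A] and all non-zero ones of [f]. *)
    specialize (H1 r th K2 Hth HBr). rewrite <- Exf, He0, ev_e0 in H1. simpl (Re (RtoC 0)) in H1.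
    rewrite ev_eadd, Re_plus.
    assert (Hxe : In (snd x) (map snd t1)) by (destruct (Hor x Hx) as [|[E _]]; [auto | contradiction]).
    specialize (H2 r th K5 Hth _ Hxe). specialize (HA2 r th K4 Hth _ (in_map snd _ _ Hy)).
    assert (r <= r ^ s) by (apply pow_le_self; [lra | lia]). nra.
Qed.

(** * Angles that force opposite rays *)

Lemma rotation_positive (s d : nat) (lam g : C) : (1 <= s < d)%nat -> lam <> RtoC 0 -> g <> RtoC 0 ->
  exists th, 0 < Re (lam * cis (INR s * th))%C /\ 0 < Re (g * cis (INR d * th))%C.
Proof.
  intros Hsd Hl Hg. assert (HPI := PI_RGT_0).
  assert (Hs1 : 1 <= INR s) by (apply (le_INR 1); lia).
  assert (Hd1 : INR s + 1 <= INR d) by (rewrite <- S_INR; apply le_INR; lia).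
  destruct (polar_exists lam) as [g1 [_ E1]].
  set (phi0 := - g1 / INR s).
  destruct (polar_exists (g * cis (INR d * phi0))%C) as [gam [Hgam E2]].
  rewrite Cmod_mult, Cmod_cis, Rmult_1_r in E2.
  (* At [phi0] the first number is a positive real and the second has phase [gam] in [[- PI, PI]].
     Rotating by [psi] leaves the phases [- gam * (2 s + 1) / (4 d)] and
     [gam * (1 / 2 - 1 / (4 s))]; both are below [PI / 2] in absolute value, the first because
     [d >= s + 1]. *)
  set (psi := - gam * (1 + / (2 * INR s)) / (2 * INR d)).
  exists (phi0 + psi). split.
  - rewrite E1, Re_polar_cis. apply Rmult_lt_0_compat; [apply Cmod_gt_0; auto|].
    replace (g1 + INR s * (phi0 + psi)) with (- (gam * ((2 * INR s + 1) / (4 * INR d)))).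
    2:{ unfold phi0, psi. field. lra. }
    rewrite cos_neg.
    assert (Hq : 0 < (2 * INR s + 1) / (4 * INR d) < / 2).
    { split; [apply Rdiv_lt_0_compat; lra|]. apply Rmult_lt_reg_r with (4 * INR d); [lra|].
      unfold Rdiv. rewrite Rmult_assoc, Rinv_l by lra. lra. }
    set (q := (2 * INR s + 1) / (4 * INR d)) in *. apply cos_gt_0; nra.
  - replace (g * cis (INR d * (phi0 + psi)))%C with (g * cis (INR d * phi0) * cis (INR d * psi))%C.
    2:{ rewrite Rmult_plus_distr_l, cis_plus. ring. }
    rewrite E2, Re_polar_cis. apply Rmult_lt_0_compat; [apply Cmod_gt_0; auto|].
    replace (gam + INR d * psi) with (gam * (/ 2 - / (4 * INR s))).
    2:{ unfold psi. field. lra. }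
    assert (Hq : 0 < / (4 * INR s) <= / 4).
    { split; [apply Rinv_0_lt_compat; lra|]. apply Rinv_le_contravar; lra. }
    set (q := / (4 * INR s)) in *. apply cos_gt_0; nra.
Qed.

(** For the quotient [b = g / lam] and after division by a cosine, the condition says
    [Re b <= Im b * y] for every tangent [y], hence for every real [y]; so [Im b = 0] and
    [Re b <= 0]. *)
Lemma opposite_ray (s : nat) (lam g : C) : (1 <= s)%nat -> lam <> RtoC 0 ->
  (forall th, 0 < Re (lam * cis (INR s * th))%C -> Re (g * cis (INR s * th))%C <= 0) ->
  exists t, 0 <= t /\ g = (- (RtoC t * lam))%C.
Proof.
  intros Hs Hl H. destruct (polar_exists lam) as [g1 [_ E1]].
  assert (Hm : 0 < Cmod lam) by (apply Cmod_gt_0; auto).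
  assert (Hs1 : 1 <= INR s) by (apply (le_INR 1); lia).
  set (b := (g / lam)%C). assert (Eg : g = (b * lam)%C) by (unfold b; field; auto).
  assert (K : forall y, Re b <= Im b * y).
  { intros y. destruct (atan_bound y) as [B1 B2]. assert (Hcos : 0 < cos (atan y)) by (apply cos_gt_0; lra).
    specialize (H ((atan y - g1) / INR s)).
    replace (INR s * ((atan y - g1) / INR s)) with (atan y - g1) in H by (field; lra).
    assert (E : (lam * cis (atan y - g1) = RtoC (Cmod lam) * cis (atan y))%C).
    { rewrite E1 at 1. rewrite polar_rot. unfold polar. do 2 f_equal. ring. }
    rewrite Eg, <- Cmult_assoc, E, Re_scal in H.
    assert (L := H ltac:(rewrite cis_val; apply Rmult_lt_0_compat; auto)).
    replace (b * (RtoC (Cmod lam) * cis (atan y)))%C with (RtoC (Cmod lam) * (b * cis (atan y)))%C in L by ring.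
    rewrite Re_scal, cis_val in L. change (Cmod lam * (Re b * cos (atan y) - Im b * sin (atan y)) <= 0) in L.
    assert (Ht : sin (atan y) = y * cos (atan y)).
    { rewrite <- (tan_atan y) at 2. unfold tan. field. lra. }
    rewrite Ht in L.
    assert (0 < Cmod lam * cos (atan y)) by (apply Rmult_lt_0_compat; auto).
    apply Rmult_le_reg_l with (Cmod lam * cos (atan y)); auto. lra. }
  assert (Him : Im b = 0).
  { destruct (Req_dec (Im b) 0); auto. exfalso. specialize (K ((Re b - 1) / Im b)).
    replace (Im b * ((Re b - 1) / Im b)) with (Re b - 1) in K by (field; auto). lra. }
  specialize (K 0). exists (- Re b). split; [lra|]. rewrite Eg.
  replace b with (RtoC (Re b)) at 1 by (apply C_eq; simpl; auto). rewrite RtoC_opp. ring.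
Qed.

Lemma dual_exponents L s (e eA : expo) : (1 <= s <= L)%nat -> valid L e -> valid L eA ->
  (degree_le s eA) -> eA s <> RtoC 0 ->
  (forall a b c0, a < b -> 0 < c0 -> (forall th, a <= th <= b -> c0 <= Re (eA s * cis (INR s * th))%C) ->
     forall delta R0, 0 < delta -> exists r th, R0 <= r /\ 1 <= r /\ a <= th <= b /\
       Re (ev L (eadd e eA) (polar r th)) <= delta * r ^ s) ->
  (degree_le s e) /\ exists t, 1 <= t /\ e s = (- (RtoC t * eA s))%C.
Proof.
  intros Hs Hv HvA HkA Hlam H. set (g := eadd e eA) in *.
  assert (Hvg : valid L g) by (apply valid_eadd; auto).
  (* A positive leading real part of [g] at an angle where [eA] is positive persists in a sector,
     and some point there would satisfy [v / 4 * r ^ d <= Re g <= v / 8 * r ^ s] although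
     [d >= s]. *)
  assert (Hd : forall d, (s <= d <= L)%nat -> (degree_le d g) ->
    forall th, 0 < Re (eA s * cis (INR s * th))%C -> Re (g d * cis (INR d * th))%C <= 0).
  { intros d Hd Hk th0 Hp. apply Rnot_lt_le; intros Hp'.
    destruct (cis_near _ _ _ Hp) as [h1 [Hh1 K1]]. destruct (cis_near _ _ _ Hp') as [h2 [Hh2 K2]].
    set (h := Rmin h1 h2). assert (Hh : 0 < h) by (apply Rmin_pos; auto).
    assert (h <= h1) by apply Rmin_l. assert (h <= h2) by apply Rmin_r.
    set (v := Re (g d * cis (INR d * th0))%C) in *.
    destruct (top_lower L d g (th0 - h) (th0 + h) (v / 2)) as (R0 & HR & KR); auto; [lia | lra | |].
    { intros th Hth; apply K2, Rabs_le; lra. }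
    destruct (H (th0 - h) (th0 + h) (Re (eA s * cis (INR s * th0))%C / 2)) with (delta := v / 8) (R0 := R0) as (r & th & Hr & Hr1 & Hth & Hle);
      [lra | lra | intros th Hth; apply K1, Rabs_le; lra | lra |].
    specialize (KR r th Hr Hth).
    assert (r ^ s <= r ^ d) by (apply Rle_pow; [auto | lia]).
    assert (0 < r ^ s) by (apply pow_lt; lra). nra. }
  assert (Hkg : degree_le s g).
  { intros k Hk. apply NNPP; intros Hgk.
    destruct (expo_degree L g Hvg) as (d & HdL & Hgd & Hkd). { intros E; apply Hgk; rewrite E; reflexivity. }
    assert (Hsd : (s < d)%nat).
    { apply Nat.nle_gt. intros Hle. apply Hgk, Hkd. lia. }
    destruct (rotation_positive s d (eA s) (g d)) as [th [T1 T2]]; auto; [lia|].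
    specialize (Hd d ltac:(lia) Hkd th T1). lra. }
  split.
  - intros k Hk. specialize (Hkg k Hk). unfold g, eadd in Hkg. rewrite HkA in Hkg by auto.
    rewrite <- Hkg. ring.
  - destruct (opposite_ray s (eA s) (g s)) as [t [Ht Et]]; auto; [lia | apply Hd; auto; lia |].
    exists (1 + t). split; [lra|]. unfold g, eadd in Et. rewrite RtoC_plus.
    replace (e s) with (e s + eA s - eA s)%C by ring. rewrite Et. ring.
Qed.

(** * The coefficient B *)

(** The positive logarithm is subadditive up to [ln 2]. That constant and [ln |g|] are each absorbed
    in [e * r ^ s], and [e = eps / (8 * PI)] makes their integral [eps / 2 * r ^ s]. *)
Lemma log_small_minus B g s : ccont B -> ccont g -> (1 <= s)%nat -> log_small B s ->
  (forall eps, 0 < eps -> exists R0, 1 <= R0 /\ forall z, R0 <= Cmod z -> Cmod (g z) <= exp (eps * Cmod z ^ s)) ->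
  log_small (fun z => B z - g z)%C s.
Proof.
  intros cB cg Hs HB Hg eps He. assert (HPI := PI_RGT_0).
  destruct (HB (eps / 2)) as [R1 H1]; [lra|].
  set (e := eps / (8 * PI)). assert (Hep : 0 < e) by (apply Rdiv_lt_0_compat; lra).
  destruct (Hg e Hep) as (R2 & HR2 & H2).
  exists (Rmax R1 (Rmax R2 (1 / e))). intros r Hr.
  destruct (Rmax_le_inv _ _ _ Hr) as [Hr1 Hr23].
  destruct (Rmax_le_inv _ _ _ Hr23) as [Hr2 Hr3].
  assert (Hrs : r <= r ^ s) by (apply pow_le_self; [lra | auto]).
  assert (H1e : 1 <= e * r ^ s).
  { apply Rmult_le_compat_l with (r := e) in Hr3; [|lra]. replace (e * (1 / e)) with 1 in Hr3 by (field; lra).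
    eapply Rle_trans; [apply Hr3|]. apply Rmult_le_compat_l; lra. }
  specialize (H1 r Hr1).
  assert (cD : ccont (fun z => B z - g z)%C).
  { intros z. apply ccont_ext with (fun z => B z + (- (1)) * g z)%C; [intros; ring|].
    apply (ccont_plus B (fun z => (- (1)) * g z)%C); auto. apply (ccont_mult (fun _ => (- (1))%C)); auto. apply ccont_const. }
  assert (cB' : forall x, continuous (fun th : R => logp (Cmod (B (polar r th)))) x) by (intros; apply continuous_logp_circle; auto).
  apply Rle_trans with (RInt (fun th => logp (Cmod (B (polar r th))) + 2 * (e * r ^ s)) 0 (2 * PI)).
  - apply RInt_le; [lra | apply ex_RInt_cont; intros; apply (continuous_logp_circle (fun z => B z - g z)%C); auto | |].
    + apply ex_RInt_cont. intros x. apply (continuous_plus (V := R_NormedModule)); [apply cB' | apply continuous_const].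
    + intros th _. assert (P := logp_pos (Cmod (B (polar r th)))).
      apply logp_le; [lra|].
      specialize (H2 (polar r th)). rewrite Cmod_polar in H2 by lra. specialize (H2 Hr2).
      eapply Rle_trans; [apply Cmod_triangle|]. rewrite Cmod_opp.
      assert (Q := le_exp_logp (Cmod (B (polar r th)))).
      replace (logp (Cmod (B (polar r th))) + 2 * (e * r ^ s)) with (e * r ^ s + (logp (Cmod (B (polar r th))) + e * r ^ s)) by ring.
      rewrite (exp_plus (e * r ^ s)), exp_plus.
      assert (2 <= exp (e * r ^ s)) by (generalize (exp_ineq1_le (e * r ^ s)); lra).
      assert (1 <= exp (logp (Cmod (B (polar r th))))) by (rewrite <- exp_0; apply exp_le_compat; auto).
      set (x := exp (logp (Cmod (B (polar r th))))) in *. set (y := exp (e * r ^ s)) in *.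
      assert (x <= x * y) by nra. assert (y <= x * y) by nra. assert (2 * (x * y) <= y * (x * y)) by (apply Rmult_le_compat_r; nra). lra.
  - assert (E : RInt (fun th => logp (Cmod (B (polar r th))) + 2 * (e * r ^ s)) 0 (2 * PI)
      = RInt (fun th => logp (Cmod (B (polar r th)))) 0 (2 * PI) + 2 * PI * (2 * (e * r ^ s))).
    { apply is_RInt_unique. evar_last.
      apply (is_RInt_plus (V := R_NormedModule)).
      apply (RInt_correct (V := R_CompleteNormedModule)), ex_RInt_cont, cB'. apply is_RInt_const.
      unfold plus, scal; simpl. unfold mult; simpl. ring. }
    rewrite E. replace (2 * PI * (2 * (e * r ^ s))) with (eps / 2 * r ^ s) by (unfold e; field; lra). lra.
Qed.

Lemma sector_exists (s : nat) (lam : C) : (1 <= s)%nat -> lam <> RtoC 0 ->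
  exists a b c0, a < b /\ 0 < c0 /\ forall th, a <= th <= b -> c0 <= Re (lam * cis (INR s * th))%C.
Proof.
  intros Hs Hl. destruct (polar_exists lam) as [g [_ E]].
  assert (Hs1 : 1 <= INR s) by (apply (le_INR 1); auto).
  assert (Hp : 0 < Re (lam * cis (INR s * (- g / INR s)))%C).
  { rewrite E, Re_polar_cis. replace (g + INR s * (- g / INR s)) with 0 by (field; lra).
    rewrite cos_0, Rmult_1_r. apply Cmod_gt_0; auto. }
  destruct (cis_near _ _ _ Hp) as [h [Hh K]].
  exists (- g / INR s - h), (- g / INR s + h). eexists. split; [lra|]. split; [|intros th Hth; apply K, Rabs_le; lra]. lra.
Qed.

(** Absence of zero divisors: a factor that is non-zero at a point is so on a disc, and the identity
    theorem settles the other factor. *)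
Lemma esum_mult_nonzero L t u : canonical L t -> canonical L u -> t <> [] -> u <> [] ->
  exists z, (esum L t z * esum L u z)%C <> RtoC 0.
Proof.
  intros Ht Hu Hnt Hnu. destruct (canonical_nonzero L t Ht Hnt) as [z0 Hz0].
  destruct (canonical_nonzero L u Hu Hnu) as [z1 Hz1].
  apply NNPP; intros Hno. apply Hz1.
  destruct (smooth_cont _ (esum_smooth L t (proj1 Ht)) z0 (Cmod (esum L t z0))) as [d [Hd K]]. apply Cmod_gt_0; auto.
  apply (smooth_identity (esum L u) z0 d); auto. apply esum_smooth, Hu.
  intros h Hh. specialize (K h Hh). apply NNPP; intros Hn. apply Hno. exists (z0 + h)%C.
  apply Cmult_neq_0; auto. intros E. rewrite E in K.
  replace (0 - esum L t z0)%C with (- esum L t z0)%C in K by ring. rewrite Cmod_opp in K. lra.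
Qed.

Lemma esum_constant_term L t x c : canonical L t -> In x t -> snd x = e0 -> (forall z, fst x z = c) ->
  forall z, esum L (efilter (fun e => cb (e = e0)) t) z = c.
Proof.
  intros (_ & Hnd & _) Hx Hx0 Hc z. destruct (in_split x t Hx) as (l1 & l2 & E).
  rewrite E, map_app in Hnd. simpl in Hnd. apply NoDup_remove_2 in Hnd.
  assert (H0 : forall y, In y (l1 ++ l2) -> cb (snd y = e0) = false).
  { intros y Hy. apply cb_false. intros Ey. apply Hnd. rewrite Hx0, <- Ey, <- map_app. apply in_map; auto. }
  unfold esum, efilter. rewrite csum_filter, E, csum_app. simpl.
  rewrite !csum_0; try (intros y Hy; rewrite H0; auto; apply in_or_app; auto).
  replace (cb (snd x = e0)) with true by (symmetry; apply cb_true; auto).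
  unfold tval. rewrite Hc, Hx0, ev_e0, cexp_0. ring.
Qed.

Definition real_top (s : nat) (lam : C) (e : expo) : Prop := exists k : R, e s = (RtoC k * lam)%C.

Lemma real_top_eadd s lam e e' : real_top s lam e -> real_top s lam e' -> real_top s lam (eadd e e').
Proof. intros [k Hk] [k' Hk']. exists (k + k'). unfold eadd. rewrite Hk, Hk', RtoC_plus. ring. Qed.

Lemma coefficient_exponents L s tf tA t1 t2 B lam x0 c :
  canonical L tf -> canonical L tA -> canonical L t1 -> canonical L t2 -> (1 <= s <= L)%nat ->
  ccont B -> log_small B s ->
  (forall x, In x t1 -> In (snd x) (map snd tf)) -> (forall x, In x t2 -> In (snd x) (map snd tf)) ->
  (forall z, (esum L t2 z + (esum L tA z * esum L t1 z + B z * esum L tf z) = 0)%C) ->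
  lam <> RtoC 0 ->
  (forall y, In y tA -> degree_le s (snd y)) ->
  (forall y, In y tA -> real_top s lam (snd y)) ->
  (forall x, In x tf -> degree_le s (snd x)) ->
  (forall x, In x tf -> snd x <> e0 -> exists t, 1 <= t /\ snd x s = (- (RtoC t * lam))%C) ->
  In x0 tf -> snd x0 = e0 -> c <> RtoC 0 -> (forall z, fst x0 z = c) ->
  exists tB, vlist L tB /\ (forall x, In x tB -> degree_le (s - 1) (snd x)) /\
    forall z, B z = esum L tB z.
Proof.
  intros Hcf HcA Hc1 Hc2 Hs cB HB Hin1 Hin2 Heq Hlam HkA HrA Hkf Hrf Hx0 Hx0e Hc Hx0c.
  set (chi0 := fun e : expo => cb (e s = RtoC 0)).
  set (chi1 := fun e : expo => negb (chi0 e)).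
  set (tE := t2 ++ emul tA t1).
  assert (HvE : vlist L tE) by (apply vlist_app; [apply Hc2 | apply vlist_emul; [apply HcA | apply Hc1]]).
  assert (Hftop : forall e, In e (map snd tf) -> real_top s lam e /\ degree_le s e).
  { intros e He. apply in_map_iff in He as [x [<- Hx]]. split; [|apply Hkf; auto].
    destruct (excluded_middle_informative (snd x = e0)) as [E|E].
    - exists 0. rewrite E. unfold e0; ring.
    - destruct (Hrf x Hx E) as [t [_ Et]]. exists (- t). rewrite Et, RtoC_opp. ring. }
  assert (HE : forall x, In x tE -> real_top s lam (snd x) /\ degree_le s (snd x)).
  { intros x Hx. apply in_app_or in Hx as [Hx|Hx]; [apply Hftop, Hin2; auto|].
    destruct (in_emul _ _ _ Hx) as (y & w & Hy & Hw & ->). destruct (Hftop _ (Hin1 w Hw)) as [T1 T2]. split.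
    - apply real_top_eadd; auto.
    - intros k Hk. unfold eadd. rewrite HkA, T2 by auto. ring. }
  (* Frequency 0 in [B f] can only come from [c * B] if [B] has lower order, so this part of [E] has
     to be cancelled by [c * B]; hence the candidate [- E0 / c]. *)
  set (tB := escal (- (1) / c)%C (efilter chi0 tE)).
  assert (HvB : vlist L tB) by (apply vlist_escal, vlist_efilter; auto).
  assert (HkB : forall x, In x tB -> degree_le (s - 1) (snd x)).
  { intros x Hx k Hk. destruct (in_escal _ _ _ Hx) as (y & Hy & ->). apply in_efilter in Hy as [Hy Ey].
    apply (proj1 (cb_true _)) in Ey. destruct (Nat.eq_dec k s) as [->|]; auto. apply HE; auto. lia. }
  set (tf' := efilter (fun e => negb (cb (e = e0))) tf).
  assert (Htf' : forall x, In x tf' -> In x tf /\ snd x <> e0).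
  { intros x Hx. apply in_efilter in Hx as [Hx Ex]. split; auto.
    apply Bool.negb_true_iff in Ex. apply (proj1 (cb_false _)) in Ex. auto. }
  assert (Hf : forall z, esum L tf z = (c + esum L tf' z)%C).
  { intros z. rewrite (esum_efilter_split L (fun e => cb (e = e0)) tf z).
    rewrite (esum_constant_term L tf x0 c) by auto. reflexivity. }
  (* From [B f = - (E0 + E1)] and [f = c + tf'] follows [D f = - E1 + E0 / c * tf']. In the last
     product a zero frequency meets some [- t * lam] with [t >= 1], so no frequency vanishes. *)
  set (tK := escal (- (1))%C (efilter chi1 tE ++ escal (- (1) / c)%C (emul (efilter chi0 tE) tf'))).
  assert (HvK : vlist L tK).
  { apply vlist_escal, vlist_app; [apply vlist_efilter; auto|].
    apply vlist_escal, vlist_emul; [apply vlist_efilter; auto|]. intros x Hx. apply Hcf, Htf'; auto. }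
  assert (HK : forall x, In x tK -> (exists k, k <> 0 /\ snd x s = (RtoC k * lam)%C) /\ degree_le s (snd x)).
  { intros x Hx. destruct (in_escal _ _ _ Hx) as (y & Hy & ->). clear x Hx. apply in_app_or in Hy as [Hy|Hy].
    - apply in_efilter in Hy as [Hy Ey]. destruct (HE y Hy) as [[k Hk] T]. split; auto. exists k; split; auto.
      intros ->. apply Bool.negb_true_iff in Ey. apply (proj1 (cb_false _)) in Ey. apply Ey. rewrite Hk. ring.
    - destruct (in_escal _ _ _ Hy) as (x & Hx & ->). destruct (in_emul _ _ _ Hx) as (u & w & Hu & Hw & ->).
      apply in_efilter in Hu as [Hu Eu]. apply (proj1 (cb_true _)) in Eu. destruct (Htf' w Hw) as [Hw' Nw].
      destruct (Hrf w Hw' Nw) as [t [Ht Et]]. unfold eadd. split.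
      + exists (- t). split; [lra|]. rewrite Eu, Et, RtoC_opp. ring.
      + intros k Hk. rewrite (Hkf w) by auto. destruct (HE u Hu) as [_ T]. rewrite T by auto. ring. }
  set (D := fun z => (B z - esum L tB z)%C).
  assert (HDK : forall z, (D z * esum L tf z = esum L tK z)%C).
  { intros z. unfold D, tK, tB. rewrite !esum_escal, esum_app, !esum_escal, esum_emul.
    assert (EE : (esum L t2 z + esum L tA z * esum L t1 z = esum L (efilter chi0 tE) z + esum L (efilter chi1 tE) z)%C).
    { rewrite <- esum_emul, <- esum_app. apply (esum_efilter_split L chi0 tE z). }
    assert (EB : (B z * esum L tf z = - (esum L (efilter chi0 tE) z + esum L (efilter chi1 tE) z))%C).
    { rewrite <- EE. replace (B z * esum L tf z)%C with
        ((esum L t2 z + (esum L tA z * esum L t1 z + B z * esum L tf z)) - (esum L t2 z + esum L tA z * esum L t1 z))%C by ring.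
      rewrite Heq. ring. }
    replace ((B z - - (1) / c * esum L (efilter chi0 tE) z) * esum L tf z)%C with
      (B z * esum L tf z - - (1) / c * esum L (efilter chi0 tE) z * esum L tf z)%C by ring.
    rewrite EB, Hf. field; auto. }
  assert (sf : smooth (esum L tf)) by (apply esum_smooth, Hcf).
  assert (sB : smooth (esum L tB)) by (apply esum_smooth; auto).
  assert (cD : ccont D).
  { intros z. apply ccont_ext with (fun z => B z + (- (1)) * esum L tB z)%C; [intros; unfold D; ring|].
    apply (ccont_plus B (fun z => (- (1)) * esum L tB z)%C); auto. apply (ccont_mult (fun _ => (- (1))%C)).
    apply ccont_const. apply smooth_cont; auto. }
  assert (HlowB := esum_low_order L s tB Hs HvB HkB).
  assert (HDs : log_small D s) by (apply log_small_minus; auto; [apply smooth_cont; auto | lia]).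
  destruct (canonicalize L tK HvK) as (tK' & HcK & HinK & HeK).
  assert (EK : forall z, esum L tK z = esum L tK' z).
  { intros z. specialize (HeK (fun _ => true) z). rewrite !efilter_true in HeK; auto. }
  exists tB. split; [auto|]. split; [auto|].
  destruct (classic (exists z, D z <> RtoC 0)) as [[z1 Hz1]|Hno].
  2:{ intros z. replace (B z) with (D z + esum L tB z)%C by (unfold D; ring).
      replace (D z) with (RtoC 0). ring. symmetry. apply NNPP; intros E; apply Hno; eauto. }
  exfalso.
  assert (Hnef : tf <> []) by (intros E; rewrite E in Hx0; contradiction).
  destruct (list_eq_dec (fun x y : term => excluded_middle_informative (x = y)) tK' []) as [EtK|HnK].
  (* If [K = 0] while [D z1] is non-zero, then [f] vanishes near [z1], hence everywhere. *)
  - destruct (cD z1 (Cmod (D z1))) as [d [Hd K]]; [apply Cmod_gt_0; auto|].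
    destruct (canonical_nonzero L tf Hcf Hnef) as [z2 Hz2]. apply Hz2.
    apply (smooth_identity (esum L tf) z1 d); auto.
    intros h Hh. specialize (K h Hh). specialize (HDK (z1 + h)%C). rewrite EK, EtK in HDK.
    apply NNPP; intros Hn. apply (Cmult_neq_0 (D (z1 + h)%C) (esum L tf (z1 + h)%C)); auto.
    intros E. rewrite E in K. replace (0 - D z1)%C with (- D z1)%C in K by ring. rewrite Cmod_opp in K. lra.
  - destruct (sector_exists s lam) as (a0 & b0 & c0 & Hab0 & Hc0 & Hsec); [lia | auto |].
    destruct (shrink_comparable L (map snd tK') a0 b0) as (a & b & Ha & Hab & Hb & Hcmp); auto.
    { intros e He; apply (vlist_exps L tK'); [apply HcK | auto]. }
    destruct (dominant_exists L a b (map snd tK') Hcmp) as [eK [HeKi HdK]]. { destruct tK'; simpl; congruence. }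
    assert (Hsec' : forall th, a <= th <= b -> c0 <= Re (lam * cis (INR s * th))%C) by (intros; apply Hsec; lra).
    assert (HeKi' := HeKi). apply in_map_iff in HeKi' as [xK [ExK HxK]].
    destruct (esum_lower L a b tK' xK HcK HxK) as (cK & RK & HcKp & HRK & HlowK); [rewrite ExK; auto|]. rewrite ExK in HlowK.
    destruct (esum_upper L a b tK' eK) as (CK & mK & RK2 & HCK & HRK2 & HupK); auto. { apply HcK. }
    assert (HtopK : (exists k, k <> 0 /\ eK s = (RtoC k * lam)%C) /\ degree_le s eK).
    { rewrite <- ExK. specialize (HinK xK HxK). apply in_map_iff in HinK as [y [<- Hy]]. auto. }
    destruct HtopK as [[kap [Hkap EeK]] HkK].
    assert (Hcp : 0 < Cmod c) by (apply Cmod_gt_0; auto).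
    (* In a sector where [lam] is positive every term of [f] with non-zero exponent decays, so [f]
       stays near [c] and [|D|] is comparable to [|K|]. *)
    destruct (esum_small L a b tf' e0) with (eps := Cmod c / 2) as (Rf & HRf & Hfs); [| | lra |].
    { intros x Hx. apply Hcf, Htf'; auto. }
    { intros x Hx. destruct (Htf' x Hx) as [Hx' Nx]. destruct (Hrf x Hx' Nx) as [t [Ht Et]].
      apply (top_epos L s (esub e0 (snd x)) a b c0); auto.
      - intros k Hk. unfold esub, e0. rewrite Hkf by auto. ring.
      - intros th Hth. unfold esub, e0. rewrite Et.
        replace ((0 - - (RtoC t * lam)) * cis (INR s * th))%C with (RtoC t * (lam * cis (INR s * th)))%C by ring.
        rewrite Re_scal. specialize (Hsec' th Hth). nra. }
    assert (Hfb : forall r th, Rf <= r -> a <= th <= b -> Cmod c / 2 <= Cmod (esum L tf (polar r th)) <= 2 * Cmod c).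
    { intros r th Hr Hth. specialize (Hfs r th Hr Hth). rewrite ev_e0 in Hfs. simpl (Re (RtoC 0)) in Hfs. rewrite exp_0 in Hfs.
      rewrite Hf. generalize (Cmod_plus_inv c (esum L tf' (polar r th))), (Cmod_triangle c (esum L tf' (polar r th))). lra. }
    destruct (Rtotal_order kap 0) as [Hneg|[E0|Hpos]]; [|contradiction|].
    (* Here [K] decays exponentially, and so does [D]; half of the rate is given up for the
       polynomial factor. *)
    + set (h := - kap * c0 / 2). assert (Hh : 0 < h) by (unfold h; nra).
      destruct (top_lower L s (esub e0 eK) a b (- kap * c0)) as (R3 & HR3 & Htop); [lia | | nra | |].
      { intros k Hk. unfold esub, e0. rewrite HkK by auto. ring. }
      { intros th Hth. unfold esub, e0. rewrite EeK.
        replace ((0 - RtoC kap * lam) * cis (INR s * th))%C with (RtoC (- kap) * (lam * cis (INR s * th)))%C by (rewrite RtoC_opp; ring).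
        rewrite Re_scal. specialize (Hsec' th Hth). nra. }
      destruct (pow_le_exp mK (CK * (2 / Cmod c)) (h / 2)) as (R4 & HR4 & Hpe); [lra|].
      destruct (canonical_nonzero L tK' HcK HnK) as [z2 Hz2]. apply Hz2.
      apply (quotient_decay_zero D (esum L tf) (esum L tK') s (h / 2) a b (Rmax (Rmax RK2 Rf) (Rmax R3 R4))); auto.
      * apply esum_smooth, HcK.
      * intros z. rewrite <- EK. auto.
      * lia.
      * lra.
      * intros r th Hr Hth.
        destruct (Rmax_le_inv _ _ _ Hr) as [K1 K2].
        destruct (Rmax_le_inv _ _ _ K1) as [K3 K4].
        destruct (Rmax_le_inv _ _ _ K2) as [K5 K6].
        specialize (HupK r th K3 Hth). specialize (Htop r th K5 Hth). specialize (Hpe r K6).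
        destruct (Hfb r th K4 Hth) as [Hf1 _].
        rewrite ev_esub, ev_e0, Re_minus in Htop. simpl (Re (RtoC 0)) in Htop.
        rewrite <- EK, <- HDK, Cmod_mult in HupK.
        assert (Hrs : r <= r ^ s) by (apply pow_le_self; [lra | lia]).
        assert (Hexp : exp (Re (ev L eK (polar r th))) <= exp (- (h * r ^ s))).
        { apply exp_le_compat. unfold h. lra. }
        apply Rmult_le_reg_r with (Cmod c / 2); [lra|].
        apply Rle_trans with (Cmod (D (polar r th)) * Cmod (esum L tf (polar r th))).
        { apply Rmult_le_compat_l; [apply Cmod_ge_0 | auto]. }
        eapply Rle_trans; [apply HupK|].
        apply Rle_trans with (CK * r ^ mK * exp (- (h * r ^ s))).
        { apply Rmult_le_compat_l; auto. apply Rmult_le_pos; auto. apply pow_le; lra. }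
        replace (CK * r ^ mK) with (Cmod c / 2 * (CK * (2 / Cmod c) * r ^ mK)) by (field; lra).
        apply Rle_trans with (Cmod c / 2 * exp (h / 2 * r ^ s) * exp (- (h * r ^ s))).
        { apply Rmult_le_compat_r; [left; apply exp_pos|]. apply Rmult_le_compat_l; [lra|].
          eapply Rle_trans; [apply Hpe|]. apply exp_le_compat. apply Rmult_le_compat_l; lra. }
        rewrite Rmult_assoc, <- exp_plus. rewrite Rmult_comm. apply Rmult_le_compat_r; [lra|].
        apply exp_le_compat. lra.
    (* Here the exponent of [K] is at least [kap * c0 / 2 * r ^ s], against at most
       [2 * del * r ^ s] at points where [B] is small. *)
    + set (del := kap * c0 / 16). assert (Hdel : 0 < del) by (unfold del; nra).
      destruct (top_lower L s eK a b (kap * c0)) as (R3 & HR3 & Htop); [lia | auto | nra | |].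
      { intros th Hth. rewrite EeK.
        replace (RtoC kap * lam * cis (INR s * th))%C with (RtoC kap * (lam * cis (INR s * th)))%C by ring.
        rewrite Re_scal. specialize (Hsec' th Hth). nra. }
      destruct (HlowB del Hdel) as (R4 & HR4 & HB4).
      destruct (exp_balance cK (4 * Cmod c) 0 del HcKp Hdel) as (R5 & HR5 & Hbal).
      destruct (log_small_often_small B s cB HB a b del (Rmax (Rmax RK Rf) (Rmax R3 (Rmax R4 R5)))) as (r & th & Hr & Hth & HBr); auto.
      destruct (Rmax_le_inv _ _ _ Hr) as [K1 K2].
      destruct (Rmax_le_inv _ _ _ K1) as [K3 K4].
      destruct (Rmax_le_inv _ _ _ K2) as [K5 K6].
      destruct (Rmax_le_inv _ _ _ K6) as [K7 K8].
      specialize (HlowK r th K3 Hth). specialize (Htop r th K5 Hth).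
      specialize (HB4 (polar r th)). rewrite Cmod_polar in HB4 by lra. specialize (HB4 K7).
      destruct (Hfb r th K4 Hth) as [_ Hf2].
      rewrite <- EK, <- HDK, Cmod_mult in HlowK.
      assert (HDb : Cmod (D (polar r th)) <= 2 * exp (del * r ^ s)).
      { unfold D. eapply Rle_trans; [apply Cmod_triangle|]. rewrite Cmod_opp. lra. }
      assert (Hfin : cK * exp (Re (ev L eK (polar r th))) <= 4 * Cmod c * r ^ 0 * exp (del * r ^ s)).
      { eapply Rle_trans; [apply HlowK|]. simpl.
        apply Rle_trans with (2 * exp (del * r ^ s) * (2 * Cmod c)); [|right; ring].
        apply Rmult_le_compat; auto; apply Cmod_ge_0. }
      specialize (Hbal r K8 _ _ Hfin).
      assert (Hrs : r <= r ^ s) by (apply pow_le_self; [lra | lia]).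
      assert (del * r <= del * r ^ s) by (apply Rmult_le_compat_l; lra).
      assert (0 < kap * c0 * r ^ s) by (apply Rmult_lt_0_compat; [nra | lra]).
      unfold del in *. lra.
Qed.

(** * Normal form *)

(** The deleted coefficient becomes the frequency, so that what remains belongs to a multiplier of
    order at most [s - 1]. *)
Definition cut (s : nat) (e : expo) : expo := fun k => if Nat.eqb k s then RtoC 0 else e k.

Definition frequency_block (s : nat) (t : list term) (w : C) : list term :=
  map (fun x : term => (fst x, cut s (snd x))) (efilter (fun e => cb (e s = w)) t).

Lemma tval_cut L s (x : term) z : (1 <= s <= L)%nat -> (degree_le s (snd x)) ->
  tval L x z = (tval (s - 1) (fst x, cut s (snd x)) z * cexp (snd x s * cpow z s))%C.
Proof.
  intros Hs Hk. unfold tval; simpl. rewrite (ev_shrink L s) by (auto; lia).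
  destruct s as [|s]; [lia|]. replace (S s - 1)%nat with s by lia. rewrite ev_S, cexp_plus.
  rewrite (ev_ext s (cut (S s) (snd x)) (snd x)); [ring|].
  intros k Hk'. unfold cut. replace (Nat.eqb k (S s)) with false; auto. symmetry; apply Nat.eqb_neq; lia.
Qed.

Lemma esum_frequency_block L s t w z : (1 <= s <= L)%nat -> (forall x, In x t -> degree_le s (snd x)) ->
  esum L (efilter (fun e => cb (e s = w)) t) z = (esum (s - 1) (frequency_block s t w) z * cexp (w * cpow z s))%C.
Proof.
  intros Hs Hk. unfold frequency_block, esum. rewrite csum_map, Cmult_comm, <- csum_scal.
  apply csum_ext. intros x Hx. apply in_efilter in Hx as [Hx Ex]. apply (proj1 (cb_true _)) in Ex.
  rewrite (tval_cut L s) by auto. rewrite Ex. ring.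
Qed.

Lemma vlist_frequency_block L s t w : (1 <= s <= L)%nat -> vlist L t ->
  (forall x, In x t -> degree_le s (snd x)) -> vlist (s - 1) (frequency_block s t w).
Proof.
  intros Hs Hv Hk x Hx. apply in_map_iff in Hx as [y [<- Hy]]. apply in_efilter in Hy as [Hy _].
  destruct (Hv y Hy) as [H1 [H2 _]]. simpl. split; auto. split.
  - unfold cut. destruct (Nat.eqb 0 s); auto.
  - intros k Hk'. unfold cut. destruct (Nat.eqb_spec k s); auto. apply Hk; auto. lia.
Qed.

(** Terms are grouped by their coefficient of degree [s]; a multiplier is non-zero because a
    non-empty part of a canonical list has a non-zero sum. *)
Lemma normal_form L s t : canonical L t -> (1 <= s <= L)%nat ->
  (forall x, In x t -> degree_le s (snd x)) -> (exists x, In x t /\ snd x s <> RtoC 0) ->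
  exists tw, normal_rep (esum L t) s (esum (s - 1) (frequency_block s t (RtoC 0))) tw /\
    forall w, In w (map fst tw) <-> w <> RtoC 0 /\ exists x, In x t /\ snd x s = w.
Proof.
  intros Hc Hs Hk [x0 [Hx0 Hn0]].
  set (t' := efilter (fun e => negb (cb (e s = RtoC 0))) t).
  assert (Ht' : forall x, In x t' <-> In x t /\ snd x s <> RtoC 0).
  { intros x. unfold t'. rewrite in_efilter, Bool.negb_true_iff, cb_false. tauto. }
  set (ws := nodup (fun x y : C => excluded_middle_informative (x = y)) (map (fun x : term => snd x s) t')).
  assert (Hws : forall w, In w ws <-> w <> RtoC 0 /\ exists x, In x t /\ snd x s = w).
  { intros w. unfold ws. rewrite nodup_In, in_map_iff. split.
    - intros [x [<- Hx]]. apply Ht' in Hx. split; [apply Hx | exists x; tauto].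
    - intros [Hw [x [Hx Ex]]]. exists x. split; auto. apply Ht'. split; auto. congruence. }
  set (tw := map (fun w => (w, esum (s - 1) (frequency_block s t w))) ws).
  assert (Efst : map fst tw = ws) by (unfold tw; rewrite map_map; simpl; apply map_id).
  exists tw. split; [|rewrite Efst; auto].
  assert (Hx0' : In (snd x0 s) ws) by (apply Hws; split; auto; exists x0; auto).
  split; [lia|]. split; [|split; [|split; [|split; [|split]]]].
  - intros E. rewrite E in Efst. rewrite <- Efst in Hx0'. contradiction.
  - rewrite Efst. apply NoDup_nodup.
  - intros wF HwF. apply in_map_iff in HwF as [w [<- Hw]]. simpl. apply Hws in Hw. apply Hw.
  - apply esum_expoly, (vlist_frequency_block L); auto. apply Hc.
  - intros wF HwF. apply in_map_iff in HwF as [w [<- Hw]]. simpl. split.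
    + apply esum_expoly, (vlist_frequency_block L); auto. apply Hc.
    + apply Hws in Hw as [_ [x [Hx Ex]]].
      destruct (canonical_nonzero L (efilter (fun e => cb (e s = w)) t)) as [z Hz].
      * apply canonical_efilter; auto.
      * intros E. assert (Hi : In x (efilter (fun e => cb (e s = w)) t)) by (apply in_efilter; split; auto; apply cb_true; auto).
        rewrite E in Hi. contradiction.
      * exists z. intros E. apply Hz. rewrite (esum_frequency_block L s) by auto. rewrite E. ring.
  - intros z. rewrite (esum_efilter_split L (fun e => cb (e s = RtoC 0)) t z).
    rewrite (esum_frequency_block L s) by auto.
    replace (cexp (0 * cpow z s)) with (RtoC 1) by (replace (0 * cpow z s)%C with (RtoC 0) by ring; symmetry; apply cexp_0).
    replace (esum (s - 1) (frequency_block s t 0%C) z * 1)%C with (esum (s - 1) (frequency_block s t (RtoC 0)) z) by ring.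
    f_equal. change (esum L t' z = fold_right (fun (wF : C * (C -> C)) acc => (snd wF z * cexp (fst wF * cpow z s) + acc)%C) (RtoC 0) tw).
    unfold esum at 1. etransitivity.
    { apply (csum_regroup (fun x => tval L x z) (fun x : term => snd x s) ws); [apply NoDup_nodup|].
      intros x Hx. apply Hws. apply Ht' in Hx. split; [apply Hx | exists x; tauto]. }
    assert (Hin : forall w, In w ws -> csum (fun x => tval L x z) (filter (fun x : term => cb (snd x s = w)) t') =
        (esum (s - 1) (frequency_block s t w) z * cexp (w * cpow z s))%C).
    { intros w Hw. apply Hws in Hw as [Hw _]. rewrite <- (esum_frequency_block L s) by auto.
      unfold esum, t', efilter. rewrite !csum_filter. apply csum_ext. intros x _.
      destruct (cb (snd x s = w)) eqn:E1; [|destruct (negb (cb (snd x s = RtoC 0))); reflexivity].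
      apply (proj1 (cb_true _)) in E1.
      replace (cb (snd x s = RtoC 0)) with false; auto. symmetry. apply cb_false. congruence. }
    unfold tw. clear -Hin. induction ws as [|w ws IH]; [reflexivity|].
    simpl. rewrite Hin by (simpl; auto). f_equal. apply IH. intros; apply Hin; simpl; auto.
Qed.

(** * Commensurability *)

(** All integers rather than positive ones, in order to have a group; signs are recovered afterwards
    from the opposite rays. *)
Definition int_multiple (w v : C) : Prop := exists k : Z, v = (RtoC (IZR k) * w)%C.

Lemma int_multiple_0 w : int_multiple w (RtoC 0).
Proof. exists 0%Z. ring. Qed.

Lemma int_multiple_plus w u v : int_multiple w u -> int_multiple w v -> int_multiple w (u + v)%C.
Proof. intros [k ->] [m ->]. exists (k + m)%Z. rewrite plus_IZR, RtoC_plus. ring. Qed.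

Lemma int_multiple_plus_iff w u v : int_multiple w v -> (int_multiple w (u + v)%C <-> int_multiple w u).
Proof.
  intros Hv. split; intros H; [|apply int_multiple_plus; auto].
  replace u with (u + v + - v)%C by ring. apply int_multiple_plus; auto.
  destruct Hv as [k ->]. exists (- k)%Z. rewrite opp_IZR, RtoC_opp. ring.
Qed.

Lemma commensurable_int_multiple w ws v : commensurable_with w ws -> In v ws -> int_multiple w v.
Proof. intros [_ H] Hv. destruct (H v Hv) as [n [_ ->]]. exists (Z.of_nat n). rewrite <- INR_IZR_INZ. auto. Qed.

(** The integer [k] equals [- (t * n)], hence is negative, and [- k] is the multiplicity with
    respect to [- w]. *)
Lemma opposite_multiple (w u v : C) (t : R) (n : nat) : w <> RtoC 0 -> (0 < n)%nat -> u = (RtoC (INR n) * w)%C ->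
  0 < t -> v = (- (RtoC t * u))%C -> int_multiple w v -> exists m, (0 < m)%nat /\ v = (RtoC (INR m) * - w)%C.
Proof.
  intros Hw Hn Eu Ht Ev [k Ek].
  assert (Hk : IZR k = - (t * INR n)).
  { apply RtoC_inj. rewrite RtoC_opp, RtoC_mult.
    replace (RtoC (IZR k)) with (RtoC (IZR k) * w / w)%C by (field; auto). rewrite <- Ek, Ev, Eu. field; auto. }
  assert (Hn' : 0 < INR n) by (apply lt_0_INR; auto).
  assert (Hkn : (k < 0)%Z) by (apply lt_IZR; assert (0 < t * INR n) by (apply Rmult_lt_0_compat; auto); lra).
  exists (Z.to_nat (- k)). split; [lia|]. rewrite Ek, INR_IZR_INZ, Z2Nat.id by lia. rewrite opp_IZR, RtoC_opp. ring.
Qed.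

Lemma esum_efilter_none L chi t z : (forall x, In x t -> chi (snd x) = false) -> esum L (efilter chi t) z = RtoC 0.
Proof. intros H. unfold esum, efilter. rewrite csum_filter. apply csum_0. intros x Hx. rewrite H; auto. Qed.

Definition outside (s : nat) (w : C) (e : expo) : bool := cb (~ int_multiple w (e s)).

Lemma outside_eadd s w e e' : int_multiple w (e' s) -> outside s w (eadd e e') = outside s w e.
Proof.
  intros He'. unfold outside, eadd. assert (Q := int_multiple_plus_iff w (e s) (e' s) He').
  destruct (cb (~ int_multiple w (e s))) eqn:E.
  - apply cb_true. apply (proj1 (cb_true _)) in E. tauto.
  - apply cb_false. apply (proj1 (cb_false _)) in E. tauto.
Qed.

(** * Assembly: common order, opposite rays, commensurability *)

Theorem theorem3p1 (A B f : C -> C)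
  (hA : entire A) (hB : entire B)
  (hsol : solves_ode A B f)
  (hf : trans_expoly f) (hAe : trans_expoly A)
  (hT : little_o_infty (nevT B) (nevT A)) :
  exists (q : nat) (c : C) (tf : list (C * (C -> C)))
         (FA0 : C -> C) (tA : list (C * (C -> C))),
    (* (a) *)
    normal_rep f q (fun _ => c) tf /\ c <> RtoC 0 /\
    normal_rep A q FA0 tA /\
    dual_freqs (map fst tf) (map fst tA) /\
    expoly_le (q - 1) B /\
    (* (b) *)
    (commensurable (map fst tf) <-> commensurable (map fst tA)) /\
    (commensurable (map fst tf) -> strongly_dual_freqs (map fst tf) (map fst tA)).
Proof.
  destruct hf as [[pf Hpf] nf]. destruct hAe as [[pA HpA] nA].
  set (L := Nat.max pf pA).
  destruct (expoly_esum pf f L Hpf) as (tf & Hcf & Ef); [unfold L; lia|].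
  destruct (expoly_esum pA A L HpA) as (tA & HcA & EA); [unfold L; lia|].
  apply functional_extensionality in Ef. apply functional_extensionality in EA. subst f A.
  destruct (nonpolynomial_expo L tf (proj1 Hcf) nf) as [x1 [Hx1 Nx1]].
  (* [s] is the order of [A]; it becomes the common order [q]. *)
  destruct (max_degree L tA (proj1 HcA) (nonpolynomial_expo L tA (proj1 HcA) nA)) as (s & Hs & HkA & yA & HyA & NyA).
  set (lam := snd yA s) in *.
  assert (cB : ccont B).
  { intros z. destruct (hB z) as [l Hl]. apply is_derive_cder in Hl. eapply cder_cont; eauto. }
  assert (cA : ccont (esum L tA)) by (apply smooth_cont, esum_smooth, HcA).
  destruct (esum_order L s tA Hs (proj1 HcA) HkA) as (K & R0 & HK & _ & HgA).
  assert (HB : log_small B s) by (eapply little_o_log_small; eauto).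
  assert (HoB := log_small_often_small B s cB HB).
  destruct hsol as (f1 & f2 & Hd1 & Hd2 & Heq).
  assert (Hnf : tf <> []) by (intros E; rewrite E in Hx1; contradiction).
  destruct (esum_derivative_canonical L tf Hcf) as (t1 & Hc1 & Hin1 & Hder1 & Hor1).
  destruct (esum_derivative_canonical L t1 Hc1) as (t2 & Hc2 & Hin2 & Hder2 & _).
  assert (E1 : forall z, f1 z = esum L t1 z).
  { intros z. apply cder_unique with (esum L tf) z; [apply is_derive_cder; auto|].
    generalize (Hder1 (fun _ => true) z). rewrite !efilter_true; auto. }
  assert (E2 : forall z, f2 z = esum L t2 z).
  { intros z. apply cder_unique with f1 z; [apply is_derive_cder; auto|]. apply cder_ext with (esum L t1); auto.
    generalize (Hder2 (fun _ => true) z). rewrite !efilter_true; auto. }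
  assert (Heq' : forall z, (esum L t2 z + (esum L tA z * esum L t1 z + B z * esum L tf z) = 0)%C).
  { intros z. rewrite <- E1, <- E2. apply Heq. }
  clear Heq nf nA Hpf HpA hT.
  assert (Hsol := fun y => solution_exponents L s tf tA B f1 f2 Hcf Hnf HcA Hs HoB
    (fun z => is_derive_cder _ _ _ (Hd1 z)) (fun z => is_derive_cder _ _ _ (Hd2 z))
    (fun z => eq_trans (f_equal2 Cplus (E2 z) (f_equal2 Cplus (f_equal (Cmult (esum L tA z)) (E1 z)) eq_refl)) (Heq' z)) y).
  destruct (sector_exists s lam) as (a0 & b0 & c0 & Hab0 & Hc0 & Hsec); [lia | auto |].
  destruct (Hsol yA a0 b0 c0 HyA (HkA yA HyA) Hab0 Hc0 Hsec) as [(x0 & Hx0 & Ex0 & c & Hc & Hx0c) _].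
  assert (Hdual : forall x y, In x tf -> snd x <> e0 -> In y tA -> snd y s <> RtoC 0 ->
    (degree_le s (snd x)) /\ exists t, 1 <= t /\ snd x s = (- (RtoC t * snd y s))%C).
  { intros x y Hx Nx Hy Ny. apply (dual_exponents L s); auto; [apply Hcf; auto | apply HcA; auto |].
    intros a b c1 Hab Hc1p Hse delta R1 Hdel.
    destruct (Hsol y a b c1 Hy (HkA y Hy) Hab Hc1p Hse) as [_ H].
    destruct (H delta R1 Hdel) as (r & th & H1 & H2 & H3 & H4). exists r, th. repeat split; auto; apply H3. }
  assert (Hkf : forall x, In x tf -> degree_le s (snd x)).
  { intros x Hx. destruct (excluded_middle_informative (snd x = e0)) as [E|E].
    - intros k _. rewrite E. reflexivity.
    - apply (Hdual x yA Hx E HyA NyA). }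
  assert (Hrf : forall x, In x tf -> snd x <> e0 -> exists t, 1 <= t /\ snd x s = (- (RtoC t * lam))%C).
  { intros x Hx E. apply (Hdual x yA Hx E HyA NyA). }
  assert (Hmul : forall t (l : C), 1 <= t -> l <> RtoC 0 -> (- (RtoC t * l))%C <> RtoC 0).
  { intros t l Ht Hl E. apply (Cmult_neq_0 (RtoC t) l); auto. intros E'. apply RtoC_inj in E'. lra.
    replace (RtoC t * l)%C with (- - (RtoC t * l))%C by ring. rewrite E. ring. }
  assert (Hftop : forall x, In x tf -> snd x <> e0 -> snd x s <> RtoC 0).
  { intros x Hx E. destruct (Hrf x Hx E) as [t [Ht ->]]. auto. }
  destruct (Hrf x1 Hx1 Nx1) as [t0 [Ht0 Et0]].
  (* Comparison through the fixed term [x1] of [f]: [- t0 * lam = - t * snd y s], so all non-zero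
     frequencies of [A] lie on the ray of [lam]. *)
  assert (HrA : forall y, In y tA -> snd y s <> RtoC 0 -> exists u, 0 < u /\ snd y s = (RtoC u * lam)%C).
  { intros y Hy Ny. destruct (Hdual x1 y Hx1 Nx1 Hy Ny) as [_ [t [Ht Et]]]. exists (t0 / t).
    split; [apply Rdiv_lt_0_compat; lra|]. rewrite Et0 in Et.
    assert (Ht' : RtoC t <> RtoC 0) by (intros E; apply RtoC_inj in E; lra).
    rewrite RtoC_div by lra.
    replace (RtoC t0 / RtoC t * lam)%C with (- (- (RtoC t0 * lam)) / RtoC t)%C by (field; auto). rewrite Et. field; auto. }
  destruct (coefficient_exponents L s tf tA t1 t2 B lam x0 c) as (tB & HvB & HkB & EB); auto.
  { intros x Hx. specialize (Hin2 x Hx). apply in_map_iff in Hin2 as [y [<- Hy]]. auto. }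
  { intros y Hy. destruct (excluded_middle_informative (snd y s = RtoC 0)) as [E|E].
    - exists 0. rewrite E. ring.
    - destruct (HrA y Hy E) as [u [_ Eu]]. exists u; auto. }
  destruct (normal_form L s tf Hcf Hs Hkf) as (twf & Hnrf & Hwf). { exists x1; auto. }
  destruct (normal_form L s tA HcA Hs HkA) as (twA & HnrA & HwA). { exists yA; auto. }
  exists s, c, twf, (esum (s - 1) (frequency_block s tA (RtoC 0))), twA.
  assert (Hwf' : forall w, In w (map fst twf) -> exists x, In x tf /\ snd x <> e0 /\ snd x s = w).
  { intros w Hw. apply Hwf in Hw as [Nw [x [Hx Ex]]]. exists x. repeat split; auto. intros E. apply Nw. rewrite <- Ex, E. reflexivity. }
  assert (HwA' : forall w, In w (map fst twA) -> w <> RtoC 0 /\ exists y, In y tA /\ snd y s = w) by (intros w; apply HwA).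
  destruct (polar_exists lam) as [gam [_ Egam]].
  assert (Hlp : 0 < Cmod lam) by (apply Cmod_gt_0; auto).
  assert (Hdf : dual_freqs (map fst twf) (map fst twA)).
  { exists (gam + PI). split.
    - intros w Hw. destruct (Hwf' w Hw) as (x & Hx & Nx & <-). destruct (Hrf x Hx Nx) as [t [Ht ->]].
      exists (t * Cmod lam). split; [apply Rmult_lt_0_compat; lra|]. fold (cis (gam + PI)). rewrite cis_plus, cis_PI, RtoC_mult.
      rewrite Egam at 1. unfold polar. ring.
    - intros l Hl. destruct (HwA' l Hl) as (Nl & y & Hy & <-). destruct (HrA y Hy Nl) as [u [Hu ->]].
      exists (u * Cmod lam). split; [apply Rmult_lt_0_compat; lra|]. fold (cis (gam + PI + PI)). rewrite !cis_plus, cis_PI, RtoC_mult.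
      rewrite Egam at 1. unfold polar. ring. }
  assert (Hpair : forall w l, In w (map fst twf) -> In l (map fst twA) -> exists t, 1 <= t /\ w = (- (RtoC t * l))%C).
  { intros w l Hw Hl. destruct (Hwf' w Hw) as (x & Hx & Nx & <-). destruct (HwA' l Hl) as (Nl & y & Hy & <-).
    apply (Hdual x y); auto. }
  assert (Hnt1 : t1 <> []).
  { intros E. rewrite E in Hor1. destruct (Hor1 x1 Hx1) as [[]|[E' _]]; auto. }
  assert (HvA := proj1 HcA). assert (Hvf := proj1 Hcf). assert (Hv1 := proj1 Hc1). assert (Hv2 := proj1 Hc2).
  assert (Hx1w : In (snd x1 s) (map fst twf)) by (apply Hwf; split; [apply Hftop; auto | exists x1; auto]).
  assert (Hlamw : In lam (map fst twA)) by (apply HwA; split; [auto | exists yA; auto]).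
  assert (HBtop : forall x, In x tB -> snd x s = RtoC 0) by (intros x Hx; apply HkB; auto; lia).
  assert (Htop_in : forall x, In x tf -> snd x s = RtoC 0 \/ In (snd x s) (map fst twf)).
  { intros x Hx. destruct (excluded_middle_informative (snd x s = RtoC 0)); auto. right. apply Hwf. split; auto. exists x; auto. }
  (* projecting the equation onto the exponents outside the group generated by a common factor *)
  assert (HfA : forall w, commensurable_with w (map fst twf) -> commensurable_with (- w)%C (map fst twA)).
  { intros w Hw. assert (Hw0 := proj1 Hw).
    assert (Hint : forall x, In x tf -> int_multiple w (snd x s)).
    { intros x Hx. destruct (Htop_in x Hx) as [->|Hi]; [apply int_multiple_0 | eapply commensurable_int_multiple; eauto]. }
    assert (Hint1 : forall x, In x t1 -> int_multiple w (snd x s)).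
    { intros x Hx. specialize (Hin1 x Hx). apply in_map_iff in Hin1 as [y [<- Hy]]; auto. }
    assert (Hint2 : forall x, In x t2 -> int_multiple w (snd x s)).
    { intros x Hx. specialize (Hin2 x Hx). apply in_map_iff in Hin2 as [y [<- Hy]]; auto. }
    set (chi := outside s w). assert (Hchi := outside_eadd s w).
    assert (HchiF : forall e : expo, int_multiple w (e s) -> chi e = false) by (intros e He; apply cb_false; tauto).
    (* The terms of [f''] and of [B f] have frequencies in the group and are removed by [chi]; in
       [A f'] the class of a product is that of its factor from [A]. *)
    assert (Htot : forall z, esum L (efilter chi (t2 ++ emul tA t1 ++ emul tB tf)) z = RtoC 0).
    { apply esum_zero_efilter.
      - repeat apply vlist_app; auto; apply vlist_emul; auto.
      - intros z. rewrite !esum_app, !esum_emul, <- EB. apply Heq'. }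
    assert (HA0 : forall y, In y tA -> int_multiple w (snd y s)).
    { apply NNPP; intros Hno. apply not_all_ex_not in Hno as [y Hno]. apply imply_to_and in Hno as [Hy Hno].
      destruct (esum_mult_nonzero L (efilter chi tA) t1) as [z Hz]; auto.
      - apply canonical_efilter; auto.
      - intros E. assert (Hi : In y (efilter chi tA)) by (apply in_efilter; split; auto; apply cb_true; auto).
        rewrite E in Hi; contradiction.
      - apply Hz. specialize (Htot z). rewrite !efilter_app, !esum_app in Htot.
        rewrite (esum_efilter_none L chi t2), (esum_efilter_none L chi (emul tB tf)) in Htot.
        + rewrite (esum_efilter_emul L chi chi) in Htot by (intros; apply Hchi; auto).
          rewrite <- Htot. ring.
        + intros x Hx. destruct (in_emul _ _ _ Hx) as (u & v & Hu & Hv & ->). apply HchiF. unfold eadd.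
          rewrite HBtop by auto. apply int_multiple_plus; [apply int_multiple_0 | auto].
        + intros x Hx. apply HchiF; auto. }
    split.
    { intros E. apply Hw0. replace w with (- - w)%C by ring. rewrite E; ring. }
    intros l Hl. destruct (Hpair _ l Hx1w Hl) as [t [Ht Et]].
    destruct (proj2 Hw _ Hx1w) as [n [Hn En]].
    apply (opposite_multiple w (snd x1 s) l (/ t) n); auto.
    + apply Rinv_0_lt_compat; lra.
    + rewrite Et. rewrite RtoC_inv by lra. field. intros E; apply RtoC_inj in E; lra.
    + destruct (HwA' l Hl) as (_ & y & Hy & <-). auto. }
  assert (HAf : forall w, commensurable_with w (map fst twA) -> commensurable_with (- w)%C (map fst twf)).
  { intros w Hw. assert (Hw0 := proj1 Hw).
    assert (HintA : forall y, In y tA -> int_multiple w (snd y s)).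
    { intros y Hy. destruct (excluded_middle_informative (snd y s = RtoC 0)) as [->|N]; [apply int_multiple_0|].
      eapply commensurable_int_multiple; eauto. apply HwA. split; auto. exists y; auto. }
    set (chi := outside s w). assert (Hchi := outside_eadd s w).
    (* The factors are in the opposite order, because the class of a product is now read from [t1]
       and [tf], the frequencies of [tA] and [tB] being in the group. *)
    assert (Htot : forall z, esum L (efilter chi (t2 ++ emul t1 tA ++ emul tf tB)) z = RtoC 0).
    { apply esum_zero_efilter.
      - repeat apply vlist_app; auto; apply vlist_emul; auto.
      - intros z. rewrite !esum_app, !esum_emul, <- EB, <- (Heq' z). ring. }
    assert (Hf0 : forall x, In x tf -> int_multiple w (snd x s)).
    { apply NNPP; intros Hno. apply not_all_ex_not in Hno as [x Hno]. apply imply_to_and in Hno as [Hx Hno].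
      (* The constant term produced for the projected solution has frequency 0 and cannot pass the
         filter [chi]. *)
      destruct (solution_exponents L s (efilter chi tf) tA B (esum L (efilter chi t1)) (esum L (efilter chi t2))
        (canonical_efilter _ _ _ Hcf)) with (xA := yA) (a := a0) (b := b0) (c0 := c0) as [(u & Hu & Eu & _) _]; auto.
      - intros E. assert (Hi : In x (efilter chi tf)) by (apply in_efilter; split; auto; apply cb_true; auto).
        rewrite E in Hi; contradiction.
      - intros z. rewrite EB. rewrite <- (Htot z). rewrite !efilter_app, !esum_app.
        rewrite (esum_efilter_emul L chi chi t1 tA) by (intros; apply Hchi; auto).
        rewrite (esum_efilter_emul L chi chi tf tB).
        + ring.
        + intros u v Hu Hv. apply Hchi. rewrite HBtop by auto. apply int_multiple_0.
      - apply in_efilter in Hu as [_ Hu]. apply (proj1 (cb_true _)) in Hu. apply Hu. rewrite Eu. apply int_multiple_0. }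
    split.
    { intros E. apply Hw0. replace w with (- - w)%C by ring. rewrite E; ring. }
    intros v Hv. destruct (Hpair v lam Hv Hlamw) as [t [Ht Et]].
    destruct (proj2 Hw _ Hlamw) as [n [Hn En]].
    apply (opposite_multiple w lam v t n); auto; [lra|].
    destruct (Hwf' v Hv) as (x & Hx & _ & <-). auto. }
  split; [|split; [|split; [|split; [|split; [|split]]]]]; auto.
  - destruct Hnrf as (N1 & N2 & N3 & N4 & N5 & N6 & N7). repeat split; auto.
    (* The empty list evaluates to 0 and serves as the zero exponent. *)
    + exists [([c], [])]. split.
      * intros pq [<-|[]]. simpl. lia.
      * intros z. unfold expsum. cbn [fold_right fst snd]. rewrite peval_cons, !peval_nil, cexp_0. ring.
    + apply N6; auto.
    + apply N6; auto.
    (* Every non-zero exponent of [f] has a non-zero coefficient of degree [s], so the block of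
       frequency 0 is the constant [c] alone. *)
    + intros z. rewrite N7. f_equal.
      assert (Ez := esum_frequency_block L s tf (RtoC 0) z Hs Hkf).
      replace (cexp (0 * cpow z s)) with (RtoC 1) in Ez
        by (replace (0 * cpow z s)%C with (RtoC 0) by ring; symmetry; apply cexp_0).
      transitivity (esum L (efilter (fun e => cb (e s = RtoC 0)) tf) z); [rewrite Ez; ring|].
      rewrite <- (esum_constant_term L tf x0 c Hcf Hx0 Ex0 Hx0c z).
      unfold esum, efilter. rewrite !csum_filter. apply csum_ext. intros x Hx.
      replace (cb (snd x s = RtoC 0)) with (cb (snd x = e0)); auto.
      destruct (cb (snd x = e0)) eqn:E; symmetry.
      * apply cb_true. apply (proj1 (cb_true _)) in E. rewrite E. reflexivity.
      * apply cb_false. apply (proj1 (cb_false _)) in E. auto.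
  - replace B with (esum (s - 1) tB).
    + apply esum_expoly. intros x Hx. destruct (HvB x Hx) as [P1 [P2 _]]. split; auto. split; [auto | exact (HkB x Hx)].
    + extensionality z. rewrite EB. symmetry. apply esum_shrink; [lia | auto].
  - split; intros [w Hw]; exists (- w)%C; auto.
  - intros [w Hw]. split; auto. exists w. split; [auto|]. split; [auto|].
    (* [v + l = - (t - 1) * l] points against [lam], and [t >= 1] makes the factor non-negative. *)
    exists (gam + PI). intros v l Hv Hl. destruct (Hpair v l Hv Hl) as [t [Ht ->]].
    destruct (HwA' l Hl) as (Nl & y & Hy & <-). destruct (HrA y Hy Nl) as [u [Hu ->]].
    exists ((t - 1) * u * Cmod lam). split.
    + apply Rmult_le_pos; [apply Rmult_le_pos; lra | lra].
    + fold (cis (gam + PI)). rewrite cis_plus, cis_PI, !RtoC_mult, RtoC_minus. rewrite Egam at 1 2. unfold polar. ring.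
Qed.
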